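(* Let $X_{ij}$ ($1\le i\le n$, $1\le j\le d$), $\mathbf{W}$, $\Sigma$, $\mathbf{Z}$, $Z_i$ be as in the context, and let $P(\mathbf{w})=A+\sum_{i=1}^dB_i|w_i|^{r_i}$ with $A\ge0$, $B_i\ge0$, $r_i\ge0$. Assume that $\mathbb{E}|X_{ij}|^{r_k+3}<\infty$ for all $i,j$ and $1\le k\le d$. Suppose $\Sigma$ is non-negative definite and that $g\in C_P^3(\mathbb{R}^d)$. Then, for $h\in C_b^3(\mathbb{R})$, \begin{align*} &|\mathbb{E}h(g(\mathbf{W}))-\mathbb{E}h(g(\Sigma^{1/2}\mathbf{Z}))|\\ &\le\frac{h_3}{6n^{3/2}}\sum_{i=1}^n\sum_{j,k,l=1}^d\bigg\{A\mathbb{E}|X_{ij}X_{ik}X_{il}|+\sum_{t=1}^d 2^{r_t}B_t\bigg(2^{r_t}\mathbb{E}|X_{ij}X_{ik}X_{il}|\,\mathbb{E}|W_t|^{r_t}\\ &\quad+\frac{2^{r_t}}{n^{r_t/2}}\mathbb{E}\big[|X_{ij}X_{ik}X_{il}||X_{it}|^{r_t}\big]+\mathbb{E}|Z_t|^{r_t}\,\mathbb{E}|X_{ij}X_{ik}X_{il}|\bigg)\\ &\quad+2|\mathbb{E}X_{ij}X_{ik}|\bigg[A\mathbb{E}|X_{il}|+\sum_{t=1}^d 2^{r_t}B_t\bigg(2^{r_t}\mathbb{E}|X_{il}|\,\mathbb{E}|W_t|^{r_t}+\frac{2^{r_t}}{n^{r_t/2}}\mathbb{E}\big[|X_{il}||X_{it}|^{r_t}\big]+\mathbb{E}|Z_t|^{r_t}\,\mathbb{E}|X_{il}|\bigg)\bigg]\bigg\}.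 \end{align*}
   Context: Setting: $X_{ij}$, $1\le i\le n$, $1\le j\le d$, are mean-zero real random variables, not necessarily identically distributed; the vectors $\mathbf{X}_i=(X_{i,1},\ldots,X_{i,d})^T$, $i=1,\ldots,n$, are independent, while for fixed $i$ the components $X_{i,1},\ldots,X_{i,d}$ may be dependent. $W_j=\frac{1}{\sqrt n}\sum_{i=1}^nX_{ij}$, $\mathbf{W}=(W_1,\ldots,W_d)^T$, and $\Sigma=(\sigma_{jk})$ is the covariance matrix of $\mathbf{W}$. $\mathbf{Z}$ is a standard $d$-dimensional normal vector, $\Sigma^{1/2}$ is the unique non-negative definite square root of $\Sigma$, and $Z_i=(\Sigma^{1/2}\mathbf{Z})_i\sim N(0,\sigma_{ii})$. $C_b^k(I)$: real-valued functions on $I$ whose (partial) derivatives of order $k$ all exist and are bounded. A function $g:\mathbb{R}^d\to\mathbb{R}$ is in $C_P^m(\mathbb{R}^d)$, where $P(\mathbf{w})=A+\sum_{i=1}^dB_i|w_i|^{r_i}$ with $A,B_i,r_i\ge0$, if all $m$-th order partial derivatives of $g$ exist and for all $\mathbf{w}\in\mathbb{R}^d$, all $k=1,\ldots,m$ and all indices $i_1,\ldots,i_k$, $\Big|\frac{\partial^kg(\mathbf{w})}{\prod_{j=1}^k\partial w_{i_j}}\Big|^{m/k}\le P(\mathbf{w})$. Further, $h_m=\sum_{j=1}^m{m\brace j}\|h^{(j)}\|$ with $\|\cdot\|$ the supremum norm and ${m\brace j}$ the Stirling numbers of the second kind. *)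

(* Defs.v *)
From HB Require Import structures.
From mathcomp Require Import all_boot all_order all_algebra.
From mathcomp Require Import all_classical all_reals all_analysis.

Set Implicit Arguments.
Unset Strict Implicit.
Unset Printing Implicit Defensive.

Import Order.TTheory GRing.Theory Num.Def Num.Theory.
Import numFieldNormedType.Exports.

Local Open Scope classical_set_scope.
Local Open Scope ring_scope.

Section independence.
Context d d' (T : measurableType d) (T' : measurableType d') (R : realType).

Definition mutually_independent (P : probability T R) (I : finType)
    (X : I -> T -> T') : Prop :=
  forall (J : {set I}) (B : I -> set T'),
    (forall i, i \in J -> measurable (B i)) ->
    P (\bigcap_(i in [set` J]) (X i @^-1` B i)) =
    (\prod_(i in J) fine (P (X i @^-1` B i)))%:E.

End independence.

Section random_vectors.
Context d0 (T : measurableType d0) (R : realType) (P : probability T R).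

(* [d.-tuple R] carries the product sigma-algebra, i.e. the Borel sets of R^d *)
Definition random_vector d (X : 'I_d -> {RV P >-> R}) : T -> d.-tuple R :=
  fun x => [tuple X j x | j < d].

Definition std_normal_vector d (Z : 'I_d -> {RV P >-> R}) : Prop :=
  (forall i A, measurable A -> distribution P (Z i) A = normal_prob 0 1 A) /\
  mutually_independent P (fun i => Z i : T -> R).

Definition normalized_sum n d (X : 'I_n -> 'I_d -> {RV P >-> R}) (j : 'I_d) :
    T -> R :=
  fun x => (Num.sqrt n%:R)^-1 * \sum_(i < n) X i j x.

Definition covariance_mx d (Y : 'I_d -> T -> R) : 'M[R]_d :=
  \matrix_(j, k) fine (covariance P (Y j) (Y k)).

End random_vectors.

Definition nonneg_definite (R : realType) d (M : 'M[R]_d) : Prop :=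
  M^T = M /\ forall x : 'cV[R]_d, 0 <= (x^T *m M *m x) 0 0.

(* this determines S uniquely when M is non-negative definite *)
Definition is_nonneg_sqrt (R : realType) d (M S : 'M[R]_d) : Prop :=
  nonneg_definite S /\ S *m S = M.

Section smooth_classes.
Context (R : realType).

(* derivatives of order 0 to k exist, but only the one of order k is required
   to be bounded *)
Definition Cb (k : nat) (h : R -> R) : Prop :=
  (forall j x, (j < k)%N -> derivable (h^`(j))%classic x 1) /\
  exists M : R, forall x, `|(h^`(k))%classic x| <= M.

Definition iter_partial d (g : 'cV[R]_d -> R) (s : seq 'I_d) : 'cV[R]_d -> R :=
  foldr (fun i f w => 'D_(delta_mx i 0) f w) g s.

Definition CP d (P : 'cV[R]_d -> R) (m : nat) (g : 'cV[R]_d -> R) : Prop :=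
  (forall (s : seq 'I_d) i w, (size s < m)%N ->
     derivable (iter_partial g s) w (delta_mx i 0)) /\
  (forall w (s : seq 'I_d), (1 <= size s <= m)%N ->
     `|iter_partial g s w| `^ (m%:R / (size s)%:R) <= P w).

(* note that 0 `^ 0 = 1 *)
Definition growth d (A : R) (B r : 'I_d -> R) (w : 'cV[R]_d) : R :=
  A + \sum_(i < d) B i * `|w i 0| `^ r i.

(* Stirling numbers of the second kind *)
Fixpoint stirling2 (m j : nat) : nat :=
  match m, j with
  | 0, 0 => 1
  | m'.+1, j'.+1 => j * stirling2 m' j + stirling2 m' j'
  | _, _ => 0
  end%N.

(* extended-real: +oo if f is unbounded *)
Definition sup_norm (f : R -> R) : \bar R :=
  ereal_sup (range (fun x => `|f x|%:E)).

Definition stirling_norm (m : nat) (h : R -> R) : \bar R :=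
  (\sum_(1 <= j < m.+1) (stirling2 m j)%:R%:E * sup_norm (h^`(j))%classic)%E.

End smooth_classes.

(* Main.v *)
Require Import Defs.
From HB Require Import structures.
From mathcomp Require Import all_boot all_order all_algebra.
From mathcomp Require Import all_classical all_reals all_analysis.
From mathcomp Require Import measurable_realfun ring lra.

Set Implicit Arguments.
Unset Strict Implicit.
Unset Printing Implicit Defensive.

Import Order.TTheory GRing.Theory Num.Def Num.Theory.
Import numFieldNormedType.Exports.

Local Open Scope classical_set_scope.
Local Open Scope ring_scope.

(** The test function h o g is compared at both ends of the path
    U(s, c) = s W + c V, where V = S Z is placed on a product space so as to be
    independent of W, and s^2 + c^2 = 1 keeps the covariance of U(s, c) equal to that
    of W.

    Write f = h o g. Moving along the circle from (s, c) to (s + ds, c + dc) changes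
    E f(U) by ds E<W, Df(U)> + dc E<V, Df(U)> up to a quadratic error. Gaussian
    integration by parts (gaussian_image_ibp) gives E<V, Df(U)> = c beta with
    beta = sum_jk sigma_jk E D_jk f(U). For W the same identity holds approximately:
    for each i, a Taylor expansion of D_j f around the mixture U without the i-th
    summand, which is independent of the vector X_i, gives
    E<W, Df(U)> = s beta + O(s^2 K) (lindeberg_estimate). Since s ds + c dc = 0 on the
    circle, beta disappears, and the change of E f(U) is at most K s^2 ds. Integrating
    from s = 0 to s = 1 yields K / 3 (arc_partition, gaussian_comparison). The factor
    1/3, combined with the weights 1/2 and 1 of the two Taylor remainders in K, is the
    factor 1/6 of the theorem.

    The constant K collects the expectations of |X_ij X_ik X_il|, and of |X_il| times
    |E X_ij X_ik|, multiplied by the supremum of the third derivatives of f on the box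
    between U and the mixture. The third derivatives are at most h_3 times the growth
    function (third_order_partials_comp). The remaining point is a uniform bound of
    the r_t-th powers of the t-th coordinate on that box by the moments that occur in
    the theorem (box_moment_bound). If r_t >= 1 the powers are split by convexity, and
    the partial sum is compared with W by Jensen's inequality. If r_t < 1 the function
    |x|^(r_t) is not convex; then the mixture, whose variance is at most that of V_t,
    has r_t-th moment at most the r_t-th power of the standard deviation of V_t, and a
    Gaussian variable satisfies sd^r <= 2^r E|V_t|^r (gaussian_image_moment_ge).

    If h' or h'' is unbounded, then h_3 is infinite and the bound says something only
    when the sum of the brackets vanishes. In that case g(W) and g(V) are almost
    surely equal to g(0) (degenerate_values). *)

(** * Mean value and Taylor estimates from coordinate partial derivatives *)

Section lines.
Context (R : realType).
Implicit Types (V : normedModType R).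

Lemma is_derive_line V (f : V -> R) (u v : V) (t df : R) :
  is_derive (u + t *: v) v f df ->
  is_derive t (1 : R) (fun s : R => f (u + s *: v)) df.
Proof.
have E : (fun h : R => h^-1 *: ((f \o shift (u + t *: v)) (h *: v) - f (u + t *: v)))
       = (fun h : R => h^-1 *: (((fun s : R => f (u + s *: v)) \o shift t) (h *: (1:R)) - f (u + t *: v))).
  apply/funext => h /=; congr (_ *: (f _ - _)).
  by rewrite /shift/= scaler1 scalerDl addrCA.
move=> [dfu Df]; split; first by rewrite /derivable -E.
by rewrite /derive -E.
Qed.

Lemma is_derive_of_line V (f : V -> R) (u v : V) (df : R) :
  is_derive (0 : R) (1 : R) (fun s : R => f (u + s *: v)) df ->
  is_derive u v f df.
Proof.
have E : (fun h : R => h^-1 *: ((f \o shift u) (h *: v) - f u))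
       = (fun h : R => h^-1 *: (((fun s : R => f (u + s *: v)) \o shift 0) (h *: (1:R)) - f (u + 0 *: v))).
  apply/funext => h /=; congr (_ *: (f _ - f _)).
    by rewrite /shift/= scaler1 addr0 addrC.
  by rewrite scale0r addr0.
move=> [dfu Df]; split; first by rewrite /derivable E.
by rewrite /derive E.
Qed.

(** The hypotheses make b - q and b + q nondecreasing on [x0, x1], so the mean value
    theorem applies to each of them. The bound db need not be constant: the
    Taylor estimates below integrate a bound that grows along the segment. *)
Lemma mean_value_bound (q b dq db : R -> R) (x0 x1 : R) : x0 <= x1 ->
  (forall x, is_derive x (1 : R) q (dq x)) ->
  (forall x, is_derive x (1 : R) b (db x)) ->
  (forall x, x0 <= x <= x1 -> `|dq x| <= db x) ->
  `|q x1 - q x0| <= b x1 - b x0.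
Proof.
move=> x01 hq hb hle.
have cont (f df : R -> R) : (forall x, is_derive x (1 : R) f (df x)) ->
    {within `[x0, x1], continuous f}.
  move=> hf; apply: derivable_within_continuous => x _; exact: (@ex_derive _ _ _ _ _ _ _ (hf x)).
have [c /[!in_itv]/= cI] := MVT_segment x01 (fun x _ => is_deriveB (hb x) (hq x))
  (cont _ _ (fun x => is_deriveB (hb x) (hq x))).
have [c' /[!in_itv]/= cI'] := MVT_segment x01 (fun x _ => is_deriveD (hb x) (hq x))
  (cont _ _ (fun x => is_deriveD (hb x) (hq x))).
rewrite /= => e1 e2.
have := hle _ cI; have := hle _ cI'.
rewrite !ler_norml => /andP[h1 h2] /andP[h3 h4].
have h5 : 0 <= (db c - dq c) * (x1 - x0) by apply: mulr_ge0; lra.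
have h6 : 0 <= (db c' + dq c') * (x1 - x0) by apply: mulr_ge0; lra.
move: e1 e2; rewrite !fctE => e1 e2.
by apply/andP; split; lra.
Qed.

End lines.

Section boxes.
Context (R : realType) (d : nat).
Local Notation V := 'cV[R]_d.
Implicit Types (u v w y : V) (f : V -> R).

Definition e_ (i : 'I_d) : V := delta_mx i 0.

(** The closed box spanned by the coordinatewise displacements |y_t| around u. A
    growth condition that is a sum of functions of single coordinates is
    estimated coordinate by coordinate on such a box, which a norm ball would
    not permit. *)
Definition box u y : set V := [set v | forall t, `|v t 0 - u t 0| <= `|y t 0|].

Definition norm1 y : R := \sum_i `|y i 0|.

Lemma norm1_ge0 y : 0 <= norm1 y.
Proof. by apply: sumr_ge0. Qed.

Lemma coord_le_norm1 y t : `|y t 0| <= norm1 y.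
Proof. by rewrite /norm1 (bigD1 t)//= lerDl sumr_ge0. Qed.

(** Corners of the staircase from u to u + y that changes one coordinate at a
    time: it stays in the box and needs only partial derivatives. *)
Let path u y (k : nat) : V :=
  \col_j (if (j < k)%N then u j 0 + y j 0 else u j 0).

Let path0 u y : path u y 0 = u.
Proof. by apply/matrixP => i j; rewrite mxE ltn0 ord1. Qed.

Let path_max u y : path u y d = u + y.
Proof. by apply/matrixP => i j; rewrite !mxE ltn_ord ord1. Qed.

Let pathS u y (k : 'I_d) : path u y k.+1 = path u y k + y k 0 *: e_ k.
Proof.
apply/matrixP => i j; rewrite !mxE !ord1 eqxx andbT ltnS leq_eqVlt.
have [->|ik] := eqVneq i k; first by rewrite eqxx ltnn/= mulr1.
have -> : (i == k :> nat) = false by apply/negbTE.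
by rewrite /= mulr0 addr0.
Qed.

Let path_in u y (k : 'I_d) (t : R) : 0 <= t <= 1 ->
  box u y (path u y k + (t * y k 0) *: e_ k).
Proof.
move=> /andP[t0 t1] i; rewrite !mxE eqxx andbT.
have [->|ik] := eqVneq i k.
  by rewrite ltnn /= mulr1 addrAC subrr add0r normrM ger0_norm// ler_piMl.
rewrite /= mulr0 addr0; case: ifP => _; last by rewrite subrr normr0.
by rewrite addrAC subrr add0r.
Qed.

Let path_dist u y (k : 'I_d) (t : R) : 0 <= t <= 1 ->
  norm1 (path u y k + (t * y k 0) *: e_ k - u) <=
  \sum_(l < d | (l < k)%N) `|y l 0| + t * `|y k 0|.
Proof.
move=> /andP[t0 t1]; rewrite /norm1.
rewrite (bigID (fun l : 'I_d => (l < k)%N))/= lerD//.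
  apply: ler_sum => i ik; rewrite !mxE ik eqxx andbT.
  have -> : (i == k) = false by apply/negbTE; rewrite neq_ltn ik.
  by rewrite mulr0 addr0 addrAC subrr add0r.
rewrite (bigD1 k) ?ltnn//= !mxE ltnn !eqxx /= mulr1 [X in `|X| + _]addrAC subrr add0r.
rewrite normrM (ger0_norm t0) -[leRHS]addr0 lerD2l big1// => i /andP[/negbTE ki /negbTE ik].
by rewrite !mxE ki ik /= mulr0 addr0 subrr normr0.
Qed.

Lemma box_sub u y v w : box u y v -> (forall t, `|w t 0 - u t 0| <= `|v t 0 - u t 0|) ->
  box u y w.
Proof. by move=> hv hw t; apply: le_trans (hw t) (hv t). Qed.

(** Each step of the staircase is a one-variable mean value estimate in a coordinate
    direction. *)
Lemma box_Lipschitz f (D : 'I_d -> V -> R) u y (M : R) :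
  (forall i w, is_derive w (e_ i) f (D i w)) ->
  (forall v i, box u y v -> `|D i v| <= M) ->
  `|f (u + y) - f u| <= M * norm1 y.
Proof.
move=> hD hM; rewrite -{1}path_max -[in X in _ - X](path0 u y).
rewrite -(telescope_sumr (fun k => f (path u y k)) (leq0n d)) big_mkord.
rewrite /norm1 mulr_sumr; apply: (le_trans (ler_norm_sum _ _ _)).
apply: ler_sum => k _.
pose q (s : R) := f (path u y k + s *: (y k 0 *: e_ k)).
have q1 : q 1 = f (path u y k.+1) by rewrite /q scale1r -pathS.
have q0 : q 0 = f (path u y k) by rewrite /q scale0r addr0.
rewrite -q1 -q0.
have -> : M * `|y k 0| = (M * `|y k 0|) *: (1:R) - (M * `|y k 0|) *: (0:R).
  by rewrite scaler0 subr0 /GRing.scale/= mulr1.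
pose dq (s : R) := y k 0 * D k (path u y k + s *: (y k 0 *: e_ k)).
apply: (@mean_value_bound _ q (fun s => (M * `|y k 0|) *: s) dq
  (fun _ => (M * `|y k 0|) *: (1 : R))) => //.
- move=> s.
  pose p (a : R) := f (path u y k + a *: e_ k).
  have hp : is_derive (s * y k 0) (1:R) p (D k (path u y k + (s * y k 0) *: e_ k)).
    exact/is_derive_line.
  have hg : is_derive s (1:R) (fun s : R => s * y k 0) (y k 0).
    apply: is_derive_eq; by rewrite scaler0 add0r /GRing.scale/= mulr1.
  have hq := @is_derive1_comp _ p (fun s : R => s * y k 0) s _ _ hp hg.
  rewrite /q /dq scalerA.
  have -> : (fun s0 : R => f (path u y k + s0 *: (y k 0 *: e_ k))) = p \o (fun s : R => s * y k 0).
    by apply/funext => a /=; rewrite /p scalerA.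
  by rewrite mulrC; exact: hq.
- move=> s s01; rewrite /dq scalerA normrM mulrC /GRing.scale/= mulr1.
  by rewrite ler_wpM2r// hM//; apply: path_in.
Qed.

(** On the k-th step of the staircase the derivative of f differs from its value
    at u by at most M times the distance already travelled (box_Lipschitz
    applied to the partial derivatives); integrating this along the staircase
    gives half the square of the total length. *)
Lemma box_Taylor f (D : 'I_d -> V -> R) (DD : 'I_d -> 'I_d -> V -> R) u y (M : R) :
  0 <= M ->
  (forall i w, is_derive w (e_ i) f (D i w)) ->
  (forall i j w, is_derive w (e_ j) (D i) (DD i j w)) ->
  (forall v i j, box u y v -> `|DD i j v| <= M) ->
  `|f (u + y) - f u - \sum_i y i 0 * D i u| <= M / 2 * norm1 y ^+ 2.
Proof.
move=> M0 hD hDD hM; rewrite -{1}path_max -[in X in _ - X - _](path0 u y).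
rewrite -(telescope_sumr (fun k => f (path u y k)) (leq0n d)) big_mkord -sumrB.
pose S k := \sum_(l < d | (l < k)%N) `|y l 0|.
have Sd : norm1 y ^+ 2 = S d ^+ 2 - S 0%N ^+ 2.
  rewrite /S [X in _ - X ^+ 2]big_pred0 // expr0n subr0 /norm1.
  by congr (_ ^+ 2); apply: eq_bigl => i; rewrite ltn_ord.
have SS (k : 'I_d) : S k.+1 = S k + `|y k 0|.
  rewrite /S (bigD1 k)//= addrC; congr (_ + _); apply: eq_bigl => i.
  by rewrite ltnS [RHS]ltn_neqAle andbC.
rewrite Sd -(telescope_sumr (fun k => S k ^+ 2) (leq0n d)) big_mkord mulr_sumr.
apply: (le_trans (ler_norm_sum _ _ _)).
apply: ler_sum => k _; rewrite SS.
pose q (s : R) := f (path u y k + s *: (y k 0 *: e_ k)) - s * (y k 0 * D k u).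
have q1 : q 1 = f (path u y k.+1) - y k 0 * D k u by rewrite /q scale1r -pathS mul1r.
have q0 : q 0 = f (path u y k) by rewrite /q scale0r addr0 mul0r subr0.
have -> : f (path u y k.+1) - f (path u y k) - y k 0 * D k u = q 1 - q 0.
  by rewrite q1 q0; ring.
pose b (s : R) := M * `|y k 0| * (s * S k + s ^+ 2 * `|y k 0| / 2).
have -> : M / 2 * ((S k + `|y k 0|) ^+ 2 - S k ^+ 2) = b 1 - b 0 by rewrite /b; field.
pose dq (s : R) := y k 0 * (D k (path u y k + s *: (y k 0 *: e_ k)) - D k u).
pose db (s : R) := M * `|y k 0| * (S k + s * `|y k 0|).
apply: (@mean_value_bound _ q b dq db) => //.
- move=> s.
  pose p (a : R) := f (path u y k + a *: e_ k).
  have hp : is_derive (s * y k 0) (1:R) p (D k (path u y k + (s * y k 0) *: e_ k)).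
    exact/is_derive_line.
  have hg : is_derive s (1:R) (fun s : R => s * y k 0) (y k 0).
    apply: is_derive_eq; by rewrite scaler0 add0r /GRing.scale/= mulr1.
  have hq := @is_derive1_comp _ p (fun s : R => s * y k 0) s _ _ hp hg.
  have hl : is_derive s (1:R) (fun s : R => s * (y k 0 * D k u)) (y k 0 * D k u).
    apply: is_derive_eq; by rewrite scaler0 add0r /GRing.scale/= mulr1.
  have -> : q = (p \o (fun s : R => s * y k 0)) - (fun s : R => s * (y k 0 * D k u)).
    by apply/funext => a; rewrite !fctE /q /= /p scalerA.
  have -> : dq s = D k (path u y k + (s * y k 0) *: e_ k) * y k 0 - y k 0 * D k u.
    by rewrite /dq scalerA mulrBr mulrC.
  exact: is_deriveB.
- move=> s; apply: is_derive_eq.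
  by rewrite /db /GRing.scale/= !mulr0 !mulr1 !add0r; field.
- move=> s s01; rewrite /dq normrM mulrC /db mulrAC ler_wpM2r//.
  rewrite scalerA -[X in D k X - _](addrNK u) [X in D k X - _]addrC.
  set y' := (_ - u).
  have hin : box u y (u + y') by rewrite /y' addrC addrNK; apply: path_in.
  apply: (@le_trans _ _ (M * norm1 y')).
    apply: (@box_Lipschitz (D k) (DD k)) => // v i hv.
    apply: hM; apply: (box_sub hin) => t; apply: le_trans (hv t) _.
    by rewrite [(u + y') t 0]mxE addrAC subrr add0r.
  by rewrite ler_wpM2l//; exact: path_dist.
Qed.

End boxes.

(** * Functions of polynomial growth *)

Section polynomial_growth.
Context (R : realType) (d : nat).
Local Notation V := 'cV[R]_d.
Implicit Types (u v w y : V) (f : V -> R).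

(** Polynomial growth of order q. The exponents r_k of the theorem are real, so
    the order is a real number. *)
Definition pgrowth (q : R) f :=
  exists2 C : R, 0 <= C & forall w, `|f w| <= C * (1 + norm1 w) `^ q.

Lemma one_norm1_ge1 w : 1 <= 1 + norm1 w.
Proof. by rewrite lerDl norm1_ge0. Qed.

Lemma pgrowth_unif (I : finType) q (F : I -> V -> R) :
  (forall i, pgrowth q (F i)) ->
  exists2 C : R, 0 <= C & forall i w, `|F i w| <= C * (1 + norm1 w) `^ q.
Proof.
move=> hF.
have /choice[C hC] : forall i, exists C : R, 0 <= C /\
    forall w, `|F i w| <= C * (1 + norm1 w) `^ q.
  by move=> i; have [C C0 hC] := hF i; exists C.
exists (\sum_i C i); first by apply: sumr_ge0 => i _; have [] := hC i.
move=> i w; have [_ /(_ w) h] := hC i; apply: le_trans h _.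
rewrite ler_wpM2r ?powR_ge0// (bigD1 i)//= lerDl sumr_ge0// => j _.
by have [] := hC j.
Qed.

Lemma norm1_box u y v : box u y v -> norm1 v <= norm1 u + norm1 y.
Proof.
move=> hv; rewrite /norm1 -big_split/=; apply: ler_sum => i _.
have := ler_normD (v i 0 - u i 0) (u i 0); rewrite subrK => h.
by rewrite (le_trans h)// [leRHS]addrC lerD2r; exact: hv.
Qed.

Lemma growth_box u y v (q C : R) f : 0 <= q -> 0 <= C ->
  (forall w, `|f w| <= C * (1 + norm1 w) `^ q) -> box u y v ->
  `|f v| <= C * (1 + norm1 u + norm1 y) `^ q.
Proof.
move=> q0 C0 hf hv; apply: le_trans (hf v) _.
rewrite ler_wpM2l// ge0_ler_powR ?nnegrE ?addr_ge0 ?norm1_ge0//.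
by rewrite -addrA lerD2l norm1_box.
Qed.

Lemma norm1_le_norm y : norm1 y <= d%:R * `|y|.
Proof.
rewrite /norm1 mulr_natl -[X in _ *+ X]card_ord -sumr_const; apply: ler_sum => i _.
rewrite [leRHS]/normr/= mx_normrE; exact: (le_bigmax _ (fun p : 'I_d * 'I_1 => `|y p.1 p.2|) (i, 0)).
Qed.

(** Coordinate partial derivatives of polynomial growth are locally bounded, hence
    f is locally Lipschitz by box_Lipschitz. *)
Lemma pgrowth_continuous f (D : 'I_d -> V -> R) q : 0 <= q ->
  (forall i w, is_derive w (e_ R i) f (D i w)) ->
  (forall i, pgrowth q (D i)) -> continuous f.
Proof.
move=> q0 hD /pgrowth_unif[C C0 hC] u.
pose M := C * (1 + norm1 u + d%:R) `^ q + 1.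
have M0 : 0 < M by rewrite ltr_pwDr// mulr_ge0// powR_ge0.
apply/(@cvgrPdist_le _ _ _ (nbhs u) (nbhs_filter u)) => e e0.
have h0 : 0 < Num.min 1 (e / (M * (d%:R + 1))).
  by rewrite lt_min ltr01 divr_gt0// mulr_gt0// ltr_pwDr.
near=> v.
have : `|u - v| <= Num.min 1 (e / (M * (d%:R + 1))).
  by near: v; apply: cvgr_dist_le.
rewrite le_min => /andP[v1 v2].
rewrite distrC -{1}[v](subrK u) [X in f X]addrC.
have n1 : norm1 (v - u) <= d%:R * `|u - v| by rewrite [`|u - v|]distrC norm1_le_norm.
have hb : `|f (u + (v - u)) - f u| <= M * norm1 (v - u).
  apply: (@box_Lipschitz R d f D) => // w i hw.
  rewrite /M ler_wpDr//; apply: (le_trans (growth_box q0 C0 (hC i) hw)).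
  rewrite ler_wpM2l// ge0_ler_powR ?nnegrE ?addr_ge0 ?norm1_ge0//.
  by rewrite lerD2l (le_trans n1)// -[leRHS]mulr1 ler_wpM2l.
apply: (le_trans hb); apply: (@le_trans _ _ (M * ((d%:R + 1) * `|u - v|))).
  by rewrite ler_pM2l// (le_trans n1)// ler_wpM2r// lerDl.
by rewrite mulrA mulrC -ler_pdivlMr// mulr_gt0// ltr_pwDr.
Unshelve. all: by end_near. Qed.

(** box_Taylor at h *: v has an error quadratic in h, which identifies every
    directional derivative from the coordinate ones. This is the chain rule
    needed to differentiate along the linear map z |-> S z. *)
Lemma is_derive_direction f (D : 'I_d -> V -> R) (DD : 'I_d -> 'I_d -> V -> R) q w v :
  0 <= q ->
  (forall i w, is_derive w (e_ R i) f (D i w)) ->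
  (forall i j w, is_derive w (e_ R j) (D i) (DD i j w)) ->
  (forall i j, pgrowth q (DD i j)) ->
  is_derive w v f (\sum_i v i 0 * D i w).
Proof.
move=> q0 hD hDD hg.
have [C C0 hC] := @pgrowth_unif ('I_d * 'I_d)%type q (fun p => DD p.1 p.2)
  (fun p => hg p.1 p.2).
pose M := C * (1 + norm1 w + norm1 v) `^ q.
have M0 : 0 <= M by rewrite mulr_ge0// powR_ge0.
have key (h : R) : `|h| <= 1 ->
    `|f (w + h *: v) - f w - h * \sum_i v i 0 * D i w| <= M / 2 * norm1 v ^+ 2 * h ^+ 2.
  move=> h1.
  have nhv : norm1 (h *: v) = `|h| * norm1 v.
    by rewrite /norm1 mulr_sumr; apply: eq_bigr => i _; rewrite mxE normrM.
  have := @box_Taylor R d f D DD w (h *: v) M M0 hD hDD.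
  rewrite nhv exprMn real_normK ?num_real// mulrA [X in _ <= X]mulrAC.
  rewrite mulr_sumr; under eq_bigr do rewrite mxE -mulrA.
  apply => z i j hz; apply: (le_trans (growth_box q0 C0 (hC (i, j)) hz)).
  rewrite ler_wpM2l// ge0_ler_powR ?nnegrE ?addr_ge0 ?norm1_ge0//.
  by rewrite lerD2l nhv ler_piMl ?norm1_ge0.
have cv : h^-1 *: ((f \o shift w) (h *: v) - f w) @[h --> (0:R)^'] --> (\sum_i v i 0 * D i w).
  apply/cvgrPdist_le => e e0.
  pose K := M / 2 * norm1 v ^+ 2 + 1.
  have K0 : 0 < K by rewrite ltr_pwDr// mulr_ge0 ?sqr_ge0// divr_ge0.
  have e1 : 0 < Num.min 1 (e / K) by rewrite lt_min ltr01 divr_gt0.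
  near=> h.
  have hn0 : h != 0 by near: h; exact: nbhs_dnbhs_neq.
  have hle : `|h| <= Num.min 1 (e / K).
    by near: h; exact: dnbhs0_le.
  move: hle; rewrite le_min => /andP[h1 h2].
  rewrite distrC /= /shift/= [h *: v + w]addrC.
  rewrite -[X in _ - X](mulKf hn0) [h^-1 *: (f _ - f w)]/GRing.scale/= -mulrBr normrM normfV.
  rewrite ler_pdivrMl ?normr_gt0//; apply: (le_trans (key h h1)).
  rewrite -[h ^+ 2]real_normK ?num_real// [`|h| ^+ 2]expr2 mulrA [leLHS]mulrC ler_wpM2l//.
  apply: (@le_trans _ _ (K * `|h|)); first by rewrite ler_wpM2r// /K lerDl.
  by rewrite mulrC -ler_pdivlMr.
split; first by apply/cvg_ex; eexists; exact: cv.
by apply: cvg_lim.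
Unshelve. all: by end_near. Qed.

End polynomial_growth.

(** * Third-order partial derivatives of a composition *)

Lemma is_derive_comp1 (R : realType) (V : normedModType R) (h : R -> R) (g : V -> R)
    (w v : V) (dh dg : R) :
  is_derive (g w) (1 : R) h dh -> is_derive w v g dg ->
  is_derive w v (h \o g) (dh * dg).
Proof.
move=> hh hg; apply: is_derive_of_line.
have hg' : is_derive (0 : R) (1 : R) (fun s : R => g (w + s *: v)) dg.
  by apply: is_derive_line; rewrite scale0r addr0.
have hh' : is_derive ((fun s : R => g (w + s *: v)) 0) (1 : R) h dh.
  by rewrite scale0r addr0.
exact: (@is_derive1_comp _ h (fun s : R => g (w + s *: v)) 0 _ _ hh' hg').
Qed.

Section third_order.
Context (R : realType) (d : nat).
Local Notation V := 'cV[R]_d.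

(** Explicit partial derivatives in place of iterated derive operators: this form
    survives composition with h and is what the Taylor lemmas consume. *)
Definition third_order_partials (f : V -> R) (D1 : 'I_d -> V -> R)
    (D2 : 'I_d -> 'I_d -> V -> R) (D3 : 'I_d -> 'I_d -> 'I_d -> V -> R) : Prop :=
  [/\ forall i w, is_derive w (e_ R i) f (D1 i w),
      forall i j w, is_derive w (e_ R j) (D1 i) (D2 i j w) &
      forall i j k w, is_derive w (e_ R k) (D2 i j) (D3 i j k w)].

Lemma powR_cancel (x y a b : R) : 0 <= x -> 0 <= y -> 0 <= b -> a * b = 1 ->
  x `^ a <= y -> x <= y `^ b.
Proof.
move=> x0 y0 b0 ab h.
have : (x `^ a) `^ b <= y `^ b by rewrite ge0_ler_powR// nnegrE powR_ge0.
by rewrite -powRrM ab powRr1.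
Qed.

(** The exponents 3/k in the definition of the class say that derivatives of order
    k are bounded by the k-th power of p = P ^ (1/3). This homogeneous form is
    stable under the chain rule. *)
Lemma CP_third_order_partials (P : V -> R) (g : V -> R) :
  (forall w, 0 <= P w) -> CP P 3 g ->
  exists D1 D2 D3, third_order_partials g D1 D2 D3 /\
   forall i j k w,
    [/\ `|D1 i w| <= P w `^ 3^-1, `|D2 i j w| <= (P w `^ 3^-1) ^+ 2 &
        `|D3 i j k w| <= P w].
Proof.
move=> P0 [hder hbd].
exists (fun i => iter_partial g [:: i]), (fun i j => iter_partial g [:: j; i]),
  (fun i j k => iter_partial g [:: k; j; i]); split.
  split=> [i w|i j w|i j k w].
  - exact: derivableP (hder [::] i w isT).
  - exact: derivableP (hder [:: i] j w isT).
  - exact: derivableP (hder [:: j; i] k w isT).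
move=> i j k w; split.
- apply: (powR_cancel _ _ _ _ (hbd w [:: i] isT)) => //=.
  by rewrite invr1 mulr1 mulfV.
- rewrite -powR_mulrn ?powR_ge0// -powRrM.
  apply: (powR_cancel _ _ _ _ (hbd w [:: j; i] isT)) => //=.
  by field.
- have := hbd w [:: k; j; i] isT.
  by rewrite divff ?powRr1// pnatr_eq0.
Qed.

(** Faa di Bruno's formula up to order three. With derivatives of g of order k
    bounded by p ^ k, every term of the third derivative is bounded by p ^ 3, and
    the numbers of terms are the Stirling numbers 1, 3, 1: this is where the
    constant h_3 comes from. *)
Lemma third_order_partials_comp (h h1 h2 h3 : R -> R) (b1 b2 b3 : R) (p : V -> R)
    (g : V -> R) D1 D2 D3 :
  0 <= b1 -> 0 <= b2 -> 0 <= b3 -> (forall w, 0 <= p w) ->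
  (forall x, is_derive x (1 : R) h (h1 x)) ->
  (forall x, is_derive x (1 : R) h1 (h2 x)) ->
  (forall x, is_derive x (1 : R) h2 (h3 x)) ->
  (forall x, `|h1 x| <= b1) -> (forall x, `|h2 x| <= b2) -> (forall x, `|h3 x| <= b3) ->
  third_order_partials g D1 D2 D3 ->
  (forall i j k w,
    [/\ `|D1 i w| <= p w, `|D2 i j w| <= p w ^+ 2 & `|D3 i j k w| <= p w ^+ 3]) ->
  exists E1 E2 E3, third_order_partials (h \o g) E1 E2 E3 /\
   forall i j k w,
    [/\ `|E1 i w| <= b1 * p w, `|E2 i j w| <= (b2 + b1) * p w ^+ 2 &
        `|E3 i j k w| <= (b1 + 3 * b2 + b3) * p w ^+ 3].
Proof.
move=> b10 b20 b30 p0 dh dh1 dh2 hb1 hb2 hb3 [g1 g2 g3] hg.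
pose E1 i w := h1 (g w) * D1 i w.
pose E2 i j w := h1 (g w) * D2 i j w + D1 i w * (h2 (g w) * D1 j w).
pose E3 i j k w := (h1 (g w) * D3 i j k w + D2 i j w * (h2 (g w) * D1 k w)) +
   (D1 i w * (h2 (g w) * D2 j k w + D1 j w * (h3 (g w) * D1 k w)) +
    (h2 (g w) * D1 j w) * D2 i k w).
exists E1, E2, E3; split.
  split=> [i w|i j w|i j k w].
  - exact: is_derive_comp1.
  - exact: (is_deriveM (is_derive_comp1 (dh1 _) (g1 j w)) (g2 i j w)).
  - have t1 := is_deriveM (is_derive_comp1 (dh1 _) (g1 k w)) (g3 i j k w).
    have t2 := is_deriveM (is_derive_comp1 (dh2 _) (g1 k w)) (g2 j k w).
    have t3 := is_deriveM (g2 i k w) t2.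
    exact: (is_deriveD t1 t3).
move=> i j k w.
have [D1i D2ij D3ijk] := hg i j k w.
have [D1j D2jk _] := hg j k k w.
have [D1k D2ik _] := hg k k k w; have [_ {}D2ik _] := hg i k k w.
have := hb1 (g w); have := hb2 (g w); have := hb3 (g w).
move=> H3 H2 H1; have pw := p0 w.
have bndM (a b x y : R) : `|a| <= x -> `|b| <= y -> `|a * b| <= x * y.
  by move=> ha hb; rewrite normrM ler_pM.
have bndD (a b x y : R) : `|a| <= x -> `|b| <= y -> `|a + b| <= x + y.
  by move=> ha hb; rewrite (le_trans (ler_normD _ _))// lerD.
split.
- exact: (bndM).
- have -> : (b2 + b1) * p w ^+ 2 = b1 * p w ^+ 2 + p w * (b2 * p w) by ring.
  by apply: (bndD); [exact: (bndM)|apply: (bndM) => //; exact: (bndM)].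
- have -> : (b1 + 3 * b2 + b3) * p w ^+ 3 = (b1 * p w ^+ 3 + p w ^+ 2 * (b2 * p w))
      + (p w * (b2 * p w ^+ 2 + p w * (b3 * p w)) + (b2 * p w) * p w ^+ 2) by ring.
  apply: (bndD); apply: (bndD); apply: (bndM) => //; first exact: (bndM).
    by apply: (bndD); [exact: (bndM)|apply: (bndM) => //; exact: (bndM)].
  exact: (bndM).
Qed.

Lemma growth_ge0 A (B r : 'I_d -> R) w : 0 <= A -> (forall i, 0 <= B i) ->
  0 <= growth A B r w.
Proof.
by move=> A0 B0; rewrite addr_ge0// sumr_ge0// => i _; rewrite mulr_ge0// powR_ge0.
Qed.

Lemma powR_coord_growth (q s : R) (i : 'I_d) (w : V) : 0 <= s -> s <= q ->
  `|w i 0| `^ s <= (1 + norm1 w) `^ q.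
Proof.
move=> s0 sq; apply: (@le_trans _ _ ((1 + norm1 w) `^ s)).
  rewrite ge0_ler_powR// ?nnegrE ?addr_ge0 ?norm1_ge0//.
  by rewrite (le_trans (coord_le_norm1 w i))// lerDr.
by rewrite ler_powR// one_norm1_ge1.
Qed.

Lemma pgrowth_growth A (B r : 'I_d -> R) q : 0 <= A -> (forall i, 0 <= B i) ->
  0 <= q -> (forall i, 0 <= r i) -> (forall i, r i <= q) -> pgrowth q (growth A B r).
Proof.
move=> A0 B0 q0 r0 rq; exists (A + \sum_i B i).
  by rewrite addr_ge0// sumr_ge0.
move=> w; rewrite ger0_norm ?growth_ge0// mulrDl lerD//.
  rewrite -{1}[A]mulr1 ler_wpM2l//.
  by have := ler_powR (one_norm1_ge1 w) q0; rewrite powRr0.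
rewrite mulr_suml; apply: ler_sum => i _.
by rewrite ler_wpM2l// powR_coord_growth.
Qed.

Lemma pgrowth_le (f p : V -> R) q c :
  0 <= c -> (forall w, `|f w| <= c * p w) -> pgrowth q p -> pgrowth q f.
Proof.
move=> c0 hf [C C0 hC]; exists (c * C); first exact: mulr_ge0.
move=> w; rewrite (le_trans (hf w))// -mulrA ler_wpM2l//.
by rewrite (le_trans (ler_norm _)).
Qed.

End third_order.

(** * Measurability of continuous functions of random vectors *)

Section measurability_of_continuous.
Context (R : realType) (n : nat) (d : measure_display) (T : measurableType d).
Implicit Types (a : 'I_n -> T -> R) (f : 'cV[R]_n -> R).

Let floors (m : nat) a (x : T) : {ffun 'I_n -> int} :=
  [ffun j => Num.floor (m.+1%:R * a j x)].

Let floors_measurable m a (c : {ffun 'I_n -> int}) :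
  (forall j, measurable_fun setT (a j)) ->
  measurable [set x | floors m a x = c].
Proof.
move=> ma.
have -> : [set x | floors m a x = c] = \bigcap_(j in [set: 'I_n])
    ((fun x => m.+1%:R * a j x) @^-1` `[(c j)%:~R, (c j + 1)%:~R[%classic).
  apply/seteqP; split => x /=.
    by move=> <- j _ /=; rewrite ffunE in_itv/= floor_itv.
  move=> h; apply/ffunP => j; rewrite ffunE; apply/floor_def.
  by have := h j I; rewrite /= in_itv.
apply: fin_bigcap_measurable => // j _; rewrite -[X in measurable X]setTI.
by apply: measurable_funM => //; exact: measurable_itv.
Qed.

(** f of the random vector is the limit of its values at the grid points obtained
    by rounding the coordinates down to multiples of 1 / (m + 1); each of these
    approximations is constant on countably many measurable pieces. *)
Lemma measurable_continuous_col a f : (forall j, measurable_fun setT (a j)) ->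
  continuous f -> measurable_fun setT (fun x => f (\col_j a j x)).
Proof.
move=> ma cf.
pose F m x := f (\col_j ((floors m a x j)%:~R / m.+1%:R)).
apply: (@measurable_fun_cvg _ _ _ _ F) => [m|x _]; last first.
  apply: (@cvg_comp _ _ _ (fun m => \col_j ((floors m a x j)%:~R / m.+1%:R)) f
    _ (nbhs (\col_j a j x))); last exact: cf.
  apply/cvgrPdist_le => e e0; near=> m.
  rewrite [leLHS]/normr/= mx_normrE; apply: bigmax_le; first exact: ltW.
  move=> [i j] _ /=; rewrite !mxE ffunE.
  have m0 : (0 : R) < m.+1%:R by rewrite ltr0n.
  have := floor_itv (m.+1%:R * a i x); set k := Num.floor _.
  rewrite intrD => /andP[h1 h2].
  have -> : a i x - k%:~R / m.+1%:R = (m.+1%:R * a i x - k%:~R) / m.+1%:R.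
    by field; rewrite -natr1 in m0 *; rewrite gt_eqF.
  rewrite normrM [`|_^-1|]gtr0_norm ?invr_gt0// ler_pdivrMr// ger0_norm ?subr_ge0//.
  apply: (@le_trans _ _ 1); first by lra.
  rewrite mulrC -ler_pdivrMr// div1r.
  near: m; exists (Num.trunc (e^-1)) => // m /= hm.
  apply/ltW/(lt_le_trans (truncnS_gt e^-1)).
  by rewrite ler_nat ltnS.
move=> _ B mB; rewrite setTI.
pose g (c : {ffun 'I_n -> int}) := f (\col_j ((c j)%:~R / m.+1%:R)).
have -> : F m @^-1` B = \bigcup_(c in [set c | B (g c)]) [set x | floors m a x = c].
  apply/seteqP; split => x /=.
    by move=> h; exists (floors m a x).
  by move=> [c Bc e]; rewrite /F e.
rewrite bigcup_mkcond; apply: countable_bigcupT_measurable; first exact: countableP.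
by move=> c; case: ifP => _; [exact: floors_measurable|exact: measurable0].
Unshelve. all: by end_near. Qed.

End measurability_of_continuous.

(** * Replacing one member of an independent family by a copy *)

Section decoupling.
Context (R : realType) (d d1 : measure_display) (T : measurableType d)
  (T1 : measurableType d1) (P : probability T R) (n : nat) (X : 'I_n -> T -> T1).
Hypotheses (mX : forall k, measurable_fun setT (X k))
  (indepX : mutually_independent P X).
Variable i : 'I_n.

Definition family_tuple (x : T) : n.-tuple T1 := [tuple X k x | k < n].

Definition replace_coord (x : T) (b : T1) : n.-tuple T1 :=
  [tuple if k == i then b else X k x | k < n].

(** The i-th member of the family is read off an independent copy z.2 of the
    sample point, all others off z.1. *)
Definition decoupled_tuple (z : T * T) : n.-tuple T1 :=
  replace_coord z.1 (X i z.2).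

Lemma measurable_family_tuple : measurable_fun setT family_tuple.
Proof.
apply/measurable_fun_tnthP => k.
rewrite (_ : _ \o _ = X k) //; apply/funext => x /=.
by rewrite tnth_mktuple.
Qed.

Lemma measurable_decoupled_tuple : measurable_fun setT decoupled_tuple.
Proof.
apply/measurable_fun_tnthP => k.
rewrite (_ : _ \o _ = fun z : T * T => if k == i then X i z.2 else X k z.1); last first.
  by apply/funext => x /=; rewrite tnth_mktuple.
by case: (k == i); [exact: (measurableT_comp (mX i))|exact: (measurableT_comp (mX k))].
Qed.

Let cylinder (B : 'I_n -> set T1) : set (n.-tuple T1) :=
  [set t | forall k, B k (tnth t k)].

Let cylinders : set (set (n.-tuple T1)) :=
  [set A | exists2 B, (forall k, measurable (B k)) & A = cylinder B].

Let cylinders_measurable : cylinders `<=` measurable.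
Proof.
move=> _ [B mB ->].
rewrite (_ : cylinder B = \bigcap_(k in [set: 'I_n]) ((fun t => tnth t k) @^-1` B k)).
  apply: fin_bigcap_measurable => // k _; rewrite -[X in measurable X]setTI.
  exact: measurable_tnth.
by apply/seteqP; split=> [t h k _|t h k]; [exact: h|exact: (h k I)].
Qed.

Let cylindersE : @measurable _ (n.-tuple T1) = <<s cylinders >>.
Proof.
apply/seteqP; split; last first.
  apply: smallest_sub; first exact: sigma_algebra_measurable.
  exact: cylinders_measurable.
rewrite {1}/measurable/=; apply: smallest_sub; first exact: smallest_sigma_algebra.
move=> A; rewrite -bigcup_seq/= => -[k _] [B mB <-].
apply: sub_sigma_algebra; exists (fun l => if l == k then B else setT).
  by move=> l; case: ifP.
rewrite setTI; apply/seteqP; split => t /=.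
  by move=> h l; case: ifP => // /eqP ->.
by move=> /(_ k); rewrite eqxx.
Qed.

Let setI_cylinders : setI_closed cylinders.
Proof.
move=> _ _ [B mB ->] [C mC ->]; exists (fun k => B k `&` C k).
  by move=> k; exact: measurableI.
apply/seteqP; split => t /=; first by move=> [h1 h2] k; split.
by move=> h; split => k; have [] := h k.
Qed.

Let mu1_pack : {mfun T >-> n.-tuple T1} :=
  HB.pack family_tuple (isMeasurableFun.Build _ _ _ _ _ measurable_family_tuple).

Let mu2_pack : {mfun (T * T)%type >-> n.-tuple T1} :=
  HB.pack decoupled_tuple (isMeasurableFun.Build _ _ _ _ _ measurable_decoupled_tuple).

Let mX_preimage k B : measurable B -> measurable (X k @^-1` B).
Proof. by move=> mB; rewrite -[X in measurable X]setTI; exact: mX. Qed.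

(** Mutual independence says exactly that both laws agree on cylinders with
    measurable bases; these form a pi-system generating the product
    sigma-algebra, and the laws are finite measures of the same mass. *)
Lemma decoupled_law A : measurable A ->
  distribution P mu1_pack A = distribution (P \x P)%E mu2_pack A.
Proof.
apply: (measure_unique cylinders (fun _ => setT)).
- exact: cylindersE.
- exact: setI_cylinders.
- by move=> _; exists (fun _ => setT) => //; apply/seteqP; split.
- by rewrite bigcup_const.
- move=> _ [B mB ->]; rewrite /distribution /pushforward /=.
  have e1 : family_tuple @^-1` cylinder B =
      \bigcap_(k in [set` [set: 'I_n]%SET]) (X k @^-1` B k).
    apply/seteqP; split => x /=.
      by move=> h k _; have := h k; rewrite tnth_mktuple.
    by move=> h k; rewrite tnth_mktuple; apply: h; rewrite /= inE.
  have e2 : decoupled_tuple @^-1` cylinder B =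
      (\bigcap_(k in [set` [set~ i]%SET]) (X k @^-1` B k)) `*` (X i @^-1` B i).
    apply/seteqP; split => -[x x'] /=.
      move=> h; split.
        move=> k /=; rewrite !inE => ki; have := h k.
        by rewrite tnth_mktuple (negbTE ki).
      by have := h i; rewrite tnth_mktuple eqxx.
    move=> [h1 h2] k; rewrite tnth_mktuple; case: ifP => [/eqP-> //|/negbT ki].
    by apply: h1; rewrite /= !inE.
  transitivity (P (family_tuple @^-1` cylinder B)) => //; rewrite e1.
  transitivity ((P \x P)%E (decoupled_tuple @^-1` cylinder B)) => //; rewrite e2.
  rewrite product_measure1E//; last exact: mX_preimage; last first.
    by apply: fin_bigcap_measurable => // k _; exact: mX_preimage.
  rewrite indepX// (bigD1 i) ?inE//= mulrC EFinM; congr (_ * _)%E.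
    by rewrite indepX//; congr EFin; apply: eq_bigl => k; rewrite !inE.
  by rewrite fineK// fin_num_measure//; exact: mX_preimage.
- move=> _; have h : (P (family_tuple @^-1` setT) < +oo)%E.
    by rewrite preimage_setT probability_setT ltry.
  exact: h.
Qed.

Lemma decoupled_integrable (F : n.-tuple T1 -> R) : measurable_fun setT F ->
  P.-integrable setT (EFin \o (F \o family_tuple)) ->
  (P \x P)%E.-integrable setT (EFin \o (F \o decoupled_tuple)).
Proof.
move=> mF /integrableP[_ iF]; apply/integrableP; split.
  by apply/measurable_EFinP; apply: measurableT_comp => //; exact: measurable_decoupled_tuple.
have mG : measurable_fun setT (fun t => `|(F t)%:E|)%E.
  by apply: measurableT_comp => //; exact/measurable_EFinP.
rewrite -(@ge0_integral_distribution _ _ _ _ _ (P \x P)%E mu2_pack (fun t => `|(F t)%:E|)%E)//.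
rewrite (eq_measure_integral (distribution P mu1_pack)); last first.
  by move=> A mA _; exact/esym/decoupled_law.
by rewrite ge0_integral_distribution.
Qed.

Lemma decoupled_integral (F : n.-tuple T1 -> R) : measurable_fun setT F ->
  P.-integrable setT (EFin \o (F \o family_tuple)) ->
  (\int[P]_x (F (family_tuple x))%:E =
   \int[P \x P]_z (F (decoupled_tuple z))%:E)%E.
Proof.
move=> mF iF; have mG : measurable_fun setT (EFin \o F) by exact/measurable_EFinP.
rewrite -(@integral_distribution _ _ _ _ _ (P \x P)%E mu2_pack (EFin \o F))//; last first.
  exact: decoupled_integrable.
rewrite (eq_measure_integral (distribution P mu1_pack)); last first.
  by move=> A mA _; exact/esym/decoupled_law.
by rewrite integral_distribution.
Qed.

End decoupling.

Section factorization.
Context (R : realType) (d d1 : measure_display) (T : measurableType d)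
  (T1 : measurableType d1) (P : probability T R) (n : nat) (X : 'I_n -> T -> T1).
Hypotheses (mX : forall k, measurable_fun setT (X k))
  (indepX : mutually_independent P X).
Variable i : 'I_n.

(** After decoupling, phi depends on the second copy only and F on the first only,
    so Fubini's theorem splits the integral. *)
Lemma independent_Rintegral (phi : T1 -> R) (F : n.-tuple T1 -> R) :
  measurable_fun setT phi -> measurable_fun setT F ->
  (forall x b, F (replace_coord X i x b) = F (family_tuple X x)) ->
  P.-integrable setT (EFin \o (phi \o X i)) ->
  P.-integrable setT (EFin \o (F \o family_tuple X)) ->
  P.-integrable setT (EFin \o (fun x => phi (X i x) * F (family_tuple X x))) ->
  \int[P]_x (phi (X i x) * F (family_tuple X x)) =
  \int[P]_x phi (X i x) * \int[P]_x F (family_tuple X x).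
Proof.
move=> mphi mF Finv iphi iF iphiF.
pose Psi (t : n.-tuple T1) := phi (tnth t i) * F t.
have mPsi : measurable_fun setT Psi.
  apply: measurable_funM => //.
  by apply: (measurableT_comp mphi); exact: measurable_tnth.
have E : (fun x => phi (X i x) * F (family_tuple X x)) = Psi \o family_tuple X.
  by apply/funext => x; rewrite /Psi /= tnth_mktuple.
have -> : \int[P]_x (phi (X i x) * F (family_tuple X x)) =
    fine (\int[P]_x (Psi (family_tuple X x))%:E)%E.
  by congr fine; apply: eq_integral => x _; rewrite /Psi tnth_mktuple.
rewrite E in iphiF.
rewrite (@decoupled_integral _ _ _ _ _ P n X mX indepX i Psi)//.
rewrite -integral12_prod_meas1/=; last exact: (decoupled_integrable mX indepX i mPsi).
rewrite /fubini_F /=.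
have Ephi : (\int[P]_y (phi (X i y))%:E)%E = (\int[P]_y phi (X i y))%:E.
  by rewrite /Rintegral fineK//; exact: integrable_fin_num.
have EF : (\int[P]_y (F (family_tuple X y))%:E)%E = (\int[P]_y F (family_tuple X y))%:E.
  by rewrite /Rintegral fineK//; exact: integrable_fin_num.
transitivity (fine (\int[P]_x ((\int[P]_y phi (X i y))%:E * (F (family_tuple X x))%:E))%E).
  congr fine; apply: eq_integral => x _.
  rewrite -Ephi -integralZr//; apply: eq_integral => y _.
  by rewrite /Psi /decoupled_tuple /= tnth_mktuple eqxx Finv EFinM.
by rewrite integralZl// EF -EFinM.
Qed.

End factorization.

(** * Integration by parts for the standard normal law *)

Section gaussian.
Context (R : realType).
Local Notation leb := (@lebesgue_measure R).
Local Notation gam := (@normal_prob R 0 1).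
Local Notation pdf := (@normal_pdf R 0 1).
Import HBNNSimple.

Let ae_density A : measurable A -> ae_eq leb A
  (Radon_Nikodym (charge_of_finite_measure gam) leb) (fun x => (pdf x)%:E).
Proof.
move=> mA; rewrite Radon_NikodymE//=; first exact: normal_prob_dominates.
move=> ab; case: cid => /= h [h1 h2 h3].
apply: integral_ae_eq => //=.
- exact: integrableS h2.
- by apply/measurable_funTS/measurableT_comp =>//; exact: measurable_normal_pdf.
- by move=> E E01 mE; rewrite -h3.
Qed.

Lemma normal_integral (f : R -> \bar R) : gam.-integrable setT f ->
  (\int[gam]_x f x = \int[leb]_x (f x * (pdf x)%:E))%E.
Proof.
move=> fi; rewrite -(Radon_Nikodym_change_of_variables (normal_prob_dominates 0 1))//=.
have mf := measurable_int _ fi.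
apply: ae_eq_integral => //.
- apply: emeasurable_funM => //; apply: (measurable_int leb).
  by apply: Radon_Nikodym_integrable; exact: normal_prob_dominates.
- apply: emeasurable_funM => //=; apply/measurableT_comp => //=.
  exact: measurable_normal_pdf.
- by apply: ae_eqe_mul2l; exact: ae_density.
Qed.

(** Needed for integrability itself: it evaluates the integral of an absolute
    value before that integral is known to be finite. *)
Lemma ge0_normal_integral (f : measurableTypeR R -> \bar R) : measurable_fun setT f ->
  (forall x, 0 <= f x)%E ->
  (\int[gam]_x f x = \int[leb]_x (f x * (pdf x)%:E))%E.
Proof.
move=> mf f0.
pose f_ := nnsfun_approx measurableT mf.
transitivity (lim (\int[gam]_x (f_ n x)%:E @[n --> \oo])%E).
  rewrite -monotone_convergence//=.
  - apply: eq_integral => ? /[!inE] xD; apply/esym/cvg_lim => //=.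
    exact: cvg_nnsfun_approx.
  - by move=> n; apply/measurable_EFinP; exact: (@measurable_funPT _ _ _ _ (f_ n)).
  - by move=> n ? _; rewrite lee_fin.
  - by move=> ? _ ? ? mn; rewrite lee_fin; exact/lefP/nd_nnsfun_approx.
transitivity (lim (\int[leb]_x ((f_ n x)%:E * (pdf x)%:E) @[n --> \oo])%E).
  apply: congr_lim; apply/funext => n /=; apply: normal_integral.
  apply/integrableP; split; first by apply/measurable_EFinP; exact: (@measurable_funPT _ _ _ _ (f_ n)).
  apply: (@le_lt_trans _ _ (\int[gam]_x (\sum_(y \in range (f_ n)) y)%:E))%E.
    apply: ge0_le_integral => //.
    - by apply: measurableT_comp => //; apply/measurable_EFinP; exact: (@measurable_funPT _ _ _ _ (f_ n)).
    - move=> x _; rewrite lee_fin ger0_norm//.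
      rewrite (fsbigD1 (f_ n x))//=; last by exists x.
      by rewrite lerDl fsumr_ge0// => y [[z _ <-] _].
  by rewrite integral_cst//= probability_setT mule1 ltry.
rewrite -monotone_convergence//=.
- apply: eq_integral => x /[!inE] xD; apply/cvg_lim => //=.
  by apply: cvgeZr => //; exact: cvg_nnsfun_approx.
- move=> n; apply: emeasurable_funM; first by apply/measurable_EFinP; exact: (@measurable_funPT _ _ _ _ (f_ n)).
  by apply/measurable_EFinP; exact: measurable_normal_pdf.
- by move=> n x _; rewrite -EFinM lee_fin mulr_ge0// normal_pdf_ge0.
- move=> ? _ ? ? mn; rewrite lee_wpmul2r ?lee_fin ?normal_pdf_ge0//.
  exact/lefP/nd_nnsfun_approx.
Qed.

End gaussian.

Section gaussian_integration_by_parts.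
Context (R : realType).
Local Notation leb := (@lebesgue_measure R).
Local Notation gam := (@normal_prob R 0 1).
Local Notation pdf := (@normal_pdf R 0 1).

Let pdfE : pdf = fun x => normal_peak 1 * expR (- (x ^+ 2 / 2)).
Proof.
rewrite normal_pdfE//; apply/funext => x; rewrite /normal_fun subr0 expr1n.
by rewrite mulNr.
Qed.

Let pdf_ge0 x : 0 <= pdf x. Proof. exact: normal_pdf_ge0. Qed.

Let is_derive_pdf (x : R) : is_derive x (1 : R) pdf (- x * pdf x).
Proof.
rewrite pdfE.
have h1 : is_derive x (1:R) (fun x : R => - (x ^+ 2 / 2)) (- x).
  by apply: is_derive_eq; rewrite /GRing.scale/= !mulr0 add0r !mulr1; lra.
have h2 := is_derive_expR (- (x ^+ 2 / 2)).
have h3 := @is_derive1_comp _ expR (fun x : R => - (x ^+ 2 / 2)) x _ _ h2 h1.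
have h4 := is_deriveZ (normal_peak (1 : R)) h3.
have -> : (fun x : R => normal_peak 1 * expR (- (x ^+ 2 / 2))) =
  normal_peak (1 : R) \*: (expR \o (fun x : R => - (x ^+ 2 / 2))) by [].
have -> : - x * (normal_peak 1 * expR (- (x ^+ 2 / 2))) =
  normal_peak (1 : R) *: (expR (- (x ^+ 2 / 2)) * - x).
  by rewrite /GRing.scale/=; ring.
exact: h4.
Qed.

(** (1 + |x|)^q <= exp (q |x|) and q |x| <= q^2 + x^2 / 4: a power times the density
    is at most a multiple of a wider Gaussian. *)
Let gauss_envelope (q : R) : 0 <= q -> exists2 K : R, 0 <= K &
  forall x, (1 + `|x|) `^ q * pdf x <= K * expR (- (x ^+ 2 / 4)).
Proof.
move=> q0; exists (normal_peak 1 * expR (q ^+ 2)).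
  by rewrite mulr_ge0 ?normal_peak_ge0 ?expR_ge0.
move=> x; rewrite pdfE mulrCA -[leRHS]mulrA ler_wpM2l ?normal_peak_ge0//.
rewrite -expRD; apply: (@le_trans _ _ (expR (`|x| * q) * expR (- (x ^+ 2 / 2)))).
  rewrite ler_wpM2r ?expR_ge0// expRM ge0_ler_powR// ?nnegrE ?expR_ge0 ?addr_ge0//.
  exact: expR_ge1Dx.
rewrite -expRD ler_expR -[x ^+ 2]real_normK ?num_real//.
have := sqr_ge0 (q - `|x| / 2); set y := `|x|; nra.
Qed.

Let integrable_envelope (K : R) :
  leb.-integrable setT (fun x : R => (K * expR (- (x ^+ 2 / 4)))%:E).
Proof.
pose s : R := Num.sqrt 2.
have s0 : s != 0 by rewrite gt_eqF// sqrtr_gt0.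
have p0 : normal_peak s != 0 by rewrite gt_eqF// normal_peak_gt0.
have -> : (fun x : R => (K * expR (- (x ^+ 2 / 4)))%:E) =
    (fun x : R => (K / normal_peak s)%:E * (normal_pdf 0 s x)%:E)%E.
  apply/funext => x; rewrite normal_pdfE// -EFinM; congr EFin.
  rewrite mulrA divfK// /normal_fun subr0 sqr_sqrtr// mulNr.
  by congr (_ * expR (- (_ / _))); ring.
by apply: integrableZl => //; exact: integrable_normal_pdf.
Qed.

Lemma gaussian_integrable (f : R -> R) (q C : R) : 0 <= q -> 0 <= C ->
  measurable_fun setT f -> (forall x, `|f x| <= C * (1 + `|x|) `^ q) ->
  gam.-integrable setT (EFin \o f).
Proof.
move=> q0 C0 mf hf; apply/integrableP; split; first exact/measurable_EFinP.
have [K K0 hK] := gauss_envelope q0.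
rewrite ge0_normal_integral//; last first.
  by apply: measurableT_comp => //; exact/measurable_EFinP.
have /integrableP[me] := integrable_envelope (C * K).
apply: le_lt_trans; apply: ge0_le_integral => //.
- by move=> x _; rewrite mule_ge0// lee_fin.
- apply: emeasurable_funM.
    by apply: measurableT_comp => //; exact/measurable_EFinP.
  by apply/measurable_EFinP; exact: measurable_normal_pdf.
- exact: measurableT_comp.
- move=> x _ /=; rewrite lee_fin [leRHS]ger0_norm ?mulr_ge0 ?expR_ge0//.
  rewrite (@le_trans _ _ (C * (1 + `|x|) `^ q * pdf x))//.
    by rewrite ler_wpM2r.
  by rewrite -[leRHS]mulrA -[leLHS]mulrA ler_wpM2l.
Qed.

(** Stein's identity. (F' x - x F x) pdf x is the derivative of F pdf, whose values
    at the ends of [-m, m] tend to 0; the integrals over these intervals converge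
    to the whole integral by dominated convergence. *)
Lemma gaussian_integration_by_parts (F F' : R -> R) (q C : R) :
  0 <= q -> 0 <= C ->
  (forall x, is_derive x (1 : R) F (F' x)) -> continuous F' ->
  (forall x, `|F x| <= C * (1 + `|x|) `^ q) ->
  (forall x, `|F' x| <= C * (1 + `|x|) `^ q) ->
  (\int[gam]_x (x * F x)%:E = \int[gam]_x (F' x)%:E)%E.
Proof.
move=> q0 C0 dF cF' hF hF'.
have cF : continuous F.
  by move=> x; apply: differentiable_continuous; apply/derivable1_diffP; exact: (@ex_derive _ _ _ _ _ _ _ (dF x)).
have mF : measurable_fun setT F by exact: continuous_measurable_fun.
have mF' : measurable_fun setT F' by exact: continuous_measurable_fun.
have hxF (x : R) : `|x * F x| <= C * (1 + `|x|) `^ (q + 1).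
  rewrite powRD; last by apply/implyP => _; rewrite gt_eqF// ltr_pwDl.
  rewrite powRr1 ?addr_ge0// mulrA normrM mulrC ler_pM//.
  by rewrite lerDr.
have q10 : 0 <= q + 1 by rewrite addr_ge0.
have ixF : gam.-integrable setT (EFin \o (fun x => x * F x)).
  apply: (gaussian_integrable q10 C0) => //.
  by apply: measurable_funM.
have iF' : gam.-integrable setT (EFin \o F') by exact: (gaussian_integrable q0 C0).
pose h x := (F' x - x * F x) * pdf x.
suff h0 : (\int[leb]_x (h x)%:E = 0)%E.
  have : (\int[gam]_x ((F' x)%:E - (x * F x)%:E) = 0)%E.
    rewrite -h0 normal_integral; last exact: integrableB.
    by apply: eq_integral => x _; rewrite -EFinB -EFinM.
  rewrite integralB//.
  have := integrable_fin_num measurableT ixF; have := integrable_fin_num measurableT iF'.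
  rewrite /comp; move=> /fineK <- /fineK <-; rewrite -EFinB => -[/eqP].
  by rewrite subr_eq0 => /eqP ->.
pose H x := F x * pdf x.
have dH (x : R) : is_derive x (1 : R) H (h x).
  have := is_deriveM (dF x) (is_derive_pdf x).
  rewrite (_ : _ + _ = h x)//.
  by rewrite /h /GRing.scale/=; ring.
have cpdf : continuous pdf by apply: continuous_normal_pdf.
have ch : continuous h.
  move=> x; apply: cvgM; last exact: cpdf.
  by apply: cvgB; [exact: cF'|apply: cvgM; [exact: cvg_id|exact: cF]].
have cH : continuous H by move=> x; apply: cvgM; [exact: cF|exact: cpdf].
have mh : measurable_fun setT h by exact: continuous_measurable_fun.
have [K K0 hK] := gauss_envelope q10.
have one_le (x : R) : 1 <= 1 + `|x| by rewrite lerDl.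
have hH (x : R) : `|H x| <= C * K * expR (- (x ^+ 2 / 4)).
  rewrite normrM (ger0_norm (pdf_ge0 x)).
  apply: (@le_trans _ _ (C * (1 + `|x|) `^ (q + 1) * pdf x)).
    rewrite ler_wpM2r//; apply: (le_trans (hF x)); rewrite ler_wpM2l//.
    by rewrite ler_powR// lerDl.
  by rewrite -[leRHS]mulrA -[leLHS]mulrA ler_wpM2l.
have hh (x : R) : `|h x| <= 2 * C * K * expR (- (x ^+ 2 / 4)).
  rewrite normrM (ger0_norm (pdf_ge0 x)).
  apply: (@le_trans _ _ (2 * C * (1 + `|x|) `^ (q + 1) * pdf x)).
    rewrite ler_wpM2r//; apply: (le_trans (ler_normB _ _)).
    rewrite -mulrA mulr_natl mulr2n lerD//; apply: (le_trans (hF' x)); rewrite ler_wpM2l//.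
    by rewrite ler_powR// lerDl.
  by rewrite -[leRHS]mulrA -[leLHS]mulrA ler_wpM2l// mulr_ge0.
pose I n := `[- n.+1%:R, n.+1%:R]%classic : set R.
have intI n : (\int[leb]_(x in I n) (h x)%:E = (H n.+1%:R)%:E - (H (- n.+1%:R))%:E)%E.
  apply: continuous_FTC2.
  - by rewrite -subr_gt0 opprK addr_gt0.
  - exact: continuous_subspaceT.
  - split.
    + by move=> x _; exact: (@ex_derive _ _ _ _ _ _ _ (dH x)).
    + by apply: cvg_at_right_filter; exact: cH.
    + by apply: cvg_at_left_filter; exact: cH.
  - by move=> x _; rewrite derive1E; exact: (@derive_val _ _ _ _ _ _ _ (dH x)).
have lim1 : (\int[leb]_(x in I n) (h x)%:E)%E @[n --> \oo] --> (\int[leb]_x (h x)%:E)%E.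
  under eq_fun do rewrite integral_mkcond.
  have := @dominated_convergence _ _ _ leb setT measurableT
    (fun n => (EFin \o h) \_ (I n)) (EFin \o h)
    (fun x => (2 * C * K * expR (- (x ^+ 2 / 4)))%:E).
  case => //.
  - move=> n; apply/(measurable_restrictT _ _).1; first exact: measurable_itv.
    by apply/measurable_EFinP; exact: measurable_funTS.
  - exact/measurable_EFinP.
  - apply: aeW => x _.
    apply: cvg_near_cst; near=> n.
    rewrite patchE ifT// inE /I /= in_itv/= -ler_norml.
    apply/ltW/(lt_le_trans (truncnS_gt _)); rewrite ler_nat ltnS.
    by near: n; exact: nbhs_infty_ge.
  - apply: aeW => x n _; rewrite patchE; case: ifP => _.
      by rewrite /= lee_fin.
    by rewrite abse0 lee_fin !mulr_ge0 ?expR_ge0.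
have lim2 : (\int[leb]_(x in I n) (h x)%:E)%E @[n --> \oo] --> 0%E.
  have -> : (fun n => (\int[leb]_(x in I n) (h x)%:E)%E) =
      (fun n => (H n.+1%:R - H (- n.+1%:R))%:E).
    by apply/funext => n; rewrite intI.
  apply/cvg_EFin; first exact: nearW.
  have lim3 : (fun n => 8 * C * K * harmonic n) @ \oo --> (0 : R).
    rewrite -[X in _ --> X](mulr0 (8 * C * K)); apply: cvgMr; exact: cvg_harmonic.
  apply: (squeeze_cvgr (f := fun n => - (8 * C * K * harmonic n)) (h := fun n => 8 * C * K * harmonic n)) => //.
    apply: nearW => n; rewrite -ler_norml /=.
    have n0 : (0 : R) < n.+1%:R by rewrite ltr0n.
    have e1 : expR (- (n.+1%:R ^+ 2 / 4)) <= 4 * (n.+1%:R : R)^-1.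
      rewrite expRN -[leRHS]invrK lef_pV2 ?posrE ?expR_gt0 ?invr_gt0 ?mulr_gt0 ?invr_gt0//.
      apply: le_trans (expR_ge1Dx _); rewrite invfM invrK.
      have : (1 : R) <= n.+1%:R by rewrite ler1n.
      set m := n.+1%:R => hm; have := sqr_ge0 (m - 1); nra.
    apply: (le_trans (ler_normB _ _)).
    apply: (@le_trans _ _ (C * K * expR (- (n.+1%:R ^+ 2 / 4)) + C * K * expR (- (n.+1%:R ^+ 2 / 4)))).
      apply: lerD; first exact: hH.
      by have := hH (- n.+1%:R); rewrite sqrrN.
    rewrite /harmonic /= -mulrDl (_ : 8 * C * K * _ = (C * K + C * K) * (4 * n.+1%:R^-1)); last by ring.
    by rewrite ler_wpM2l// addr_ge0// mulr_ge0.
  by rewrite -[X in _ --> X]oppr0; exact: cvgN.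
exact: (cvg_unique _ lim1 lim2).
Unshelve. all: by end_near. Qed.

End gaussian_integration_by_parts.

(** * Integrability by domination *)

Section domination.
Context (R : realType) (d : measure_display) (T : measurableType d) (P : probability T R).
Variable N : T -> R.
Hypothesis N_ge1 : forall x, 1 <= N x.
Implicit Types (f g : T -> R) (k : R).

(** A calculus for integrability: all integrands below are measurable and at most
    a power of one size function N >= 1, the exponents add under products, and
    N^m is integrable for a known m. *)
Definition dominated k f := measurable_fun setT f /\
  exists2 C : R, 0 <= C & forall x, `|f x| <= C * N x `^ k.

Let N_gt0 x : 0 < N x. Proof. exact: lt_le_trans (N_ge1 x). Qed.

Lemma dominated_le k1 k2 f : k1 <= k2 -> dominated k1 f -> dominated k2 f.
Proof.
move=> k12 [mf [C C0 hC]]; split => //; exists C => // x.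
by apply: (le_trans (hC x)); rewrite ler_wpM2l// ler_powR.
Qed.

Lemma dominated_cst c : dominated 0 (cst c).
Proof. by split=> //; exists `|c| => // x; rewrite powRr0 mulr1. Qed.

Lemma dominatedD k f g : dominated k f -> dominated k g ->
  dominated k (fun x => f x + g x).
Proof.
move=> [mf [C C0 hC]] [mg [D D0 hD]]; split; first exact: measurable_funD.
exists (C + D); first exact: addr_ge0.
by move=> x; rewrite mulrDl (le_trans (ler_normD _ _))// lerD.
Qed.

Lemma dominatedM k1 k2 f g : dominated k1 f -> dominated k2 g ->
  dominated (k1 + k2) (fun x => f x * g x).
Proof.
move=> [mf [C C0 hC]] [mg [D D0 hD]]; split; first exact: measurable_funM.
exists (C * D); first exact: mulr_ge0.
move=> x; rewrite powRD; last by apply/implyP => _; rewrite gt_eqF.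
by rewrite mulrACA normrM ler_pM.
Qed.

Lemma dominatedZ k c f : dominated k f -> dominated k (fun x => c * f x).
Proof. by move=> hf; rewrite -[k]add0r; apply: dominatedM => //; exact: dominated_cst. Qed.

Lemma dominatedB k f g : dominated k f -> dominated k g ->
  dominated k (fun x => f x - g x).
Proof.
move=> hf hg; have := dominatedD hf (dominatedZ (-1) hg).
by under eq_fun do rewrite mulN1r.
Qed.

Lemma dominated_abs k f : dominated k f -> dominated k (fun x => `|f x|).
Proof.
move=> [mf [C C0 hC]]; split; last by exists C => // x; rewrite normr_id.
exact: measurableT_comp.
Qed.

Lemma dominated_powR k r f : 0 <= r -> 0 <= k -> dominated k f ->
  dominated (k * r) (fun x => `|f x| `^ r).
Proof.
move=> r0 k0 [mf [C C0 hC]]; split.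
  apply: (measurableT_comp (measurable_powR r)).
  exact: (measurableT_comp (normr_measurable (D := setT))).
exists (C `^ r); first exact: powR_ge0.
move=> x; rewrite ger0_norm ?powR_ge0// powRrM -powRM ?powR_ge0//.
by rewrite ge0_ler_powR// nnegrE mulr_ge0 ?powR_ge0.
Qed.

Lemma dominated_sum k (I : finType) (F : I -> T -> R) : 0 <= k ->
  (forall i, dominated k (F i)) -> dominated k (fun x => \sum_i F i x).
Proof.
move=> k0 hF; elim: (index_enum I) => [|i s IH].
  under eq_fun do rewrite big_nil; apply: (dominated_le k0); exact: dominated_cst.
under eq_fun do rewrite big_cons; exact: dominatedD.
Qed.

Lemma dominated_integrable m k f : k <= m ->
  P.-integrable setT (fun x => (N x `^ m)%:E) -> dominated k f ->
  P.-integrable setT (EFin \o f).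
Proof.
move=> km iN /(dominated_le km)[mf [C C0 hC]].
have iC : P.-integrable setT (fun x => (C * N x `^ m)%:E).
  under eq_fun do rewrite EFinM; exact: integrableZl.
apply: le_integrable iC => //; first exact/measurable_EFinP.
move=> x _; rewrite /= lee_fin (le_trans (hC x))//.
exact: ler_norm.
Qed.

End domination.

Section Rintegral_sums.
Context (R : realType) (d : measure_display) (T : measurableType d)
  (mu : {measure set T -> \bar R}).

Lemma integrable_fsum (I : finType) (F : I -> T -> R) :
  (forall i, mu.-integrable setT (EFin \o F i)) ->
  mu.-integrable setT (EFin \o (fun x => \sum_i F i x)).
Proof.
move=> hF; elim: (index_enum I) => [|i s IH].
  by apply: eq_integrable (integrable0 _ _) => // x _ /=; rewrite big_nil.
apply: eq_integrable (integrableD measurableT (hF i) IH) => // x _ /=.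
by rewrite big_cons.
Qed.

Lemma Rintegral_fsum (I : finType) (F : I -> T -> R) :
  (forall i, mu.-integrable setT (EFin \o F i)) ->
  \int[mu]_x (\sum_i F i x) = \sum_i \int[mu]_x F i x.
Proof.
move=> hF.
have iF s : mu.-integrable setT (EFin \o (fun x => \sum_(i <- s) F i x)).
  elim: s => [|i s IH].
    by apply: eq_integrable (integrable0 _ _) => // x _ /=; rewrite big_nil.
  apply: eq_integrable (integrableD measurableT (hF i) IH) => // x _ /=.
  by rewrite big_cons.
elim: (index_enum I) => [|i s IH].
  rewrite big_nil; under eq_Rintegral do rewrite big_nil.
  by rewrite Rintegral_cst// mul0r.
rewrite big_cons -IH -RintegralD//.
by apply: eq_Rintegral => x _; rewrite big_cons.
Qed.

End Rintegral_sums.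

Lemma powR_sum_le (R : realType) (I : finType) (a : I -> R) (k : R) : 0 <= k ->
  (forall i, 0 <= a i) ->
  (\sum_i a i) `^ k <= (1 + #|I|%:R) `^ k * (1 + \sum_i a i `^ k).
Proof.
move=> k0 a0.
have S0 : 0 <= \sum_i a i `^ k by apply: sumr_ge0 => i _; exact: powR_ge0.
pose M := \big[Num.max/0]_i a i.
have M0 : 0 <= M by apply: bigmax_ge_id.
have aM i : a i <= M by apply: le_bigmax.
have h1 : \sum_i a i <= (1 + #|I|%:R) * M.
  apply: (@le_trans _ _ (\sum_(i : I) M)); first exact: ler_sum.
  by rewrite sumr_const mulrDl mul1r mulr_natl -[leLHS]add0r lerD.
apply: (@le_trans _ _ (((1 + #|I|%:R) * M) `^ k)).
  by rewrite ge0_ler_powR// nnegrE ?sumr_ge0// mulr_ge0 ?addr_ge0.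
rewrite powRM ?addr_ge0// ler_wpM2l ?powR_ge0//.
have [[i0 _ eM]|eM] : (exists2 i, true & M = a i) \/ M = 0.
  rewrite /M; elim/big_ind: _ => [|x y hx hy|i _].
  - by right.
  - by rewrite /Num.max /Order.max; case: ifP.
  - by left; exists i.
- rewrite eM (bigD1 i0)//= addrCA lerDl addr_ge0// sumr_ge0// => i _.
  exact: powR_ge0.
- rewrite eM; have [->|kn0] := eqVneq k 0; last by rewrite powR0// addr_ge0.
  by rewrite powRr0 lerDl; under eq_bigr do rewrite powRr0; exact: sumr_ge0.
Qed.

Lemma one_plus_sum_powR_integrable (R : realType) (d : measure_display)
    (T : measurableType d) (P : probability T R) (I : finType) (f : I -> T -> R) (k : R) :
  0 <= k -> (forall i, measurable_fun setT (f i)) ->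
  (forall i, P.-integrable setT (EFin \o (fun x => `|f i x| `^ k))) ->
  P.-integrable setT (fun x => ((1 + \sum_i `|f i x|) `^ k)%:E).
Proof.
move=> k0 mf hf.
pose a (o : option I) y : R := if o is Some m then `|f m y| else 1.
have E y : 1 + \sum_i `|f i y| = \sum_o a o y.
  rewrite (bigD1 None)//=; congr (_ + _).
  rewrite (reindex_omap Some id)//=; last by case.
  by apply: eq_bigl => i; rewrite eqxx.
pose c := (1 + #|{: option I}|%:R) `^ k : R.
have i1 : P.-integrable setT (EFin \o (fun y => c * (1 + \sum_o a o y `^ k))).
  rewrite (_ : _ \o _ = fun y => (c%:E * (1 + \sum_o a o y `^ k)%:E)%E); last first.
    by apply/funext => y /=; rewrite EFinM.
  apply: integrableZl => //.
  have ic : P.-integrable setT (EFin \o cst (1 : R)) by exact: finite_measure_integrable_cst.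
  have iS : P.-integrable setT (EFin \o (fun y => \sum_o a o y `^ k)).
    apply: integrable_fsum => -[m|]; first exact: hf.
    by apply: eq_integrable ic => // y _ /=; rewrite powR1.
  exact: eq_integrable (integrableD measurableT ic iS).
apply: le_integrable i1 => //.
  apply/measurable_EFinP; apply: (measurableT_comp (measurable_powR k)).
  apply: measurable_funD => //; apply: measurable_sum => m.
  by apply: measurableT_comp.
move=> y _ /=; rewrite lee_fin ger0_norm ?powR_ge0// (le_trans _ (ler_norm _))//.
by rewrite E; apply: powR_sum_le => // -[m|]//=.
Qed.

(** * Integration by parts for a standard normal vector *)

Section gaussian_vector.
Context (R : realType) (d0 : measure_display) (T : measurableType d0)
  (Q : probability T R) (d : nat) (Z : 'I_d -> {RV Q >-> R}).
Hypothesis Z_normal : std_normal_vector Z.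
Local Notation V := 'cV[R]_d.

Let mZ k : measurable_fun setT (Z k : T -> R) := @measurable_funPT _ _ _ _ (Z k).

Let mid : @measurable_fun _ _ (measurableTypeR R) R setT (fun x => x).
Proof. by []. Qed.

Let idRV : {RV (normal_prob (0 : R) 1) >-> R} :=
  HB.pack (fun x : measurableTypeR R => x : R) (isMeasurableFun.Build _ _ _ _ _ mid).

Lemma std_normal_integral m (f : R -> R) q C : 0 <= q -> 0 <= C ->
  measurable_fun setT f -> (forall x, `|f x| <= C * (1 + `|x|) `^ q) ->
  Q.-integrable setT (EFin \o (f \o Z m)) /\
  (\int[Q]_y (f (Z m y))%:E = \int[normal_prob 0 1]_x (f x)%:E)%E.
Proof.
move=> q0 C0 mf hf.
have ig := gaussian_integrable q0 C0 mf hf.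
have ge0_eqm (F : R -> \bar R) : measurable_fun setT F -> (forall x, 0 <= F x)%E ->
    (\int[distribution Q (Z m)]_x F x = \int[normal_prob 0 1]_x F x)%E.
  move=> mF F0.
  rewrite (eq_measure_integral (distribution (normal_prob 0 1) idRV)); last first.
    by move=> A mA _; exact: (Z_normal.1 m A mA).
  by rewrite ge0_integral_distribution.
have mE : measurable_fun setT (EFin \o f) by exact/measurable_EFinP.
have iQ : Q.-integrable setT (EFin \o (f \o Z m)).
  apply/integrableP; split; first by apply/measurable_EFinP; exact: measurableT_comp.
  have /integrableP[_] := ig; rewrite -ge0_eqm ?ge0_integral_distribution//; exact: measurableT_comp.
split => //; rewrite -(integral_distribution mE iQ).
rewrite (eq_measure_integral (distribution (normal_prob 0 1) idRV)); last first.
  by move=> A mA _; exact: (Z_normal.1 m A mA).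
by rewrite integral_distribution.
Qed.

Definition gaussian_size (y : T) : R := 1 + \sum_m `|Z m y|.

Lemma gaussian_size_ge1 y : 1 <= gaussian_size y.
Proof. by rewrite lerDl sumr_ge0. Qed.

Lemma gaussian_size_integrable k : 0 <= k ->
  Q.-integrable setT (fun y => (gaussian_size y `^ k)%:E).
Proof.
move=> k0; apply: one_plus_sum_powR_integrable => // m.
have [] // := @std_normal_integral m (fun x => `|x| `^ k) k 1 k0 ler01.
  by apply: (measurableT_comp (measurable_powR k)); exact: normr_measurable.
move=> x; rewrite mul1r ger0_norm ?powR_ge0// ge0_ler_powR// ?nnegrE ?addr_ge0//.
by rewrite lerDr.
Qed.

Let dominatedZ1 m : dominated gaussian_size 1 (Z m).
Proof.
split => //; exists 1 => // y; rewrite mul1r powRr1; last first.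
  exact: le_trans (gaussian_size_ge1 y).
by rewrite /gaussian_size (bigD1 m)//= addrCA lerDl addr_ge0// sumr_ge0.
Qed.

Let colZ y : V := \col_j Z j y.

Let norm1_colZ y : 1 + norm1 (colZ y) = gaussian_size y.
Proof. by congr (_ + _); apply: eq_bigr => i _; rewrite mxE. Qed.

Let dominatedG (G : V -> R) q : continuous G -> pgrowth q G ->
  dominated gaussian_size q (fun y => G (colZ y)).
Proof.
move=> cG [C C0 hC]; split; first exact: measurable_continuous_col.
by exists C => // y; rewrite -norm1_colZ.
Qed.

Let G_tuple (G : V -> R) (t : d.-tuple R) := G (\col_j tnth t j).

Let measurable_G_tuple (G : V -> R) : continuous G -> measurable_fun setT (G_tuple G).
Proof. by move=> cG; apply: measurable_continuous_col => // j; exact: measurable_tnth. Qed.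

(** By decoupling the m-th coordinate, the others are frozen and the statement
    becomes the one-dimensional identity for the function on a coordinate line. *)
Lemma gaussian_vector_ibp m (G G' : V -> R) q : 0 <= q ->
  (forall z, is_derive z (e_ R m) G (G' z)) ->
  continuous G -> continuous G' -> pgrowth q G -> pgrowth q G' ->
  \int[Q]_y (Z m y * G (\col_j Z j y)) = \int[Q]_y G' (\col_j Z j y).
Proof.
move=> q0 dG cG cG' gG gG'.
have N1 := gaussian_size_ge1.
have iN := gaussian_size_integrable (addr_ge0 ler01 q0).
have famE y : (\col_j tnth (family_tuple (fun k => Z k : T -> R) y) j) = colZ y.
  by apply/matrixP => a b; rewrite !mxE tnth_mktuple.
pose Psi (t : d.-tuple R) := tnth t m * G_tuple G t.
pose Psi' (t : d.-tuple R) := G_tuple G' t.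
have mPsi : measurable_fun setT Psi.
  by apply: measurable_funM; [exact: measurable_tnth|exact: measurable_G_tuple].
have mPsi' : measurable_fun setT Psi' by exact: measurable_G_tuple.
have iPsi : Q.-integrable setT (EFin \o (Psi \o family_tuple (fun k => Z k : T -> R))).
  apply: (dominated_integrable N1 (lexx (1 + q)) iN).
  have := dominatedM N1 (dominatedZ1 m) (dominatedG cG gG).
  by congr (dominated _ _ _); apply/funext => y; rewrite /Psi /= /G_tuple famE tnth_mktuple.
have iPsi' : Q.-integrable setT (EFin \o (Psi' \o family_tuple (fun k => Z k : T -> R))).
  apply: (dominated_integrable N1 _ iN); last first.
    have := dominatedG cG' gG'.
    by congr (dominated _ _ _); apply/funext => y; rewrite /Psi' /= /G_tuple famE.
  by rewrite lerDr.
have -> : \int[Q]_y (Z m y * G (\col_j Z j y)) =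
    fine (\int[Q]_y (Psi (family_tuple (fun k => Z k : T -> R) y))%:E)%E.
  by congr fine; apply: eq_integral => y _; rewrite /Psi tnth_mktuple /G_tuple famE.
have -> : \int[Q]_y G' (\col_j Z j y) =
    fine (\int[Q]_y (Psi' (family_tuple (fun k => Z k : T -> R) y))%:E)%E.
  by congr fine; apply: eq_integral => y _; rewrite /Psi' /G_tuple famE.
have ind := Z_normal.2.
congr fine.
rewrite (decoupled_integral mZ ind m mPsi iPsi) (decoupled_integral mZ ind m mPsi' iPsi').
rewrite -!integral12_prod_meas1; last 2 first.
- exact: (decoupled_integrable mZ ind m mPsi' iPsi').
- exact: (decoupled_integrable mZ ind m mPsi iPsi).
apply: eq_integral => y _; rewrite /fubini_F /=.
pose u : V := \col_j (if j == m then 0 else Z j y).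
have repl b : \col_j tnth (replace_coord (fun k => Z k : T -> R) m y b) j = u + b *: e_ R m.
  apply/matrixP => a c; rewrite !mxE tnth_mktuple !ord1 eqxx andbT.
  by case: eqVneq => _; rewrite ?add0r ?mulr1// mulr0 addr0.
pose F x := G (u + x *: e_ R m); pose F' x := G' (u + x *: e_ R m).
transitivity (\int[Q]_y' (Z m y' * F (Z m y'))%:E)%E.
  apply: eq_integral => y' _; rewrite /Psi /decoupled_tuple /= tnth_mktuple eqxx.
  by rewrite /G_tuple repl.
transitivity (\int[Q]_y' (F' (Z m y'))%:E)%E; last first.
  by apply: eq_integral => y' _; rewrite /Psi' /decoupled_tuple /= /G_tuple repl.
have cline (x : R) : {for x, continuous (fun x : R => u + x *: e_ R m)}.
  by apply: cvgD; [exact: cvg_cst|apply: cvgZr_tmp; exact: cvg_id].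
have cF : continuous F by move=> x; apply: continuous_comp; [exact: cline|exact: cG].
have cF' : continuous F' by move=> x; apply: continuous_comp; [exact: cline|exact: cG'].
have line_growth (H : V -> R) : pgrowth q H -> exists2 C, 0 <= C &
    forall x, `|H (u + x *: e_ R m)| <= C * (1 + `|x|) `^ q.
  move=> [C C0 hC]; exists (C * (1 + norm1 u) `^ q); first by rewrite mulr_ge0// powR_ge0.
  move=> x; apply: (le_trans (hC _)); rewrite -mulrA ler_wpM2l//.
  rewrite -powRM ?addr_ge0 ?norm1_ge0// ge0_ler_powR// ?nnegrE ?mulr_ge0 ?addr_ge0 ?norm1_ge0//.
  have : norm1 (u + x *: e_ R m) <= norm1 u + `|x|.
    rewrite /norm1 (bigD1 m)//= [X in _ <= X + _](bigD1 m)//=.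
    rewrite !mxE eqxx /= mulr1 add0r normr0 add0r addrC lerD2r.
    apply: ler_sum => a am; rewrite !mxE (negbTE am) /= mulr0 addr0//.
  have := norm1_ge0 u; have := normr_ge0 x; move: (norm1 _) (norm1 u) => a b; nra.
have [C C0 hF] := line_growth G gG; have [D D0 hF'] := line_growth G' gG'.
have hF2 x : `|F x| <= (C + D) * (1 + `|x|) `^ q.
  by rewrite (le_trans (hF x))// ler_wpM2r ?powR_ge0// lerDl.
have hF2' x : `|F' x| <= (C + D) * (1 + `|x|) `^ q.
  by rewrite (le_trans (hF' x))// ler_wpM2r ?powR_ge0// lerDr.
have CD0 : 0 <= C + D by rewrite addr_ge0.
have mF : measurable_fun setT F by exact: continuous_measurable_fun.
have mF' : measurable_fun setT F' by exact: continuous_measurable_fun.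
have q10 : 0 <= q + 1 by rewrite addr_ge0.
have hxF (x : R) : `|x * F x| <= (C + D) * (1 + `|x|) `^ (q + 1).
  rewrite powRD; last by apply/implyP => _; rewrite gt_eqF// ltr_pwDl.
  rewrite powRr1 ?addr_ge0// mulrA normrM mulrC ler_pM//.
  by rewrite lerDr.
have [_ ->] := @std_normal_integral m (fun x => x * F x) (q + 1) (C + D) q10 CD0
  (measurable_funM (@measurable_id _ _ _) mF) hxF.
have [_ ->] := @std_normal_integral m F' q (C + D) q0 CD0 mF' hF2'.
apply: (gaussian_integration_by_parts q0 CD0 _ cF' hF2 hF2').
by move=> x; apply: is_derive_line; exact: dG.
Qed.

End gaussian_vector.

(** * Inequalities between real powers *)

Section power_inequalities.
Context (R : realType).
Implicit Types (x y z r p : R).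

Lemma powR_concave_tangent z p : 0 <= z -> 0 <= p <= 1 -> z `^ p <= 1 + p * (z - 1).
Proof.
move=> z0 /andP[p0 p1].
have [->|pn0] := eqVneq p 0; first by rewrite powRr0 mul0r addr0.
have [->|pn1] := eqVneq p 1; first by rewrite powRr1// mul1r addrC subrK.
have pgt0 : 0 < p by rewrite lt_neqAle eq_sym pn0.
have qgt0 : 0 < 1 - p by rewrite subr_gt0 lt_neqAle pn1.
have := @conjugate_powR R (z `^ p) 1 p^-1 (1 - p)^-1 (powR_ge0 _ _) ler01.
rewrite !invr_gt0 !invrK mulr1 powR1 -powRrM mulfV// powRr1//.
have pq : p + (1 - p) = 1 by lra.
by move=> /(_ pgt0 qgt0 pq) h; apply: (le_trans h); lra.
Qed.

Lemma powR_convex_tangent y r : 0 <= y -> 1 <= r -> 1 + r * (y - 1) <= y `^ r.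
Proof.
move=> y0 r1; have r0 : 0 < r by lra.
have := @powR_concave_tangent (y `^ r) r^-1 (powR_ge0 _ _).
rewrite -powRrM mulfV ?gt_eqF// powRr1// invr_ge0 (ltW r0) invf_le1// r1 => /(_ isT).
rewrite -(ler_pM2l r0) mulrDr mulrA mulfV ?gt_eqF//.
lra.
Qed.

Lemma powR_add_le x y r : 0 <= x -> 0 <= y -> 0 <= r ->
  (x + y) `^ r <= 2 `^ r * (x `^ r + y `^ r).
Proof.
move=> x0 y0 r0.
have main a b : 0 <= a -> a <= b -> (a + b) `^ r <= 2 `^ r * (a `^ r + b `^ r).
  move=> a0 ab; have b0 := le_trans a0 ab.
  apply: (@le_trans _ _ ((2 * b) `^ r)).
    by rewrite ge0_ler_powR// ?nnegrE ?addr_ge0 ?mulr_ge0//; lra.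
  by rewrite powRM// ler_wpM2l ?powR_ge0// lerDr powR_ge0.
have [xy|/ltW yx] := leP x y; first exact: main.
by rewrite addrC [x `^ r + _]addrC; exact: main.
Qed.

(** Both x / (x + y) and y / (x + y) lie in [0, 1], where a power with exponent at
    most 1 is at least the identity. *)
Lemma powR_subadditive x y r : 0 <= x -> 0 <= y -> 0 <= r <= 1 ->
  (x + y) `^ r <= x `^ r + y `^ r.
Proof.
move=> x0 y0 /andP[r0 r1].
have [->|rn0] := eqVneq r 0; first by rewrite !powRr0; lra.
have rgt0 : 0 < r by rewrite lt_neqAle eq_sym rn0.
have [s0|s0] := eqVneq (x + y) 0.
  by rewrite s0 powR0// addr_ge0 ?powR_ge0.
have sp : 0 < x + y by rewrite lt_neqAle eq_sym s0 addr_ge0.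
have part a : 0 <= a -> a <= x + y -> a / (x + y) * (x + y) `^ r <= a `^ r.
  move=> a0 ale; have [->|an0] := eqVneq a 0.
    by rewrite !mul0r powR_ge0.
  have ap : 0 < a by rewrite lt_neqAle eq_sym an0.
  rewrite -{2}[a](divfK s0) powRM ?divr_ge0 ?(ltW sp)// ler_wpM2r ?powR_ge0//.
  by apply: ger1_powR => //; rewrite divr_gt0//= ler_pdivrMr// mul1r.
have := lerD (part x x0 _) (part y y0 _).
rewrite lerDl lerDr -mulrDl -mulrDl mulfV// mul1r; exact.
Qed.

(** The tangent at s^2 of the concave power u |-> u ^ (r/2). Integrated, it bounds
    the r-th absolute moment by the r-th power of the standard deviation. *)
Lemma powR_le_quadratic y s r : 0 <= y -> 0 < s -> 0 <= r <= 2 ->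
  y `^ r <= s `^ r * (1 + r / 2 * (y ^+ 2 / s ^+ 2 - 1)).
Proof.
move=> y0 s0 /andP[r0 r2].
have ys0 : 0 <= y / s by rewrite divr_ge0// ltW.
rewrite -{1}[y](divfK (lt0r_neq0 s0)) mulrC powRM// ?(ltW s0)// mulrC -exprVn -exprMn.
rewrite mulrC ler_wpM2l ?powR_ge0//.
have -> : (y / s) `^ r = ((y / s) ^+ 2) `^ (r / 2).
  rewrite -powR_mulrn// -powRrM; congr powR; lra.
by apply: powR_concave_tangent; [exact: sqr_ge0|lra].
Qed.

(** The tangent of the convex function |.|^r at u, for every real u; its slope is
    what independence will annihilate in partial_sum_jensen. *)
Lemma powR_norm_tangent u v r : 1 <= r ->
  `|u| `^ r + r * (Num.sg u * `|u| `^ (r - 1)) * (v - u) <= `|v| `^ r.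
Proof.
move=> r1; have [->|un0] := eqVneq u 0.
  by rewrite sgr0 mul0r mulr0 mul0r addr0 normr0 powR0 ?powR_ge0//; lra.
have up : 0 < `|u| by rewrite normr_gt0.
have := @powR_convex_tangent (`|v| / `|u|) r (divr_ge0 (normr_ge0 _) (normr_ge0 _)) r1.
rewrite -(ler_pM2l (powR_gt0 r up)) -powRM ?divr_ge0// [`|u| * _]mulrC divfK ?gt_eqF//.
apply: le_trans; rewrite [leRHS]mulrDr mulr1 lerD2l.
have -> : `|u| `^ r = `|u| * `|u| `^ (r - 1) by rewrite mulr_powRB1//; lra.
have -> : `|u| * `|u| `^ (r - 1) * (r * (`|v| / `|u| - 1)) = r * `|u| `^ (r - 1) * (`|v| - `|u|).
  by field; rewrite gt_eqF.
have -> : r * (Num.sg u * `|u| `^ (r - 1)) * (v - u) = r * `|u| `^ (r - 1) * (Num.sg u * v - `|u|).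
  by rewrite [X in _ = _ * (_ - X)]normrEsg; ring.
apply: ler_wpM2l; first by rewrite mulr_ge0 ?powR_ge0//; lra.
rewrite lerD2r (le_trans (ler_norm _))// normrM normr_sg un0 mul1r//.
Qed.

(** A lower bound of |x|^r by 1 + (r/2) (1 - a^2 / x^2), from exp t >= 1 + t twice,
    multiplied by x^10 in order to become a polynomial in x. Integrated against a
    Gaussian it bounds a fractional moment from below by even moments. *)
Lemma powR_even_moment_bound x a r : 0 < a -> 0 <= r ->
  a `^ r * (x ^+ 10 + r / 2 * (x ^+ 10 - a ^+ 2 * x ^+ 8)) <= x ^+ 10 * `|x| `^ r.
Proof.
move=> a0 r0; have [->|xn0] := eqVneq x 0.
  by rewrite !expr0n/= !mul0r !mulr0 subrr mulr0 addr0 mulr0.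
have xp : 0 < `|x| by rewrite normr_gt0.
have h : a `^ r * (1 + r / 2 * (1 - a ^+ 2 / x ^+ 2)) <= `|x| `^ r.
  rewrite -[in leRHS](divfK (lt0r_neq0 a0) `|x|) powRM ?divr_ge0 ?(ltW a0)//.
  rewrite mulrC ler_wpM2r ?powR_ge0//.
  have zp : 0 < `|x| / a by rewrite divr_gt0.
  rewrite /powR gt_eqF//; apply: le_trans (expR_ge1Dx _); rewrite lerD2l.
  have := expR_ge1Dx (- (2 * ln (`|x| / a))).
  rewrite expRN mulrC expRM powR_mulrn ?expR_ge0// lnK ?posrE// exprMn exprVn.
  rewrite real_normK ?num_real// invfM invrK [_^-1 * _]mulrC => hh.
  rewrite -mulrA ler_wpM2l// [2^-1 * _]mulrC ler_pdivrMr// mulrC; lra.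
have -> : a `^ r * (x ^+ 10 + r / 2 * (x ^+ 10 - a ^+ 2 * x ^+ 8)) =
    x ^+ 10 * (a `^ r * (1 + r / 2 * (1 - a ^+ 2 / x ^+ 2))) by field.
by rewrite ler_wpM2l// exprn_even_ge0.
Qed.

(** The alternating partial sums of exp (- y) by two integrations, starting from
    exp (- y) >= 1 - y. *)
Let expR_lower y : 0 <= y -> 1 - y + y ^+ 2 / 2 - y ^+ 3 / 6 <= expR (- y).
Proof.
move=> y0.
have dexp (s : R) : is_derive s (1 : R) (fun s : R => expR (- s)) (- expR (- s)).
  have h := @is_derive1_comp _ expR (fun s : R => - s) s _ _ (is_derive_expR (- s))
    (is_deriveN (is_derive_id s (1 : R))).
  by rewrite -mulrN1; exact: h.
have up z : 0 <= z -> expR (- z) <= 1 - z + z ^+ 2 / 2.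
  move=> z0.
  pose q (s : R) := expR (- s) - (1 - s); pose b (s : R) := s ^+ 2 / 2.
  have : `|q z - q 0| <= b z - b 0.
    apply: (@mean_value_bound R q b (fun s => - expR (- s) - (- 1)) (fun s => s)) => // s.
    - apply: is_deriveB; apply: is_derive_eq; lra.
    - apply: is_derive_eq; rewrite /GRing.scale/=; lra.
    - move=> /andP[s0 _]; rewrite ler_norml; have := expR_ge1Dx (- s).
      have : expR (- s) <= 1 by rewrite -[leRHS]expR0 ler_expR; lra.
      lra.
  rewrite ler_norml => /andP[_]; rewrite /q /b oppr0 expR0; lra.
pose q (s : R) := (1 - s + s ^+ 2 / 2) - expR (- s); pose b (s : R) := s ^+ 3 / 6.
have : `|q y - q 0| <= b y - b 0.
  apply: (@mean_value_bound R q b (fun s => (- 1 + s) - (- expR (- s))) (fun s => s ^+ 2 / 2)) => // s.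
  - apply: is_deriveB; apply: is_derive_eq; rewrite /GRing.scale/=; lra.
  - apply: is_derive_eq; rewrite /GRing.scale/=; lra.
  - move=> /andP[s0 _]; rewrite ler_norml; have := expR_ge1Dx (- s); have := up s s0.
    lra.
rewrite ler_norml => /andP[_]; rewrite /q /b oppr0 expR0; lra.
Qed.

(** Each factor 1 + r / k is at most exp (r / k), and
    1 + 1/3 + 1/5 + 1/7 + 1/9 = 1.7873... is below log 6 = 1.7917.... *)
Lemma six_powR_ge r : 0 <= r ->
  (1 + r) * (1 + r / 3) * (1 + r / 5) * (1 + r / 7) * (1 + r / 9) <= 6 `^ r.
Proof.
move=> r0.
(* S / 8 <= 19 / 85, the cubic lower bound gives exp (- 19 / 85) >= 259 / 324, and
   (324 / 259)^8 <= 6 *)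
pose S : R := 1 + 1 / 3 + 1 / 5 + 1 / 7 + 1 / 9.
have e6 : expR S <= 6.
  have [c [c0 c8 hc]] : exists c : R, [/\ 0 < c, c ^+ 8 <= 6 & c^-1 <= expR (- (19 / 85))].
    exists (324 / 259); split; [lra|lra|].
    by apply: le_trans (expR_lower _); lra.
  have h2 : expR (S / 8) <= c.
    apply: (@le_trans _ _ (expR (19 / 85))); first by rewrite ler_expR /S; lra.
    by rewrite -[leLHS]invrK -expRN -[leRHS]invrK lef_pV2 ?posrE ?expR_gt0 ?invr_gt0.
  have -> : S = S / 8 * 8%:R by rewrite divfK.
  rewrite expRM powR_mulrn ?expR_ge0//; apply: le_trans c8.
  by rewrite lerXn2r ?nnegrE ?expR_ge0 ?(ltW c0).
apply: (@le_trans _ _ (expR (S * r))); last first.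
  by rewrite expRM ge0_ler_powR// ?nnegrE ?expR_ge0.
have -> : S * r = r + r / 3 + r / 5 + r / 7 + r / 9 by rewrite /S; field.
rewrite !expRD.
have pos k : 0 <= k -> 0 <= 1 + r / k by move=> k0; rewrite addr_ge0// divr_ge0.
by do 4 (apply: ler_pM; rewrite ?mulr_ge0 ?pos ?addr_ge0 ?expR_ge1Dx//).
Qed.

End power_inequalities.

(** * Linearity of real-valued integrals and powers of absolute values *)

Lemma integrable_scale (R : realType) (d : measure_display) (T : measurableType d)
    (mu : {measure set T -> \bar R}) (c : R) (f : T -> R) :
  mu.-integrable setT (EFin \o f) -> mu.-integrable setT (EFin \o (fun x => c * f x)).
Proof.
by move=> fi; apply: eq_integrable (integrableZl measurableT c fi).
Qed.

Lemma integrable_sub (R : realType) (d : measure_display) (T : measurableType d)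
    (mu : {measure set T -> \bar R}) (f g : T -> R) :
  mu.-integrable setT (EFin \o f) -> mu.-integrable setT (EFin \o g) ->
  mu.-integrable setT (EFin \o (fun x => f x - g x)).
Proof.
by move=> fi gi; apply: eq_integrable (integrableB measurableT fi gi).
Qed.

Lemma integrable_add (R : realType) (d : measure_display) (T : measurableType d)
    (mu : {measure set T -> \bar R}) (f g : T -> R) :
  mu.-integrable setT (EFin \o f) -> mu.-integrable setT (EFin \o g) ->
  mu.-integrable setT (EFin \o (fun x => f x + g x)).
Proof.
by move=> fi gi; apply: eq_integrable (integrableD measurableT fi gi).
Qed.

Lemma Rintegral_probability_cst (R : realType) (d : measure_display) (T : measurableType d) (P : probability T R) (c : R) :
  \int[P]_x c = c.
Proof.
rewrite Rintegral_cst//.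
have e : fine (P [set: T]) = 1 by rewrite probability_setT.
by rewrite -[RHS]mulr1 -e.
Qed.

Section powers_of_norms.
Context (R : realType).

Lemma continuous_norm_powR (r : R) : 0 <= r -> continuous (fun x : R => `|x| `^ r).
Proof.
move=> r0; have [->|rn0] := eqVneq r 0.
  by under eq_fun do rewrite powRr0; exact: cst_continuous.
have rp : 0 < r by rewrite lt_neqAle eq_sym rn0.
move=> u; have [->|un0] := eqVneq u 0.
  rewrite /continuous_at normr0 powR0//; apply/cvgrPdist_le => e e0.
  have ep : 0 < e `^ r^-1 by rewrite powR_gt0.
  near=> x; rewrite sub0r normrN ger0_norm ?powR_ge0//.
  have : `|x| <= e `^ r^-1.
    near: x; exact: (@nbhs0_le _ R (e `^ r^-1) ep).
  move=> hx; rewrite -[leRHS](powRr1 (ltW e0)) -(mulVf rn0) powRrM.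
  by rewrite ge0_ler_powR// nnegrE powR_ge0.
have up : 0 < `|u| by rewrite normr_gt0.
apply: (@continuous_comp _ _ _ (fun x : R => `|x|) (fun y : R => y `^ r)).
  exact: norm_continuous.
apply: differentiable_continuous; apply/derivable1_diffP; apply: derivable_powR.
by rewrite in_itv/= up.
Unshelve. all: by end_near. Qed.

(** At x = 0 the difference quotient is |h|^p, which tends to
    (p + 1) 0 ^ p: for p = 0 both are 1, otherwise both are 0. *)
Lemma is_derive_odd_power (p x : R) : 0 <= p ->
  is_derive x (1 : R) (fun x : R => x * `|x| `^ p) ((p + 1) * `|x| `^ p).
Proof.
move=> p0.
have pos (y : R) : 0 < y ->
    is_derive y (1 : R) (fun y : R => y `^ p) (p * y `^ (p - 1)).
  move=> y0; have yi : y \in `]0, +oo[ by rewrite in_itv/= y0.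
  have h : derivable (fun y : R => y `^ p) y 1 by apply: derivable_powR.
  have := derivableP h; rewrite -derive1E (powR_derive1 p)//.
have main (y : R) : 0 < y ->
    is_derive y (1 : R) (fun y : R => y * y `^ p) ((p + 1) * y `^ p).
  move=> y0; have := is_deriveM (is_derive_id y (1:R)) (pos y y0).
  rewrite (_ : _ + _ = (p + 1) * y `^ p)//.
  rewrite /GRing.scale/= mulr1 mulrCA.
  have [->|pn0] := eqVneq p 0; first by rewrite mul0r !add0r mul1r powRr0.
  rewrite mulr_powRB1 ?(ltW y0)//; first by ring.
  by rewrite lt_neqAle eq_sym pn0.
have [x0|x0|x0] := ltgtP x 0.
- have h := @is_derive1_comp _ (fun y : R => y * y `^ p) (fun s : R => - s) x _ _
    (main (- x) _) (is_deriveN (is_derive_id x (1 : R))).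
  have xn : 0 < - x by rewrite oppr_gt0.
  rewrite ltr0_norm// (_ : (p + 1) * _ = - ((p + 1) * (- x) `^ p * - 1)); last by rewrite mulrN1 opprK.
  apply: near_eq_is_derive (is_deriveN (h xn)).
  near=> y; rewrite !fctE /= ltr0_norm ?mulNr ?opprK//; near: y; exact: lt_nbhsl.
- rewrite gtr0_norm//; apply: near_eq_is_derive (main x x0).
  by near=> y; rewrite gtr0_norm//; near: y; exact: lt_nbhsr.
- have cv : h^-1 *: (((fun x : R => x * `|x| `^ p) \o shift 0) (h *: (1 : R)) - 0 * `|0 : R| `^ p) @[h --> (0 : R)^'] -->
      (p + 1) * `|0 : R| `^ p.
    have -> : (p + 1) * `|0 : R| `^ p = `|0 : R| `^ p.
      rewrite normr0; have [->|pn0] := eqVneq p 0; first by rewrite add0r mul1r.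
      by rewrite powR0// mulr0.
    have c0 : `|h| `^ p @[h --> (0 : R)^'] --> `|0 : R| `^ p.
      by apply: cvg_within_filter; exact: continuous_norm_powR.
    apply: cvg_trans c0; apply: near_eq_cvg; near=> h.
    have hn0 : h != 0 by near: h; exact: nbhs_dnbhs_neq.
    by rewrite /= /shift/= mul0r subr0 addr0 /GRing.scale/= mulr1 mulKf.
  rewrite x0; split; first by apply/cvg_ex; eexists; exact: cv.
  by apply: cvg_lim.
Unshelve. all: by end_near. Qed.

End powers_of_norms.

(** * Linear images of a standard normal vector *)

Lemma continuous_fsum (R : realType) (T : topologicalType) (I : finType)
    (F : I -> T -> R) :
  (forall i, continuous (F i)) -> continuous (fun x => \sum_i F i x).
Proof.
move=> cF; elim: (index_enum I) => [|i s IH] x.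
  by under eq_fun do rewrite big_nil; exact: cst_continuous.
under eq_fun do rewrite big_cons.
exact: (continuousD (cF i x) (IH x)).
Qed.

Section linear_image_of_gaussian.
Context (R : realType) (d0 : measure_display) (T : measurableType d0)
  (Q : probability T R) (d : nat) (Z : 'I_d -> {RV Q >-> R}) (S : 'M[R]_d).
Hypotheses (Z_normal : std_normal_vector Z) (S_sym : S^T = S).
Local Notation V := 'cV[R]_d.
Local Notation NZ := (gaussian_size Z).
Let Sg : 'M[R]_d := S *m S.

Definition gaussian_image (y : T) : V := S *m \col_j Z j y.
Local Notation SZ := gaussian_image.

Let NZ1 := gaussian_size_ge1 Z.
Let mZ k : measurable_fun setT (Z k : T -> R) := @measurable_funPT _ _ _ _ (Z k).

Lemma gaussian_imageE j y : SZ y j 0 = \sum_m S j m * Z m y.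
Proof. by rewrite mxE; apply: eq_bigr => m _; rewrite mxE. Qed.

Lemma dominated_gaussian_image j : dominated NZ 1 (fun y => SZ y j 0).
Proof.
under eq_fun do rewrite gaussian_imageE.
apply: dominated_sum => // m; apply: dominatedZ => //.
split => //; exists 1 => // y; rewrite mul1r powRr1; last first.
  exact: le_trans (NZ1 y).
by rewrite /gaussian_size (bigD1 m)//= addrCA lerDl addr_ge0// sumr_ge0.
Qed.

Lemma gaussian_image_integrable k f : 0 <= k -> dominated NZ k f ->
  Q.-integrable setT (EFin \o f).
Proof.
by move=> k0; apply: dominated_integrable => //; exact: gaussian_size_integrable.
Qed.

Let affine w0 c (z : V) : V := w0 + c *: (S *m z).

Let norm1_affine w0 c : exists2 K : R, 0 <= K &
  forall z, 1 + norm1 (affine w0 c z) <= K * (1 + norm1 z).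
Proof.
pose K := 1 + norm1 w0 + `|c| * \sum_i \sum_j `|S i j|.
have S0 : 0 <= \sum_i \sum_j `|S i j| by apply: sumr_ge0 => i _; apply: sumr_ge0.
exists K; first by rewrite !addr_ge0 ?norm1_ge0 ?mulr_ge0.
move=> z.
have h1 : norm1 (affine w0 c z) <= norm1 w0 + `|c| * ((\sum_i \sum_j `|S i j|) * norm1 z).
  rewrite /norm1 mulr_suml mulr_sumr -big_split/=; apply: ler_sum => i _.
  rewrite !mxE (le_trans (ler_normD _ _))// lerD2l normrM ler_wpM2l//.
  rewrite (le_trans (ler_norm_sum _ _ _))// mulr_suml; apply: ler_sum => j _.
  by rewrite normrM ler_wpM2l//; exact: coord_le_norm1.
have := norm1_ge0 z; have := norm1_ge0 w0; have := normr_ge0 c.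
rewrite /K; move: h1 S0; move: (\sum_i _) (norm1 (affine _ _ _)) (norm1 z) (norm1 w0) `|c|.
move=> a b e f g h1 a0 g0 f0 e0.
have : 0 <= g * a by rewrite mulr_ge0.
by nra.
Qed.

Let pgrowth_affine w0 c q f : 0 <= q -> pgrowth q f -> pgrowth q (f \o affine w0 c).
Proof.
move=> q0 [C C0 hC]; have [K K0 hK] := norm1_affine w0 c.
exists (C * K `^ q); first by rewrite mulr_ge0 ?powR_ge0.
move=> z /=; rewrite (le_trans (hC _))// -mulrA ler_wpM2l//.
rewrite -powRM ?addr_ge0 ?norm1_ge0// ge0_ler_powR// ?nnegrE ?mulr_ge0 ?addr_ge0 ?norm1_ge0//.
Qed.

Let continuous_mulS : continuous (fun z : V => S *m z).
Proof.
apply: (@bounded_linear_continuous _ _ _ (mulmx S : {linear V -> V})).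
apply/linear_boundedP; near=> r => x.
rewrite [leLHS]/normr/= mx_normrE; apply: bigmax_le.
  by rewrite mulr_ge0//; near: r; exact: nbhs_pinfty_ge.
move=> [i j] _ /=; rewrite ord1 mxE (le_trans (ler_norm_sum _ _ _))//.
apply: (@le_trans _ _ ((\sum_i \sum_j `|S i j|) * `|x|)); last first.
  by rewrite ler_wpM2r//; near: r; exact: nbhs_pinfty_ge.
rewrite [X in _ <= X * _](bigD1 i)//= mulrDl ler_wpDr//.
  by rewrite mulr_ge0// sumr_ge0// => k _; apply: sumr_ge0.
rewrite mulr_suml; apply: ler_sum => k _; rewrite normrM ler_wpM2l//.
rewrite [leRHS]/normr/= mx_normrE.
exact: (le_bigmax _ (fun p : 'I_d * 'I_1 => `|x p.1 p.2|) (k, 0)).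
Unshelve. all: by end_near.
Qed.

Let continuous_affine w0 c : continuous (affine w0 c).
Proof.
move=> z; apply: (@continuousD _ _ _ (cst w0) (fun z : V => c *: (S *m z))).
  exact: cst_continuous.
apply: (@continuousZl_tmp _ _ _ (fun z : V => S *m z)).
exact: continuous_mulS.
Qed.

Lemma dominated_gaussian_image_affine w0 c q f : 0 <= q -> continuous f -> pgrowth q f ->
  dominated NZ q (fun y => f (w0 + c *: SZ y)).
Proof.
move=> q0 cf gf.
have [C C0 hC] := pgrowth_affine w0 c q0 gf.
have cg : continuous (f \o affine w0 c).
  by move=> z; apply: continuous_comp; [exact: continuous_affine|exact: cf].
split; last first.
  exists C => // y; have := hC (\col_j Z j y).
  by congr (_ <= _ * (_ + _) `^ _); apply: eq_bigr => i _; rewrite mxE.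
exact: (measurable_continuous_col mZ cg).
Qed.

(** Integration by parts in each coordinate Z_m gives the derivative of f along
    the column S e_m times S j m; summing over m produces S S^T = S S. *)
Lemma gaussian_image_ibp j w0 c q (f : V -> R) (f1 : 'I_d -> V -> R) : 0 <= q ->
  (forall w v, is_derive w v f (\sum_k v k 0 * f1 k w)) ->
  continuous f -> (forall k, continuous (f1 k)) ->
  pgrowth q f -> (forall k, pgrowth q (f1 k)) ->
  \int[Q]_y (SZ y j 0 * f (w0 + c *: SZ y)) =
  c * \sum_k Sg j k * \int[Q]_y f1 k (w0 + c *: SZ y).
Proof.
move=> q0 df cf cf1 gf gf1.
pose G (z : V) := f (affine w0 c z).
pose G' m (z : V) := \sum_k (c * S k m) * f1 k (affine w0 c z).
have dG m z : is_derive z (e_ R m) G (G' m z).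
  apply: is_derive_of_line.
  have -> : (fun s : R => G (z + s *: e_ R m)) =
      (fun s : R => f (affine w0 c z + s *: (c *: (S *m e_ R m)))).
    apply/funext => s; rewrite /G /affine mulmxDr -scalemxAr scalerDr addrA.
    by rewrite !scalerA mulrC.
  apply: is_derive_line; rewrite scale0r addr0.
  have := df (affine w0 c z) (c *: (S *m e_ R m)).
  congr (is_derive _ _ _ _); apply: eq_bigr => k _.
  rewrite !mxE (bigD1 m)//= big1 ?addr0; first by rewrite mxE !eqxx mulr1.
  by move=> a am; rewrite mxE (negbTE am) /= mulr0.
have cG : continuous G.
  by move=> z; apply: continuous_comp; [exact: continuous_affine|exact: cf].
have cG' m : continuous (G' m).
  apply: continuous_fsum => k z; apply: (@continuousM _ _ (cst (c * S k m))).
    exact: cst_continuous.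
  by apply: (@continuous_comp _ _ _ (affine w0 c) (f1 k)); [exact: continuous_affine|exact: cf1].
have gG : pgrowth q G by exact: pgrowth_affine.
have gG' m : pgrowth q (G' m).
  have [C C0 hC] := @pgrowth_unif _ _ _ q _ (fun k => pgrowth_affine w0 c q0 (gf1 k)).
  exists (\sum_k `|c * S k m| * C); first by apply: sumr_ge0 => k _; rewrite mulr_ge0.
  move=> z; rewrite (le_trans (ler_norm_sum _ _ _))// mulr_suml; apply: ler_sum => k _.
  by rewrite normrM -mulrA ler_wpM2l//; exact: hC.
have if1 k : Q.-integrable setT (EFin \o (fun y => f1 k (w0 + c *: SZ y))).
  by apply: (gaussian_image_integrable q0); exact: dominated_gaussian_image_affine.
have domf := dominated_gaussian_image_affine w0 c q0 cf gf.
have domZ m : dominated NZ 1 (Z m).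
  split => //; exists 1 => // y; rewrite mul1r powRr1; last first.
    exact: le_trans (NZ1 y).
  by rewrite /gaussian_size (bigD1 m)//= addrCA lerDl addr_ge0// sumr_ge0.
have iZf m : Q.-integrable setT (EFin \o (fun y => S j m * (Z m y * f (w0 + c *: SZ y)))).
  apply: (@gaussian_image_integrable (1 + q)); first by rewrite addr_ge0.
  by apply: dominatedZ => //; apply: dominatedM.
transitivity (\int[Q]_y (\sum_m S j m * (Z m y * f (w0 + c *: SZ y)))).
  apply: eq_Rintegral => y _; rewrite gaussian_imageE mulr_suml.
  by apply: eq_bigr => m _; rewrite mulrA.
rewrite Rintegral_fsum//.
transitivity (\sum_m S j m * (\sum_k (c * S k m) * \int[Q]_y f1 k (w0 + c *: SZ y))).
  apply: eq_bigr => m _; rewrite RintegralZl//; last first.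
    apply: (@gaussian_image_integrable (1 + q)); first by rewrite addr_ge0.
    exact: dominatedM.
  congr (_ * _).
  have -> : \int[Q]_y (Z m y * f (w0 + c *: SZ y)) = \int[Q]_y (Z m y * G (\col_j Z j y)) by [].
  rewrite (gaussian_vector_ibp Z_normal q0 (dG m) cG (cG' m) gG (gG' m)).
  rewrite /G' Rintegral_fsum; last first.
    move=> k; apply: (@gaussian_image_integrable q) => //.
    by apply: dominatedZ => //; exact: dominated_gaussian_image_affine.
  by apply: eq_bigr => k _; rewrite RintegralZl//; exact: if1.
rewrite mulr_sumr; under eq_bigr do rewrite mulr_sumr.
rewrite exchange_big/=; apply: eq_bigr => k _.
rewrite /Sg mxE mulr_suml mulr_sumr; apply: eq_bigr => m _.
have -> : S k m = S m k by rewrite -{1}S_sym mxE.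
by ring.
Qed.

End linear_image_of_gaussian.

Section gaussian_image_moments.
Context (R : realType) (d0 : measure_display) (T : measurableType d0)
  (Q : probability T R) (d : nat) (Z : 'I_d -> {RV Q >-> R}) (S : 'M[R]_d).
Hypotheses (Z_normal : std_normal_vector Z) (S_sym : S^T = S).
Local Notation V := 'cV[R]_d.
Local Notation SZ := (gaussian_image Z S).
Let Sg : 'M[R]_d := S *m S.

Lemma is_derive_coord (t : 'I_d) (w v : V) :
  is_derive w v (fun w : V => w t 0) (v t 0).
Proof.
apply: is_derive_of_line.
have -> : (fun s : R => (w + s *: v) t 0) = (fun s : R => w t 0 + s * v t 0).
  by apply/funext => s; rewrite !mxE.
by apply: is_derive_eq; rewrite /GRing.scale/=; lra.
Qed.

Lemma continuous_coord (t : 'I_d) : continuous (fun w : V => w t 0).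
Proof. exact: coord_continuous. Qed.

Lemma pgrowth_coord_powR (t : 'I_d) p : 0 <= p -> pgrowth p (fun w : V => `|w t 0| `^ p).
Proof.
move=> p0; exists 1 => // w; rewrite mul1r ger0_norm ?powR_ge0//.
exact: powR_coord_growth.
Qed.

Lemma continuous_coord_powR (t : 'I_d) p : 0 <= p ->
  continuous (fun w : V => `|w t 0| `^ p).
Proof.
move=> p0 w; apply: (@continuous_comp _ _ _ (fun w : V => w t 0) (fun x : R => `|x| `^ p)).
  exact: continuous_coord.
exact: continuous_norm_powR.
Qed.

Let moment t p := \int[Q]_y (`|SZ y t 0| `^ p).

Lemma gaussian_image_powR_integrable t p : 0 <= p ->
  Q.-integrable setT (EFin \o (fun y => `|SZ y t 0| `^ p)).
Proof.
move=> p0; apply: (gaussian_image_integrable Z_normal p0).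
have := dominated_gaussian_image_affine Z S 0 1 p0 (continuous_coord_powR (t := t) p0)
  (pgrowth_coord_powR t p0).
by under eq_fun do rewrite add0r scale1r.
Qed.

Lemma gaussian_image_mean t : \int[Q]_y SZ y t 0 = 0.
Proof.
have df (w v : V) : is_derive w v (cst 1 : V -> R) (\sum_k v k 0 * (cst 0 : V -> R) w).
  rewrite big1; first exact: is_derive_cst.
  by move=> k _; rewrite mulr0.
have c1 (c : R) : continuous (cst c : V -> R) by exact: cst_continuous.
have g1 (c : R) : pgrowth 0 (cst c : V -> R).
  by exists `|c| => // w; rewrite powRr0 mulr1.
have := gaussian_image_ibp Z_normal S_sym t 0 1 (lexx 0) df (c1 1) (fun _ => c1 0) (g1 1) (fun _ => g1 0).
rewrite /cst; under eq_Rintegral do rewrite mulr1; move=> ->.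
rewrite mul1r big1// => k _; rewrite Rintegral_cst// mul0r mulr0//.
Qed.

(** Gaussian integration by parts for the function w_t |w_t|^p. *)
Lemma gaussian_image_moment_rec t p : 0 <= p ->
  moment t (p + 2) = (p + 1) * Sg t t * moment t p.
Proof.
move=> p0.
pose f (w : V) := w t 0 * `|w t 0| `^ p.
pose f1 k (w : V) : R := if k == t then (p + 1) * `|w t 0| `^ p else 0.
have p10 : 0 <= p + 1 by rewrite addr_ge0.
have df (w v : V) : is_derive w v f (\sum_k v k 0 * f1 k w).
  rewrite (bigD1 t)//= big1 ?addr0; last first.
    by move=> k kt; rewrite /f1 (negbTE kt) mulr0.
  rewrite /f1 eqxx mulrC.
  exact: (is_derive_comp1 (is_derive_odd_power (w t 0) p0) (is_derive_coord t w v)).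
have cf : continuous f.
  move=> w; apply: (@continuousM _ _ (fun w : V => w t 0) (fun w : V => `|w t 0| `^ p)).
    exact: continuous_coord.
  exact: continuous_coord_powR.
have cf1 k : continuous (f1 k).
  rewrite /f1; case: (k == t); last exact: cst_continuous.
  move=> w; apply: (@continuousM _ _ (cst (p + 1)) (fun w : V => `|w t 0| `^ p)).
    exact: cst_continuous.
  exact: continuous_coord_powR.
have gf : pgrowth (p + 1) f.
  exists 1 => // w; rewrite mul1r /f normrM [`|_ `^ p|]ger0_norm ?powR_ge0//.
  rewrite [p + 1]addrC powRD; last by apply/implyP; rewrite gt_eqF//; lra.
  have L0 : 0 <= 1 + norm1 w by rewrite addr_ge0 ?norm1_ge0.
  rewrite powRr1// ler_pM ?powR_ge0 ?powR_coord_growth//.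
  by rewrite (le_trans (coord_le_norm1 w t))// lerDr.
have gf1 k : pgrowth (p + 1) (f1 k).
  exists (p + 1) => // w; rewrite /f1; case: ifP => _; last first.
    by rewrite normr0 mulr_ge0// powR_ge0.
  rewrite normrM ger0_norm// ler_wpM2l// ger0_norm ?powR_ge0//.
  by rewrite powR_coord_growth// lerDl.
have := gaussian_image_ibp Z_normal S_sym t 0 1 p10 df cf cf1 gf gf1.
under eq_Rintegral do rewrite add0r scale1r.
have -> : \int[Q]_y (SZ y t 0 * f (SZ y)) = moment t (p + 2).
  apply: eq_Rintegral => y _; rewrite /f mulrA -expr2 -[_ ^+ 2]real_normK ?num_real//.
  rewrite -[`|SZ y t 0| ^+ 2]powR_mulrn// [p + 2]addrC [RHS]powRD//.
  by rewrite [2 + p == 0]gt_eqF//; lra.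
move=> ->; rewrite mul1r (bigD1 t)//= big1 ?addr0; last first.
  by move=> k kt; rewrite /f1 (negbTE kt) Rintegral_cst// mul0r mulr0.
rewrite /f1 eqxx; under eq_Rintegral do rewrite add0r scale1r.
rewrite RintegralZl//; first by rewrite mulrCA mulrA.
exact: gaussian_image_powR_integrable.
Qed.

Lemma gaussian_image_variance t : \int[Q]_y (SZ y t 0) ^+ 2 = Sg t t.
Proof.
have := gaussian_image_moment_rec t (lexx 0).
rewrite !add0r mul1r {2}/moment; under [X in _ * X]eq_Rintegral do rewrite powRr0.
rewrite Rintegral_probability_cst mulr1 => <-.
by apply: eq_Rintegral => y _; rewrite powR_mulrn// real_normK ?num_real.
Qed.

Lemma gaussian_image_variance_ge0 t : 0 <= Sg t t.
Proof. by rewrite -gaussian_image_variance; apply: Rintegral_ge0 => y _; exact: sqr_ge0. Qed.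

(** For a centred Gaussian variable V with standard deviation s this says that
    s^r <= 2^r E|V|^r for every r >= 0. For small r it replaces an explicit formula
    for absolute moments, which would involve the Gamma function. The recursion
    m_(p+2) = (p + 1) s^2 m_p reduces the moment of order r to that of order r + 10,
    where powR_even_moment_bound is sharp enough, and six_powR_ge compares the
    accumulated factors. *)
Lemma gaussian_image_moment_ge t r : 0 <= r ->
  Num.sqrt (Sg t t) `^ r <= 2 `^ r * \int[Q]_y (`|SZ y t 0| `^ r).
Proof.
move=> r0.
have m_ge0 p : 0 <= moment t p by apply: Rintegral_ge0 => y _; exact: powR_ge0.
pose s := Num.sqrt (Sg t t).
have s0 : 0 <= s by exact: sqrtr_ge0.
have sE : Sg t t = s ^+ 2 by rewrite sqr_sqrtr// gaussian_image_variance_ge0.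
have m0 : moment t 0 = 1.
  rewrite /moment; under eq_Rintegral do rewrite powRr0.
  exact: Rintegral_probability_cst.
rewrite -/s -/(moment t r); have [->|sn0] := eqVneq s 0.
  have [->|rn0] := eqVneq r 0; first by rewrite !powRr0 m0 mulr1.
  by rewrite powR0// mulr_ge0 ?powR_ge0.
have sp : 0 < s by rewrite lt_neqAle eq_sym sn0.
have rec p := @gaussian_image_moment_rec t p; rewrite sE in rec.
pose m n := moment t n%:R.
have recn (n : nat) : m n.+2 = (n%:R + 1) * s ^+ 2 * m n.
  by rewrite /m -rec// -natrD addn2.
have recr (n : nat) : moment t (r + n.+2%:R) = (r + n%:R + 1) * s ^+ 2 * moment t (r + n%:R).
  rewrite -rec ?addr_ge0//; congr moment.
  by rewrite -addrA -natrD addn2.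
have im (p : R) : 0 <= p -> Q.-integrable setT (EFin \o (fun y => `|SZ y t 0| `^ p)).
  exact: gaussian_image_powR_integrable.
have evn (n : nat) (x : R) : `|x| `^ (n.*2)%:R = x ^+ n.*2.
  rewrite powR_mulrn// -normrX ger0_norm// -muln2 exprM.
  exact: sqr_ge0.
(* the tenth moment is 9 s^2 times the eighth, so that with a = 3 s the correction
     in powR_even_moment_bound integrates to 0 *)
pose a := 3 * s.
have ap : 0 < a by rewrite mulr_gt0.
have key : a `^ r * m 10 <= moment t (r + 10).
  pose u y := `|SZ y t 0| `^ 10%:R; pose v y := `|SZ y t 0| `^ 8%:R.
  have iu : Q.-integrable setT (EFin \o u) by exact: im.
  have iv : Q.-integrable setT (EFin \o v) by exact: im.
  have e : \int[Q]_y (a `^ r * (1 + r / 2) * u y - a `^ r * (r / 2 * a ^+ 2) * v y) = a `^ r * m 10.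
    rewrite RintegralB//; try exact: integrable_scale.
    rewrite !RintegralZl//.
    have -> : \int[Q]_x u x = m 10 by [].
    have -> : \int[Q]_x v x = m 8 by [].
    by rewrite (recn 8%N) /a; ring.
  rewrite -e; apply: le_Rintegral => //.
  - by apply: integrable_sub; exact: integrable_scale.
  - by apply: im; rewrite addr_ge0.
  - move=> y _; have := powR_even_moment_bound (SZ y t 0) ap r0.
    have e10 (x : R) : `|x| `^ 10 = x ^+ 10 := evn 5%N x.
    have e8 (x : R) : `|x| `^ 8 = x ^+ 8 := evn 4%N x.
    have pr : 0 < 10 + r by lra.
    rewrite /u /v e10 e8 -[X in _ <= X * _]e10 -powRD; last by rewrite gt_eqF.
    rewrite [10 + r]addrC; apply: le_trans.
    by rewrite le_eqVlt; apply/orP; left; apply/eqP; ring.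
have e10 : m 10 = 9 * 7 * 5 * 3 * s ^+ 10.
  rewrite (recn 8%N) (recn 6%N) (recn 4%N) (recn 2%N) (recn 0%N) /m m0 !natr1.
  by ring.
have er10 : moment t (r + 10) = (r + 9) * (r + 7) * (r + 5) * (r + 3) * (r + 1) * s ^+ 10 * moment t r.
  rewrite (recr 8%N) (recr 6%N) (recr 4%N) (recr 2%N) (recr 0%N) addr0.
  by ring.
have s10 : 0 < s ^+ 10 by rewrite exprn_gt0.
move: key; rewrite e10 er10.
pose Pi := (1 + r) * (1 + r / 3) * (1 + r / 5) * (1 + r / 7) * (1 + r / 9).
have -> : (r + 9) * (r + 7) * (r + 5) * (r + 3) * (r + 1) * s ^+ 10 * moment t r =
   (Pi * moment t r) * (9 * 7 * 5 * 3 * s ^+ 10) by rewrite /Pi; field.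
rewrite ler_pM2r; last by rewrite !mulr_gt0.
move=> h; have : a `^ r <= 6 `^ r * moment t r.
  apply: (le_trans h); rewrite ler_wpM2r//; exact: six_powR_ge.
have -> : 6 = 3 * 2 :> R by lra.
rewrite /a !powRM// -mulrA ler_pM2l// powR_gt0//.
Qed.

End gaussian_image_moments.

(** * Iterated real-valued integrals *)

Section product_space.
Context (R : realType) (dT dT' : measure_display) (T : measurableType dT)
  (T' : measurableType dT') (P : probability T R) (Q : probability T' R).
Local Notation mu := (P \x Q)%E.

Lemma integrable_prod (f : T -> R) (g : T' -> R) :
  P.-integrable setT (EFin \o f) -> Q.-integrable setT (EFin \o g) ->
  mu.-integrable setT (EFin \o (fun z => f z.1 * g z.2)).
Proof.
move=> fi gi.
have mf : measurable_fun setT f by apply/measurable_EFinP; exact: measurable_int fi.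
have mg : measurable_fun setT g by apply/measurable_EFinP; exact: measurable_int gi.
have mfg : measurable_fun setT (EFin \o (fun z : T * T' => f z.1 * g z.2)).
  by apply/measurable_EFinP; apply: measurable_funM; [exact: (measurableT_comp mf measurable_fst)|exact: (measurableT_comp mg measurable_snd)].
apply/integrable12ltyP => //.
have /integrableP[_ gfin] := gi; have /integrableP[_ ffin] := fi.
have mag : measurable_fun setT (fun y => `|g y|%:E).
  by apply/measurable_EFinP; exact: (measurableT_comp (normr_measurable (D := setT))).
have maf : measurable_fun setT (fun y => `|f y|%:E).
  by apply/measurable_EFinP; exact: (measurableT_comp (normr_measurable (D := setT))).
have -> : (\int[P]_x \int[Q]_y `|(EFin \o (fun z : T * T' => (f z.1 * g z.2)%R)) (x, y)| =
    \int[P]_x (`|f x|%:E * \int[Q]_y `|g y|%:E))%E.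
  apply: eq_integral => x _; rewrite -ge0_integralZl//.
  by apply: eq_integral => y _; rewrite /= normrM EFinM.
rewrite ge0_integralZr//; last exact: integral_ge0.
apply: lte_mul_pinfty; [exact: integral_ge0| |exact: gfin].
by rewrite ge0_fin_numE ?ffin//; exact: integral_ge0.
Qed.

Lemma Rintegral_iterated (F : T * T' -> R) :
  mu.-integrable setT (EFin \o F) ->
  (forall x, Q.-integrable setT (EFin \o (fun y => F (x, y)))) ->
  \int[mu]_z F z = \int[P]_x (\int[Q]_y F (x, y)).
Proof.
move=> iF iFx; rewrite /Rintegral -integral12_prod_meas1//; congr fine.
apply: eq_integral => x _; rewrite /fubini_F fineK//.
exact: integrable_fin_num (iFx x).
Qed.

Lemma Rintegral_iterated_swap (F : T * T' -> R) :
  mu.-integrable setT (EFin \o F) ->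
  (forall y, P.-integrable setT (EFin \o (fun x => F (x, y)))) ->
  \int[mu]_z F z = \int[Q]_y (\int[P]_x F (x, y)).
Proof.
move=> iF iFy; rewrite /Rintegral -integral21_prod_meas1//; congr fine.
apply: eq_integral => y _; rewrite /fubini_G fineK//.
exact: integrable_fin_num (iFy y).
Qed.

Lemma integrable_iterated (F : T * T' -> R) :
  mu.-integrable setT (EFin \o F) ->
  (forall x, Q.-integrable setT (EFin \o (fun y => F (x, y)))) ->
  P.-integrable setT (EFin \o (fun x => \int[Q]_y F (x, y))).
Proof.
move=> iF iFx; apply: eq_integrable (integrable_fubini_F iF) => // x _ /=.
rewrite /fubini_F /Rintegral fineK//.
exact: integrable_fin_num (iFx x).
Qed.

Lemma integrable_iterated_swap (F : T * T' -> R) :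
  mu.-integrable setT (EFin \o F) ->
  (forall y, P.-integrable setT (EFin \o (fun x => F (x, y)))) ->
  Q.-integrable setT (EFin \o (fun y => \int[P]_x F (x, y))).
Proof.
move=> iF iFy.
have E y : (\int[P]_x F (x, y))%:E = fubini_G P (EFin \o F) y.
  by rewrite /fubini_G /Rintegral fineK//; exact: integrable_fin_num (iFy y).
have mF := measurable_int _ iF.
have Ef : EFin \o (fun y => \int[P]_x F (x, y)) = fubini_G P (EFin \o F).
  by apply/funext => y; exact: E.
have mG : measurable_fun setT (fubini_G P (EFin \o F)) by exact: (measurable_fubini_G iF).
rewrite Ef; apply/integrableP; split => //.
have := (integrable21ltyP P Q mF).1 iF; apply: le_lt_trans.
apply: ge0_le_integral => //.
- exact: measurableT_comp.
- apply: (measurable_fun_fubini_tonelli_G (abse \o (EFin \o F))).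
    exact: measurableT_comp.
  by move=> z; exact: abse_ge0.
- move=> y _; rewrite /fubini_G; apply: le_abse_integral => //.
  exact: measurable_int (iFy y).
Qed.

Lemma integrable_fst (f : T -> R) : P.-integrable setT (EFin \o f) ->
  mu.-integrable setT (EFin \o (fun z => f z.1)).
Proof.
move=> fi; have ic : Q.-integrable setT (EFin \o cst (1 : R)).
  exact: finite_measure_integrable_cst.
by apply: eq_integrable (integrable_prod fi ic) => // z _ /=; rewrite mulr1.
Qed.

Lemma Rintegral_fst (f : T -> R) : P.-integrable setT (EFin \o f) ->
  \int[mu]_z f z.1 = \int[P]_x f x.
Proof.
move=> fi; rewrite (Rintegral_iterated (integrable_fst fi)) /=.
  by apply: eq_Rintegral => x _; exact: Rintegral_probability_cst.
by move=> x; exact: finite_measure_integrable_cst.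
Qed.

Lemma integrable_snd (g : T' -> R) : Q.-integrable setT (EFin \o g) ->
  mu.-integrable setT (EFin \o (fun z => g z.2)).
Proof.
move=> gi; have ic : P.-integrable setT (EFin \o cst (1 : R)).
  exact: finite_measure_integrable_cst.
by apply: eq_integrable (integrable_prod ic gi) => // z _ /=; rewrite mul1r.
Qed.

Lemma Rintegral_snd (g : T' -> R) : Q.-integrable setT (EFin \o g) ->
  \int[mu]_z g z.2 = \int[Q]_y g y.
Proof.
move=> gi; rewrite (Rintegral_iterated_swap (integrable_snd gi)) /=.
  by apply: eq_Rintegral => x _; exact: Rintegral_probability_cst.
by move=> x; exact: finite_measure_integrable_cst.
Qed.

Lemma Rintegral_prod (f : T -> R) (g : T' -> R) :
  P.-integrable setT (EFin \o f) -> Q.-integrable setT (EFin \o g) ->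
  \int[mu]_z (f z.1 * g z.2) = \int[P]_x f x * \int[Q]_y g y.
Proof.
move=> fi gi.
have sl (x : T) : Q.-integrable setT (EFin \o (fun y => f x * g y)) by exact: integrable_scale.
rewrite (Rintegral_iterated (integrable_prod fi gi) sl) /=.
rewrite -RintegralZr//; apply: eq_Rintegral => x _; exact: RintegralZl.
Qed.

End product_space.

(** * Normalized sums and their sizes *)

Section sums_setting.
Context (R : realType) (dT dT' : measure_display) (T : measurableType dT)
  (T' : measurableType dT') (P : probability T R) (Q : probability T' R)
  (n d : nat) (X : 'I_n -> 'I_d -> {RV P >-> R}) (Z : 'I_d -> {RV Q >-> R})
  (q : R).
Hypotheses (q0 : 0 <= q)
  (X_mom : forall i j, P.-integrable setT (EFin \o (fun x => `|X i j x| `^ (q + 3))))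
  (Z_normal : std_normal_vector Z).
Local Notation mu := (P \x Q)%E.
Local Notation NZ := (gaussian_size Z).
Local Notation rn := (@Num.sqrt R n%:R)^-1.

(** The size functions for the sample and for the pair of sample and Gaussian
    vector. The moment hypothesis makes their (q + 3)-th powers integrable. *)
Definition sample_size (x : T) : R := 1 + \sum_(p : 'I_n * 'I_d) `|X p.1 p.2 x|.
Local Notation NX := sample_size.

Definition joint_size (z : T * T') : R := NX z.1 * NZ z.2.
Local Notation N := joint_size.

Lemma sample_size_ge1 x : 1 <= NX x.
Proof. by rewrite lerDl sumr_ge0. Qed.

Lemma joint_size_ge1 z : 1 <= N z.
Proof.
have := sample_size_ge1 z.1; have := gaussian_size_ge1 Z z.2.
by rewrite /N; move: (NX _) (NZ _) => a b; nra.
Qed.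

Let mX i j : measurable_fun setT (X i j : T -> R) := @measurable_funPT _ _ _ _ (X i j).
Let q30 : 0 <= q + 3. Proof. by rewrite addr_ge0. Qed.

Lemma sample_size_integrable : P.-integrable setT (fun x => (NX x `^ (q + 3))%:E).
Proof.
have := @one_plus_sum_powR_integrable _ _ _ P ('I_n * 'I_d)%type
  (fun p => X p.1 p.2 : T -> R) (q + 3) q30.
by apply => p; [exact: mX|exact: X_mom].
Qed.

Lemma joint_size_integrable : mu.-integrable setT (fun z => (N z `^ (q + 3))%:E).
Proof.
have := integrable_prod (f := fun x => NX x `^ (q + 3)) (g := fun y => NZ y `^ (q + 3))
  sample_size_integrable (gaussian_size_integrable Z_normal q30).
apply: eq_integrable => // z _ /=; rewrite /N powRM//.
  exact: le_trans (sample_size_ge1 _).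
exact: le_trans (gaussian_size_ge1 _ _).
Qed.

Lemma sample_integrable k f : k <= q + 3 -> dominated NX k f ->
  P.-integrable setT (EFin \o f).
Proof.
move=> k3; apply: dominated_integrable k3 sample_size_integrable.
exact: sample_size_ge1.
Qed.

Lemma joint_integrable k f : k <= q + 3 -> dominated N k f ->
  mu.-integrable setT (EFin \o f).
Proof.
move=> k3; apply: dominated_integrable k3 joint_size_integrable.
exact: joint_size_ge1.
Qed.

Lemma dominated_fst k f : 0 <= k -> dominated NX k f -> dominated N k (fun z => f z.1).
Proof.
move=> k0 [mf [C C0 hC]]; split; first by apply: (measurableT_comp mf).
exists C => // z; rewrite (le_trans (hC _))// ler_wpM2l//.
have := sample_size_ge1 z.1; have := gaussian_size_ge1 Z z.2 => h1 h2.
rewrite ge0_ler_powR// ?nnegrE.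
- exact: le_trans h2.
- by rewrite mulr_ge0 ?(le_trans ler01).
- by rewrite /N ler_peMr// (le_trans ler01).
Qed.

Lemma dominated_snd k f : 0 <= k -> dominated NZ k f -> dominated N k (fun z => f z.2).
Proof.
move=> k0 [mf [C C0 hC]]; split; first by apply: (measurableT_comp mf).
exists C => // z; rewrite (le_trans (hC _))// ler_wpM2l//.
have := sample_size_ge1 z.1; have := gaussian_size_ge1 Z z.2 => h1 h2.
rewrite ge0_ler_powR// ?nnegrE.
- exact: le_trans h1.
- by rewrite mulr_ge0 ?(le_trans ler01).
- by rewrite /N ler_peMl// (le_trans ler01).
Qed.

Lemma dominated_sample i j : dominated NX 1 (X i j).
Proof.
split; first exact: mX.
exists 1 => // x; rewrite mul1r powRr1; last exact: le_trans (sample_size_ge1 x).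
by rewrite /NX (bigD1 (i, j))//= addrCA lerDl addr_ge0// sumr_ge0.
Qed.

Lemma dominated_slice_fst k F y : 0 <= k -> dominated N k F ->
  dominated NX k (fun x => F (x, y)).
Proof.
move=> k0 [mF [C C0 hC]]; split; first exact: (measurable_fun_pair1 y mF).
exists (C * NZ y `^ k); first by rewrite mulr_ge0 ?powR_ge0.
move=> x; rewrite (le_trans (hC _))// /N /= powRM ?(le_trans ler01) ?sample_size_ge1 ?gaussian_size_ge1//.
by rewrite mulrCA mulrC.
Qed.

Lemma dominated_slice_snd k F x : 0 <= k -> dominated N k F ->
  dominated NZ k (fun y => F (x, y)).
Proof.
move=> k0 [mF [C C0 hC]]; split; first exact: (measurable_fun_pair2 x mF).
exists (C * NX x `^ k); first by rewrite mulr_ge0 ?powR_ge0.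
move=> y; rewrite (le_trans (hC _))// /N /= powRM ?(le_trans ler01) ?sample_size_ge1 ?gaussian_size_ge1//.
by rewrite mulrA.
Qed.

(** The normalized sum without its i-th summand, with the normalization of the
    whole sum. *)
Definition partial_sum i j (x : T) : R := rn * \sum_(k < n | k != i) X k j x.

Lemma normalized_sumE i j x : normalized_sum X j x = partial_sum i j x + rn * X i j x.
Proof. by rewrite /normalized_sum /partial_sum (bigD1 i)//= mulrDr addrC. Qed.

Lemma dominated_normalized_sum j : dominated NX 1 (normalized_sum X j).
Proof.
apply: dominatedZ; first exact: sample_size_ge1.
apply: dominated_sum => //; first exact: sample_size_ge1.
by move=> i; exact: dominated_sample.
Qed.

Lemma dominated_partial_sum i j : dominated NX 1 (partial_sum i j).
Proof.
have -> : partial_sum i j = fun x => normalized_sum X j x - rn * X i j x.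
  by apply/funext => x; rewrite (normalized_sumE i) addrK.
apply: dominatedB; first exact: sample_size_ge1; first exact: dominated_normalized_sum.
by apply: dominatedZ; [exact: sample_size_ge1|exact: dominated_sample].
Qed.

End sums_setting.

(** * The interpolation and the independence it retains *)

Lemma dominated_col (R : realType) (dT : measure_display) (T : measurableType dT)
    (N : T -> R) (d : nat) (a : 'I_d -> T -> R) (f : 'cV[R]_d -> R) k :
  (forall x, 1 <= N x) -> 0 <= k ->
  (forall j, dominated N 1 (a j)) -> continuous f -> pgrowth k f ->
  dominated N k (fun z => f (\col_j a j z)).
Proof.
move=> N1 k0 ha cf [C C0 hC]; split.
  by apply: measurable_continuous_col => // j; have [] := ha j.
have /choice[D hD] : forall j, exists D : R, 0 <= D /\ forall z, `|a j z| <= D * N z.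
  move=> j; have [_ [D D0 hD]] := ha j; exists D; split => // z.
  by rewrite (le_trans (hD z))// powRr1// (le_trans ler01).
have SD0 : 0 <= \sum_j D j by apply: sumr_ge0 => j _; have [] := hD j.
exists (C * (1 + \sum_j D j) `^ k); first by rewrite mulr_ge0 ?powR_ge0.
move=> z; rewrite (le_trans (hC _))// -mulrA ler_wpM2l//.
have Nz0 : 0 <= N z by rewrite (le_trans ler01).
have b0 : 0 <= 1 + \sum_j D j by rewrite addr_ge0.
rewrite -powRM// ge0_ler_powR// ?nnegrE ?(mulr_ge0 b0 Nz0) ?addr_ge0 ?norm1_ge0//.
rewrite mulrDl mul1r lerD// /norm1 mulr_suml; apply: ler_sum => j _.
by rewrite mxE; have [_ ] := hD j; apply.
Qed.

Section sums_independence.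
Context (R : realType) (dT dT' : measure_display) (T : measurableType dT)
  (T' : measurableType dT') (P : probability T R) (Q : probability T' R)
  (n d : nat) (X : 'I_n -> 'I_d -> {RV P >-> R}) (Z : 'I_d -> {RV Q >-> R})
  (S : 'M[R]_d) (q : R).
Hypotheses (X_indep : mutually_independent P (fun i => random_vector (X i)))
  (q0 : 0 <= q)
  (X_mom : forall i j, P.-integrable setT (EFin \o (fun x => `|X i j x| `^ (q + 3))))
  (Z_normal : std_normal_vector Z).
Local Notation mu := (P \x Q)%E.
Local Notation V := 'cV[R]_d.
Local Notation SZ := (gaussian_image Z S).
Local Notation rn := (Num.sqrt n%:R)^-1.

Local Notation NX := (sample_size X).
Local Notation N := (joint_size X Z).
Let NX1 := sample_size_ge1 X.
Let N1 := joint_size_ge1 X Z.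
Let mX i j : measurable_fun setT (X i j : T -> R) := @measurable_funPT _ _ _ _ (X i j).
Let vec i : T -> d.-tuple R := random_vector (X i).

Let mvec i : measurable_fun setT (vec i).
Proof.
apply/measurable_fun_tnthP => k.
rewrite (_ : _ \o _ = X i k); last by apply/funext => x /=; rewrite tnth_mktuple.
exact: mX.
Qed.

Let tnth_vec i x j : tnth (vec i x) j = X i j x.
Proof. by rewrite tnth_mktuple. Qed.

Let tnth_family x k : tnth (family_tuple vec x) k = vec k x.
Proof. by rewrite tnth_mktuple. Qed.

Let tnth_replace i x b k : tnth (replace_coord vec i x b) k = if k == i then b else vec k x.
Proof. by rewrite tnth_mktuple. Qed.

(** Dependence on the i-th vector only, and independence of the i-th vector, are
    expressed by factorization through the i-th vector, resp. by a factorization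
    through the whole family that is insensitive to replacing the i-th vector. *)
Definition depends_on i (phi : T -> R) := exists2 phi' : d.-tuple R -> R,
  measurable_fun setT phi' & forall x, phi x = phi' (vec i x).

Definition depends_off i (F : T -> R) := exists F' : n.-tuple (d.-tuple R) -> R,
  [/\ measurable_fun setT F', forall x, F x = F' (family_tuple vec x) &
      forall x b, F' (replace_coord vec i x b) = F' (family_tuple vec x)].

Lemma depends_on_sample i j : depends_on i (X i j).
Proof.
exists (fun t => tnth t j); first exact: measurable_tnth.
by move=> x; rewrite tnth_vec.
Qed.

Lemma depends_onM i f g : depends_on i f -> depends_on i g ->
  depends_on i (fun x => f x * g x).
Proof.
move=> [f' mf hf] [g' mg hg]; exists (fun t => f' t * g' t).
  exact: measurable_funM.
by move=> x; rewrite hf hg.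
Qed.

Lemma depends_on_abs i f : depends_on i f -> depends_on i (fun x => `|f x|).
Proof.
move=> [f' mf hf]; exists (fun t => `|f' t|).
  by apply: (measurableT_comp (normr_measurable (D := setT))).
by move=> x; rewrite hf.
Qed.

Lemma depends_off_partial_sum i j : depends_off i (partial_sum X i j).
Proof.
exists (fun t => rn * \sum_(k < n | k != i) tnth (tnth t k) j); split.
- apply: measurable_funM => //.
  under eq_fun do rewrite big_mkcond; apply: measurable_sum => k.
  case: (k != i) => //.
  by apply: (measurableT_comp (measurable_tnth j)); exact: measurable_tnth.
- move=> x; rewrite /partial_sum; congr (_ * _); apply: eq_bigr => k _.
  by rewrite tnth_family tnth_vec.
- move=> x b; congr (_ * _); apply: eq_bigr => k ki.
  by rewrite tnth_family tnth_replace (negbTE ki).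
Qed.

Lemma depends_off_comp i (G : R -> R) F : measurable_fun setT G -> depends_off i F ->
  depends_off i (G \o F).
Proof.
move=> mG [F' [mF hF invF]]; exists (G \o F'); split.
- exact: (measurableT_comp mG).
- by move=> x /=; rewrite hF.
- by move=> x b /=; rewrite invF.
Qed.

Lemma depends_off_col i (a : 'I_d -> T -> R) (f : V -> R) : continuous f ->
  (forall j, depends_off i (a j)) -> depends_off i (fun x => f (\col_j a j x)).
Proof.
move=> cf /choice[a' ha]; exists (fun t => f (\col_j a' j t)); split.
- by apply: measurable_continuous_col => // j; have [] := ha j.
- by move=> x; congr f; apply/matrixP => j k; rewrite !mxE; have [_ ->] := ha j.
- by move=> x b; congr f; apply/matrixP => j k; rewrite !mxE; have [_ _ ->] := ha j.
Qed.

Lemma depends_off_affine i F a b : depends_off i F -> depends_off i (fun x => a * F x + b).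
Proof.
apply: (@depends_off_comp i (fun y => a * y + b)).
by apply: measurable_funD => //; exact: measurable_funM.
Qed.

(** The form in which the independence of the vectors is used. *)
Lemma sample_independent i phi F k1 k2 : 0 <= k1 -> 0 <= k2 -> k1 + k2 <= q + 3 ->
  depends_on i phi -> depends_off i F -> dominated NX k1 phi -> dominated NX k2 F ->
  \int[P]_x (phi x * F x) = \int[P]_x phi x * \int[P]_x F x.
Proof.
move=> k10 k20 k12 [phi' mphi hphi] [F' [mF hF invF]] dphi dF.
have i1 : P.-integrable setT (EFin \o (phi' \o vec i)).
  have := sample_integrable q0 X_mom (_ : k1 <= q + 3) dphi.
  rewrite (_ : phi = phi' \o vec i); last by apply/funext.
  by apply; lra.
have i2 : P.-integrable setT (EFin \o (F' \o family_tuple vec)).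
  have := sample_integrable q0 X_mom (_ : k2 <= q + 3) dF.
  rewrite (_ : F = F' \o family_tuple vec); last by apply/funext.
  by apply; lra.
have i12 : P.-integrable setT (EFin \o (fun x => phi' (vec i x) * F' (family_tuple vec x))).
  have := sample_integrable q0 X_mom k12 (dominatedM NX1 dphi dF).
  by apply: eq_integrable => // x _; rewrite /= hphi hF.
have := independent_Rintegral mvec X_indep mphi mF invF i1 i2 i12.
have -> : \int[P]_x (phi' (vec i x) * F' (family_tuple vec x)) = \int[P]_x (phi x * F x).
  by apply: eq_Rintegral => x _; rewrite hphi hF.
have -> : \int[P]_x phi' (vec i x) = \int[P]_x phi x.
  by apply: eq_Rintegral => x _; rewrite hphi.
by have -> : \int[P]_x F' (family_tuple vec x) = \int[P]_x F x
  by apply: eq_Rintegral => x _; rewrite hF.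
Qed.

(** The interpolation without the i-th summand: it is independent of the i-th
    vector. *)
Definition mixture i (s c : R) (z : T * T') : V :=
  \col_j (s * partial_sum X i j z.1 + c * SZ z.2 j 0).

(** With s^2 + c^2 = 1 the covariance is that of the normalized sum;
    (s, c) = (1, 0) is the normalized sum and (0, 1) the Gaussian vector. *)
Definition interpolation (s c : R) (z : T * T') : V :=
  \col_j (s * normalized_sum X j z.1 + c * SZ z.2 j 0).

Lemma dominated_joint_image j : dominated N 1 (fun z => SZ z.2 j 0).
Proof. exact: (dominated_snd X ler01 (dominated_gaussian_image Z S j)). Qed.

Lemma dominated_mixture i s c k (f : V -> R) : 0 <= k -> continuous f -> pgrowth k f ->
  dominated N k (fun z => f (mixture i s c z)).
Proof.
move=> k0 cf gf; apply: dominated_col => // j; apply: dominatedD => //.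
  apply: dominatedZ => //; exact: (dominated_fst Z ler01 (dominated_partial_sum X i j)).
by apply: dominatedZ => //; exact: dominated_joint_image.
Qed.

Lemma dominated_interpolation s c k (f : V -> R) : 0 <= k -> continuous f -> pgrowth k f ->
  dominated N k (fun z => f (interpolation s c z)).
Proof.
move=> k0 cf gf; apply: dominated_col => // j; apply: dominatedD => //.
  apply: dominatedZ => //; exact: (dominated_fst Z ler01 (dominated_normalized_sum X j)).
by apply: dominatedZ => //; exact: dominated_joint_image.
Qed.

(** For a fixed value of the Gaussian vector the mixture depends on the other
    vectors only, so sample_independent applies on each slice. *)
Lemma mixture_independent i phi s c k1 k2 (f : V -> R) :
  0 <= k1 -> 0 <= k2 -> k1 + k2 <= q + 3 ->
  depends_on i phi -> dominated NX k1 phi -> continuous f -> pgrowth k2 f ->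
  \int[mu]_z (phi z.1 * f (mixture i s c z)) =
  \int[P]_x phi x * \int[mu]_z f (mixture i s c z).
Proof.
move=> k10 k20 k12 hphi dphi cf gf.
have df := dominated_mixture i s c k20 cf gf.
have dphif := dominatedM N1 (dominated_fst Z k10 dphi) df.
have k2q : k2 <= q + 3 by lra.
have if1 := joint_integrable q0 X_mom Z_normal k2q df.
have if2 := joint_integrable q0 X_mom Z_normal k12 dphif.
have sl1 y := sample_integrable q0 X_mom k2q (dominated_slice_fst y k20 df).
have k120 : 0 <= k1 + k2 by rewrite addr_ge0.
have sl2 y := sample_integrable q0 X_mom k12 (dominated_slice_fst y k120 dphif).
rewrite (Rintegral_iterated_swap if2 sl2) (Rintegral_iterated_swap if1 sl1) /=.
rewrite -RintegralZl//; last first.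
  exact: (integrable_iterated_swap if1 sl1).
apply: eq_Rintegral => y _.
apply: (sample_independent k10 k20 k12 hphi) => //.
  apply: depends_off_col => // j.
  exact: (depends_off_affine s (c * SZ y j 0) (depends_off_partial_sum i j)).
exact: (dominated_slice_fst y k20 df).
Qed.

End sums_independence.

(** * Absolute moments without the i-th summand *)

Lemma measurable_sgr (R : realType) : measurable_fun setT (@Num.sg R).
Proof.
have -> : @Num.sg R = fun u => if 0 < u then 1 else if u < 0 then -1 else 0.
  apply/funext => u; have [u0|u0|<-] := ltgtP 0 u.
  - by rewrite gtr0_sg.
  - by rewrite ltr0_sg.
  - by rewrite sgr0.
apply: measurable_fun_ifT => //; first exact: measurable_fun_ltr.
by apply: measurable_fun_ifT => //; exact: measurable_fun_ltr.
Qed.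

Section sums_moments.
Context (R : realType) (dT dT' : measure_display) (T : measurableType dT)
  (T' : measurableType dT') (P : probability T R) (Q : probability T' R)
  (n d : nat) (X : 'I_n -> 'I_d -> {RV P >-> R}) (Z : 'I_d -> {RV Q >-> R})
  (S : 'M[R]_d) (q : R).
Hypotheses (X_indep : mutually_independent P (fun i => random_vector (X i)))
  (X_mean0 : forall i j, \int[P]_x X i j x = 0) (q0 : 0 <= q)
  (X_mom : forall i j, P.-integrable setT (EFin \o (fun x => `|X i j x| `^ (q + 3))))
  (Z_normal : std_normal_vector Z) (S_sym : S^T = S).
Local Notation mu := (P \x Q)%E.
Local Notation V := 'cV[R]_d.
Local Notation SZ := (gaussian_image Z S).
Local Notation NZ := (gaussian_size Z).
Local Notation rn := (@Num.sqrt R n%:R)^-1.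

Local Notation NX := (sample_size X).
Local Notation N := (joint_size X Z).
Hypothesis SS : forall j k, (S *m S) j k =
  \int[P]_x (normalized_sum X j x * normalized_sum X k x).
Local Notation W := (normalized_sum X).
Local Notation mix := (mixture X Z S).

Let NX1 := sample_size_ge1 X.
Let N1 := joint_size_ge1 X Z.

(** W is the partial sum plus an independent centred summand, and |.|^r is convex:
    the expectation of the tangent at the partial sum has no linear term. *)
Lemma partial_sum_jensen i t r : 1 <= r -> r <= q + 3 ->
  \int[P]_x (`|partial_sum X i t x| `^ r) <= \int[P]_x (`|W t x| `^ r).
Proof.
move=> r1 rq; have r0 : 0 <= r by lra.
have rm0 : 0 <= r - 1 by lra.
(* up to the factor r, the slope of |.|^r at u *)
pose G (u : R) := Num.sg u * `|u| `^ (r - 1).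
have mG : measurable_fun setT G.
  apply: measurable_funM; first exact: measurable_sgr.
  apply: (measurableT_comp (measurable_powR (r - 1))).
  exact: (measurableT_comp (normr_measurable (D := setT))).
have dp := dominated_partial_sum X i t.
have dG : dominated NX (r - 1) (G \o partial_sum X i t).
  have [_ [C C0 hC]] := dominated_powR rm0 ler01 dp.
  split; first by apply: (measurableT_comp mG); have [] := dp.
  exists C => // x; rewrite mul1r in hC; apply: le_trans (hC x).
  rewrite /G /= normrM ler_piMl// normr_sg; by case: (_ == _).
have e0 : \int[P]_x (X i t x * (G \o partial_sum X i t) x) = 0.
  rewrite (@sample_independent _ _ _ _ _ _ _ q X_indep q0 X_mom i _ _ 1 (r - 1))//.
  - by rewrite X_mean0 mul0r.
  - lra.
  - exact: depends_on_sample.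
  - by apply: depends_off_comp => //; exact: depends_off_partial_sum.
  - exact: dominated_sample.
have dXG : dominated NX r (fun x => X i t x * (G \o partial_sum X i t) x).
  rewrite -[r](subrKC 1); apply: dominatedM => //; exact: dominated_sample.
have ip : P.-integrable setT (EFin \o (fun x => `|partial_sum X i t x| `^ r)).
  apply: (sample_integrable q0 X_mom rq).
  by have := dominated_powR r0 ler01 dp; rewrite mul1r.
have iW : P.-integrable setT (EFin \o (fun x => `|W t x| `^ r)).
  apply: (sample_integrable q0 X_mom rq).
  by have := dominated_powR r0 ler01 (dominated_normalized_sum X t); rewrite mul1r.
have iXG := sample_integrable q0 X_mom rq dXG.
have iXG' : P.-integrable setT (EFin \o (fun x => r * rn * (X i t x * (G \o partial_sum X i t) x))).
  exact: integrable_scale.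
have e1 : \int[P]_x (`|partial_sum X i t x| `^ r + r * rn * (X i t x * (G \o partial_sum X i t) x))
    = \int[P]_x (`|partial_sum X i t x| `^ r).
  by rewrite RintegralD// RintegralZl// e0 mulr0 addr0.
rewrite -e1; apply: le_Rintegral => //; first exact: integrable_add.
move=> x _; have := powR_norm_tangent (partial_sum X i t x) (W t x) r1.
apply: le_trans; rewrite lerD2l (normalized_sumE X i t x).
by rewrite /G /= le_eqVlt; apply/orP; left; apply/eqP; ring.
Qed.

Lemma partial_sum_sqr_le i t : \int[P]_x (partial_sum X i t x) ^+ 2 <= (S *m S) t t.
Proof.
have E (f : T -> R) : \int[P]_x (f x) ^+ 2 = \int[P]_x (`|f x| `^ 2).
  by apply: eq_Rintegral => x _; rewrite powR_mulrn// real_normK ?num_real.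
rewrite SS; under [X in _ <= X]eq_Rintegral do rewrite -expr2.
by rewrite !E; have := q0 => ?; apply: partial_sum_jensen; lra.
Qed.

Lemma mixture_variance i t s c : s ^+ 2 + c ^+ 2 = 1 ->
  \int[mu]_z (mixture X Z S i s c z t 0) ^+ 2 <= (S *m S) t t.
Proof.
move=> sc; have q0' := q0.
have q2 : 2 <= q + 3 by lra.
have q1 : 1 <= q + 3 by lra.
have dp := dominated_partial_sum X i t.
have dv := dominated_gaussian_image Z S t.
have dp2 : dominated NX 2 (fun x => partial_sum X i t x ^+ 2).
  have -> : 2 = 1 + 1 :> R by lra.
  exact: dominatedM.
have dv2 : dominated NZ 2 (fun y => SZ y t 0 ^+ 2).
  have -> : 2 = 1 + 1 :> R by lra.
  by apply: dominatedM => //; exact: gaussian_size_ge1.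
have ip := sample_integrable q0 X_mom q1 dp.
have ip2 := sample_integrable q0 X_mom q2 dp2.
have iv := gaussian_image_integrable Z_normal ler01 dv.
have iv2 := gaussian_image_integrable Z_normal (ler0n _ 2) dv2.
have i1 := integrable_scale (s ^+ 2) (integrable_fst Q ip2).
have i2 := integrable_scale (2 * s * c) (integrable_prod ip iv).
have i3 := integrable_scale (c ^+ 2) (integrable_snd P iv2).
have -> : \int[mu]_z (mixture X Z S i s c z t 0) ^+ 2 =
   \int[mu]_z (s ^+ 2 * partial_sum X i t z.1 ^+ 2 +
     2 * s * c * (partial_sum X i t z.1 * SZ z.2 t 0) + c ^+ 2 * SZ z.2 t 0 ^+ 2).
  by apply: eq_Rintegral => z _; rewrite mxE; ring.
rewrite RintegralD//; last exact: (integrable_add i1 i2).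
rewrite (RintegralD _ i1 i2)// (RintegralZl _ _ (integrable_fst Q ip2))//.
rewrite (RintegralZl _ _ (integrable_prod ip iv))// (RintegralZl _ _ (integrable_snd P iv2))//.
rewrite (Rintegral_fst Q ip2) (Rintegral_prod ip iv) (Rintegral_snd P iv2).
rewrite gaussian_image_mean// gaussian_image_variance// !mulr0 addr0.
rewrite -[leRHS]mul1r -sc mulrDl lerD2r ler_wpM2l ?sqr_ge0//.
exact: partial_sum_sqr_le.
Qed.

Let dominated_mixture_powR i s c t r : 0 <= r ->
  dominated N r (fun z => `|mix i s c z t 0| `^ r).
Proof.
move=> r0; exact: (dominated_mixture X Z S i s c r0 (continuous_coord_powR (t := t) r0)
  (pgrowth_coord_powR t r0)).
Qed.

(** For r <= 1 the theorem's bound offers no term that controls both the partial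
    sum and the Gaussian part. The mixture has at most the variance of
    V = S Z, so its r-th moment is at most the r-th power of the standard
    deviation of V, which gaussian_image_moment_ge compares with E|V_t|^r. *)
Lemma mixture_low_moment i t s c r : s ^+ 2 + c ^+ 2 = 1 -> 0 <= r -> r <= q -> r <= 1 ->
  \int[mu]_z (`|mix i s c z t 0| `^ r) <= 2 `^ r * \int[Q]_y (`|SZ y t 0| `^ r).
Proof.
move=> sc r0 rq r1; have q0' := q0.
have var := mixture_variance i t sc.
have ge := gaussian_image_moment_ge Z_normal S_sym t r0.
apply: le_trans ge; set sg := Num.sqrt _.
have sg0 : 0 <= sg by exact: sqrtr_ge0.
have sgE : (S *m S) t t = sg ^+ 2.
  by rewrite sqr_sqrtr// (gaussian_image_variance_ge0 Z_normal S_sym).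
have ir : mu.-integrable setT (EFin \o (fun z => `|mix i s c z t 0| `^ r)).
  by apply: (joint_integrable q0 X_mom Z_normal _ (dominated_mixture_powR i s c t r0)); lra.
have i2 : mu.-integrable setT (EFin \o (fun z => (mix i s c z t 0) ^+ 2)).
  have := joint_integrable q0 X_mom Z_normal _ (dominated_mixture_powR i s c t (ler0n R 2)).
  move=> /(_ _)/=; under eq_fun do rewrite powR_mulrn// real_normK ?num_real//.
  by apply; lra.
have ic (a : R) : mu.-integrable setT (EFin \o cst a).
  have icP : P.-integrable setT (EFin \o cst a) by exact: finite_measure_integrable_cst.
  exact: (integrable_fst Q icP).
have bound a : 0 < a -> sg <= a -> \int[mu]_z (`|mix i s c z t 0| `^ r) <= a `^ r.
  move=> a0 sga.
  pose k := r / 2 / a ^+ 2.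
  have k0 : 0 <= k by rewrite !divr_ge0// sqr_ge0.
  apply: (@le_trans _ _ (\int[mu]_z (a `^ r * (1 - r / 2) + a `^ r * k * (mix i s c z t 0) ^+ 2))).
    apply: le_Rintegral => //.
      by apply: integrable_add; [exact: ic|exact: integrable_scale].
    move=> z _; have := powR_le_quadratic (normr_ge0 (mix i s c z t 0)) a0 (_ : 0 <= r <= 2).
    rewrite real_normK ?num_real//; move=> /(_ _)h.
    apply: (le_trans (h _)); first by lra.
    by rewrite /k le_eqVlt; apply/orP; left; apply/eqP; field; rewrite gt_eqF.
  rewrite RintegralD//; [|exact: ic|exact: integrable_scale].
  rewrite Rintegral_probability_cst RintegralZl//.
  have v2 : \int[mu]_z (mix i s c z t 0) ^+ 2 <= a ^+ 2.
    by apply: (le_trans var); rewrite sgE lerXn2r// nnegrE ltW.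
  apply: (@le_trans _ _ (a `^ r * (1 - r / 2) + a `^ r * k * a ^+ 2)).
    by rewrite lerD2l ler_wpM2l// mulr_ge0// powR_ge0.
  by rewrite /k le_eqVlt; apply/orP; left; apply/eqP; field; rewrite gt_eqF.
have [sgz|sgn0] := eqVneq sg 0; last first.
  by apply: bound => //; rewrite lt_neqAle eq_sym sgn0.
rewrite sgz; have [rz|rn0] := eqVneq r 0.
  rewrite rz powRr0; under eq_Rintegral do rewrite powRr0.
  by rewrite Rintegral_probability_cst.
(* a vanishing variance: the bound by a ^ r holds for every a > 0, here with
   a = e ^ (1 / r) *)
rewrite powR0//; apply/ler_addgt0Pr => e e0; rewrite add0r.
rewrite -[leRHS](powRr1 (ltW e0)) -(mulVf rn0) powRrM.
by apply: bound; rewrite ?powR_gt0// sgz powR_ge0.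
Qed.

(** The supremum of |v_t|^r over the segment between the t-th coordinates with and
    without the i-th summand, integrated against a weight phi of the i-th vector.
    For r >= 1 two applications of (x + y)^r <= 2^r (x^r + y^r) separate the partial
    sum, the summand and the Gaussian part, and partial_sum_jensen replaces the
    partial sum by W. For r < 1 that route is blocked, since Jensen's inequality is
    reversed; there the power is subadditive, and the mixture is kept whole and
    handled by mixture_low_moment. *)
Lemma box_moment_bound i t s c r : 0 <= s -> 0 <= c -> s ^+ 2 + c ^+ 2 = 1 ->
  0 <= r -> r <= q ->
  exists D : T * T' -> R, [/\ dominated N r D, forall z, 0 <= D z,
    forall z (v : V), `|v t 0 - mix i s c z t 0| <= `|s * (rn * X i t z.1)| ->
      `|v t 0| `^ r <= D z &
    forall phi k, 0 <= k -> k <= 3 -> depends_on X i phi -> dominated NX k phi ->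
      (forall x, 0 <= phi x) ->
      \int[mu]_z (phi z.1 * D z) <=
      2 `^ r * (2 `^ r * \int[P]_x phi x * \int[P]_x (`|W t x| `^ r)
        + 2 `^ r * rn `^ r * \int[P]_x (phi x * `|X i t x| `^ r)
        + \int[Q]_y (`|SZ y t 0| `^ r) * \int[P]_x phi x)].
Proof.
move=> s0 c0 sc r0 rq; have q0' := q0.
have s1 : s <= 1 by nra.
have c1 : c <= 1 by nra.
have rn0 : 0 <= rn by rewrite invr_ge0 sqrtr_ge0.
have rp1 : 1 <= 2 `^ r :> R.
  by have := ler_powR (ler1n R 2) r0; rewrite powRr0.
have rq3 : r <= q + 3 by lra.
have iXr : dominated NX r (fun x => `|X i t x| `^ r).
  by have := dominated_powR r0 ler01 (dominated_sample X i t); rewrite mul1r.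
have dpr : dominated NX r (fun x => `|partial_sum X i t x| `^ r).
  by have := dominated_powR r0 ler01 (dominated_partial_sum X i t); rewrite mul1r.
have dWr : dominated NX r (fun x => `|W t x| `^ r).
  by have := dominated_powR r0 ler01 (dominated_normalized_sum X t); rewrite mul1r.
have iVr := gaussian_image_powR_integrable S Z_normal t r0.
have dVr : dominated NZ r (fun y => `|SZ y t 0| `^ r).
  have := dominated_gaussian_image_affine Z S 0 1 r0 (continuous_coord_powR (t := t) r0)
  (pgrowth_coord_powR t r0).
  by under eq_fun do rewrite add0r scale1r.
have EW0 : 0 <= \int[P]_x (`|W t x| `^ r) by apply: Rintegral_ge0 => x _; exact: powR_ge0.
have EV0 : 0 <= \int[Q]_y (`|SZ y t 0| `^ r) by apply: Rintegral_ge0 => y _; exact: powR_ge0.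
have rnX x : `|rn * X i t x| `^ r = rn `^ r * `|X i t x| `^ r.
  by rewrite normrM (ger0_norm rn0) powRM.
have [r1|r1] := leP 1 r.
- exists (fun z => 2 `^ r * (2 `^ r * (`|partial_sum X i t z.1| `^ r + rn `^ r * `|X i t z.1| `^ r)
      + `|SZ z.2 t 0| `^ r)).
  split.
  + apply: dominatedZ => //; apply: dominatedD => //.
      apply: dominatedZ => //; apply: dominatedD => //.
        exact: (dominated_fst Z r0 dpr).
      by apply: dominatedZ => //; exact: (dominated_fst Z r0 iXr).
    exact: (dominated_snd X r0 dVr).
  + by move=> z; rewrite !(mulr_ge0, addr_ge0) ?powR_ge0.
  + move=> z v hv.
    have : `|v t 0| <= (`|partial_sum X i t z.1| + `|rn * X i t z.1|) + `|SZ z.2 t 0|.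
      have := ler_normD (v t 0 - mix i s c z t 0) (mix i s c z t 0); rewrite subrK => h.
      apply: (le_trans h); rewrite [mix _ _ _ _ _ _]mxE in hv *.
      have h1 : `|s * (rn * X i t z.1)| <= `|rn * X i t z.1|.
        by rewrite normrM ger0_norm// ler_piMl.
      have h2 := ler_normD (s * partial_sum X i t z.1) (c * SZ z.2 t 0).
      have h3 : `|s * partial_sum X i t z.1| <= `|partial_sum X i t z.1|.
        by rewrite normrM ger0_norm// ler_piMl.
      have h4 : `|c * SZ z.2 t 0| <= `|SZ z.2 t 0|.
        by rewrite normrM ger0_norm// ler_piMl.
      have := lerD (le_trans hv h1) (le_trans h2 (lerD h3 h4)) => h5.
      by apply: (le_trans h5); rewrite addrCA addrA.
    move=> hv2.
    apply: (@le_trans _ _ (((`|partial_sum X i t z.1| + `|rn * X i t z.1|) + `|SZ z.2 t 0|) `^ r)).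
      by rewrite ge0_ler_powR// nnegrE ?addr_ge0.
    apply: (le_trans (powR_add_le _ _ r0)); rewrite ?addr_ge0//.
    rewrite ler_wpM2l ?powR_ge0// lerD2r -rnX.
    exact: powR_add_le.
  + move=> phi k k0 k3 hphi dphi phi0.
    have k1 : k + r <= q + 3 by lra.
    have kq : k <= q + 3 by lra.
    have iphi := sample_integrable q0 X_mom kq dphi.
    have Ephi : 0 <= \int[P]_x phi x by apply: Rintegral_ge0.
    have i1 := sample_integrable q0 X_mom k1 (dominatedM NX1 dphi dpr).
    have i2 := sample_integrable q0 X_mom k1 (dominatedM NX1 dphi iXr).
    have j1 := integrable_fst Q i1; have j2 := integrable_fst Q i2.
    have j3 := integrable_prod iphi iVr.
    have E : \int[mu]_z (phi z.1 * (2 `^ r * (2 `^ r * (`|partial_sum X i t z.1| `^ r +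
        rn `^ r * `|X i t z.1| `^ r) + `|SZ z.2 t 0| `^ r))) =
      2 `^ r * (2 `^ r * \int[P]_x (phi x * `|partial_sum X i t x| `^ r)
        + 2 `^ r * rn `^ r * \int[P]_x (phi x * `|X i t x| `^ r)
        + \int[Q]_y (`|SZ y t 0| `^ r) * \int[P]_x phi x).
      have l1 := integrable_scale (2 `^ r) j1.
      have l2 := integrable_scale (2 `^ r * rn `^ r) j2.
      transitivity (\int[mu]_z (2 `^ r * (2 `^ r * (phi z.1 * `|partial_sum X i t z.1| `^ r)
         + 2 `^ r * rn `^ r * (phi z.1 * `|X i t z.1| `^ r) + phi z.1 * `|SZ z.2 t 0| `^ r))).
        by apply: eq_Rintegral => z _; ring.
      rewrite RintegralZl//; last exact: (integrable_add (integrable_add l1 l2) j3).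
      rewrite RintegralD//; last exact: (integrable_add l1 l2).
      rewrite (RintegralD _ l1 l2)// (RintegralZl _ _ j1)// (RintegralZl _ _ j2)//.
      rewrite (Rintegral_fst Q i1) (Rintegral_fst Q i2) (Rintegral_prod iphi iVr).
      by congr (_ * (_ + _)); rewrite mulrC.
    rewrite E ler_wpM2l ?powR_ge0// lerD2r lerD2r -mulrA ler_wpM2l ?powR_ge0//.
    rewrite (sample_independent X_indep q0 X_mom k0 r0 k1 hphi _ dphi dpr); last first.
      apply: (@depends_off_comp _ _ _ _ _ _ _ i (fun y : R => `|y| `^ r)).
        apply: (measurableT_comp (measurable_powR r)).
        exact: normr_measurable.
      exact: depends_off_partial_sum.
    by rewrite ler_wpM2l//; exact: partial_sum_jensen.
- have r1' := ltW r1.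
  exists (fun z => `|mix i s c z t 0| `^ r + rn `^ r * `|X i t z.1| `^ r).
  have dmix := dominated_mixture_powR i s c t r0.
  split.
  + apply: dominatedD => //; apply: dominatedZ => //; exact: (dominated_fst Z r0 iXr).
  + by move=> z; rewrite !(mulr_ge0, addr_ge0) ?powR_ge0.
  + move=> z v hv.
    have := ler_normD (v t 0 - mix i s c z t 0) (mix i s c z t 0); rewrite subrK => h.
    apply: (@le_trans _ _ ((`|mix i s c z t 0| + `|rn * X i t z.1|) `^ r)).
      rewrite ge0_ler_powR// ?nnegrE ?addr_ge0// (le_trans h)// addrC lerD2l.
      by rewrite (le_trans hv)// normrM ger0_norm// ler_piMl.
    rewrite -rnX; apply: powR_subadditive => //; by rewrite r0.
  + move=> phi k k0 k3 hphi dphi phi0.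
    have k1 : k + r <= q + 3 by lra.
    have kq : k <= q + 3 by lra.
    have iphi := sample_integrable q0 X_mom kq dphi.
    have Ephi : 0 <= \int[P]_x phi x by apply: Rintegral_ge0.
    have i2 := sample_integrable q0 X_mom k1 (dominatedM NX1 dphi iXr).
    have j2 := integrable_fst Q i2.
    have j1 := joint_integrable q0 X_mom Z_normal k1
      (dominatedM N1 (dominated_fst Z k0 dphi) dmix).
    have l2 := integrable_scale (rn `^ r) j2.
    have EX : 0 <= \int[P]_x (phi x * `|X i t x| `^ r).
      by apply: Rintegral_ge0 => x _; rewrite mulr_ge0 ?powR_ge0.
    have -> : \int[mu]_z (phi z.1 * (`|mix i s c z t 0| `^ r + rn `^ r * `|X i t z.1| `^ r)) =
      \int[mu]_z (phi z.1 * `|mix i s c z t 0| `^ r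
       + rn `^ r * (phi z.1 * `|X i t z.1| `^ r)).
      by apply: eq_Rintegral => z _; ring.
    rewrite RintegralD// (RintegralZl _ _ j2)// (Rintegral_fst Q i2).
    have := mixture_independent S X_indep q0 X_mom Z_normal s c k0 r0 k1 hphi dphi
      (continuous_coord_powR (t := t) r0) (pgrowth_coord_powR t r0).
    move=> ->.
    have low := mixture_low_moment i t sc r0 rq r1'.
    have h1 : \int[P]_x phi x * \int[mu]_z (`|mix i s c z t 0| `^ r) <=
        2 `^ r * (\int[Q]_y (`|SZ y t 0| `^ r) * \int[P]_x phi x).
      by rewrite [_ * \int[P]_x phi x]mulrC mulrCA ler_wpM2l.
    have h2 : rn `^ r * \int[P]_x (phi x * `|X i t x| `^ r) <=
        2 `^ r * (2 `^ r * rn `^ r * \int[P]_x (phi x * `|X i t x| `^ r)).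
      rewrite !mulrA -[leLHS]mul1r !mulrA ler_wpM2r// ler_wpM2r ?powR_ge0//.
      by rewrite -[leLHS]mulr1 ler_pM.
    have h3 : 0 <= 2 `^ r * (2 `^ r * \int[P]_x phi x * \int[P]_x (`|W t x| `^ r)).
      by rewrite !mulr_ge0 ?powR_ge0.
    by rewrite !mulrDr; lra.
Qed.

End sums_moments.

(** * The moment brackets of the bound *)

Section moment_brackets.
Context (R : realType) (dT dT' : measure_display) (T : measurableType dT)
  (T' : measurableType dT') (P : probability T R) (Q : probability T' R)
  (n d : nat) (X : 'I_n -> 'I_d -> {RV P >-> R}) (Z : 'I_d -> {RV Q >-> R})
  (S : 'M[R]_d) (A : R) (B r : 'I_d -> R).
Local Notation rn := (@Num.sqrt R n%:R)^-1.

(** The two bracketed sums of moments in the theorem have this form, with the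
    weight phi equal to |X_ij X_ik X_il|, resp. |X_il|. It bounds the expectation of
    phi times the supremum of the growth function over the box that separates the
    mixture from the interpolation. *)
Definition third_moment_bracket (i : 'I_n) (phi : T -> R) : R :=
  A * \int[P]_x phi x + \sum_t (2 `^ r t * B t) *
    (2 `^ r t * \int[P]_x phi x * \int[P]_x (`|normalized_sum X t x| `^ r t)
     + 2 `^ r t * rn `^ r t * \int[P]_x (phi x * `|X i t x| `^ r t)
     + \int[Q]_y (`|gaussian_image Z S y t 0| `^ r t) * \int[P]_x phi x).

End moment_brackets.

(** * Summation along a quarter of the unit circle *)

Section partition_of_the_arc.
Context (R : realType).
Implicit Types (t K C : R).

Let cs t : R := (1 - t ^+ 2) / (1 + t ^+ 2).
Let sn t : R := 2 * t / (1 + t ^+ 2).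

Let den t : 0 < 1 + t ^+ 2.
Proof. by rewrite ltr_pwDl// sqr_ge0. Qed.

Let circle t : sn t ^+ 2 + cs t ^+ 2 = 1.
Proof. by rewrite /sn /cs; field; rewrite gt_eqF. Qed.

Let sn_ge0 t : 0 <= t -> 0 <= sn t.
Proof. by move=> t0; rewrite /sn divr_ge0// ?(ltW (den t)) ?mulr_ge0. Qed.

Let cs_ge0 t : 0 <= t -> t <= 1 -> 0 <= cs t.
Proof.
by move=> t0 t1; rewrite /cs divr_ge0// ?(ltW (den t))// subr_ge0 expr_le1.
Qed.

Let sn_le t u : 0 <= t -> t <= u -> u <= 1 -> sn t <= sn u.
Proof.
move=> t0 tu u1; rewrite /sn ler_pdivrMr// mulrAC ler_pdivlMr//.
have h : 0 <= (u - t) * (1 - t * u) by apply: mulr_ge0; nra.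
by nra.
Qed.

Let chord t u : 0 <= t -> 0 <= u ->
  (sn u - sn t) ^+ 2 + (cs u - cs t) ^+ 2 <= 4 * (u - t) ^+ 2.
Proof.
move=> t0 u0.
have dt := den t; have du := den u.
have -> : (sn u - sn t) ^+ 2 + (cs u - cs t) ^+ 2 =
    4 * (u - t) ^+ 2 / ((1 + t ^+ 2) * (1 + u ^+ 2)).
  by rewrite /sn /cs; field; rewrite !gt_eqF.
have p : 0 <= 4 * (u - t) ^+ 2 by rewrite mulr_ge0// sqr_ge0.
rewrite ler_pdivrMr ?mulr_gt0// ler_peMr//.
move: (sqr_ge0 t) (sqr_ge0 u); move: (t ^+ 2) (u ^+ 2) => a b; nra.
Qed.

(** The rational parametrization of the quarter circle is used with m equal steps.
    The cubes telescope to K / 3, and m chords whose squared lengths are at most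
    4 / m^2 contribute at most 4 C / m. Letting m tend to infinity replaces the
    integration of a derivative along the path. *)
Lemma arc_partition (F : R -> R -> R) K C : 0 <= C ->
  (forall s c s' c', 0 <= s -> 0 <= c -> 0 <= s' -> 0 <= c' ->
    s ^+ 2 + c ^+ 2 = 1 -> s' ^+ 2 + c' ^+ 2 = 1 -> s <= s' ->
    `|F s' c' - F s c| <=
      K * ((s' ^+ 3 - s ^+ 3) / 3) + C * ((s' - s) ^+ 2 + (c' - c) ^+ 2)) ->
  `|F 1 0 - F 0 1| <= K / 3.
Proof.
move=> C0 hF.
have bound m : (0 < m)%N -> `|F 1 0 - F 0 1| <= K / 3 + 4 * C / m%:R.
  move=> m0; have m0' : 0 < m%:R :> R by rewrite ltr0n.
  pose tau (i : nat) : R := i%:R / m%:R.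
  pose G i := F (sn (tau i)) (cs (tau i)).
  have tau_ge0 i : 0 <= tau i by rewrite divr_ge0.
  have tau_le1 i : (i <= m)%N -> tau i <= 1 by move=> im; rewrite ler_pdivrMr// mul1r ler_nat.
  have -> : F 1 0 - F 0 1 = \sum_(0 <= i < m) (G i.+1 - G i).
    rewrite telescope_sumr// /G /tau divff ?gt_eqF// mul0r /sn /cs.
    by rewrite !expr1n expr0n/= mulr1 mulr0 mul0r addr0 subr0 subrr mul0r !divr1 divff.
  apply: (le_trans (ler_norm_sum _ _ _)).
  apply: (@le_trans _ _ (\sum_(0 <= i < m) (K / 3 * (sn (tau i.+1) ^+ 3 - sn (tau i) ^+ 3)
      + 4 * C / m%:R ^+ 2))).
    rewrite big_nat_cond [leRHS]big_nat_cond; apply: ler_sum => i /[!andbT] /andP[_ im].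
    have tt : tau i <= tau i.+1 by rewrite ler_pM2r ?invr_gt0// ler_nat.
    have t1 := tau_le1 _ im; have t1' := tau_le1 _ (ltnW im).
    have := hF _ _ _ _ (sn_ge0 (tau_ge0 i)) (cs_ge0 (tau_ge0 i) t1')
      (sn_ge0 (tau_ge0 i.+1)) (cs_ge0 (tau_ge0 i.+1) t1) (circle _) (circle _)
      (sn_le (tau_ge0 i) tt t1).
    move/le_trans; apply; apply: lerD.
      by rewrite le_eqVlt; apply/orP; left; apply/eqP; field.
    have -> : 4 * C / m%:R ^+ 2 = C * (4 * (tau i.+1 - tau i) ^+ 2).
      by rewrite /tau -natr1; field; rewrite gt_eqF.
    by rewrite ler_wpM2l// chord.
  rewrite big_split/= -mulr_sumr telescope_sumr// sumr_const_nat subn0.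
  rewrite /tau divff ?gt_eqF// mul0r /sn expr1n mulr1 mulr0 mul0r divff//.
  rewrite expr1n expr0n/= subr0 mulr1 lerD2l -mulr_natr le_eqVlt; apply/orP; left; apply/eqP.
  by field; rewrite gt_eqF.
apply/ler_addgt0Pr => e e0.
have [m hm] : exists m, 4 * C / e < m.+1%:R.
  by exists (Num.trunc (4 * C / e)); exact: truncnS_gt.
apply: (le_trans (bound m.+1 isT)); rewrite lerD2l ler_pdivrMr ?ltr0n//.
by move: hm; rewrite ltr_pdivrMr// [_ * e]mulrC => /ltW.
Qed.

End partition_of_the_arc.

(** Integrating from the origin raises the order of growth by one. *)
Lemma pgrowth_primitive (R : realType) (d : nat) (f : 'cV[R]_d -> R) (D : 'I_d -> 'cV[R]_d -> R) q :
  0 <= q -> (forall i w, is_derive w (e_ R i) f (D i w)) ->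
  (forall i, pgrowth q (D i)) -> pgrowth (q + 1) f.
Proof.
move=> q0 hD /pgrowth_unif[C C0 hC].
exists (`|f 0| + C); first by rewrite addr_ge0.
move=> w; have w1 := one_norm1_ge1 w.
have w0 : 0 < 1 + norm1 w by apply: lt_le_trans w1.
have L : `|f (0 + w) - f 0| <= C * (1 + norm1 w) `^ q * norm1 w.
  apply: box_Lipschitz hD _ => v i hv.
  have := growth_box q0 C0 (hC i) hv.
  have -> : norm1 (0 : 'cV[R]_d) = 0 by rewrite /norm1 big1// => j _; rewrite mxE normr0.
  by rewrite addr0.
rewrite add0r in L.
have -> : f w = f 0 + (f w - f 0) by rewrite addrC subrK.
apply: (le_trans (ler_normD _ _)); rewrite mulrDl; apply: lerD.
  by rewrite ler_peMr// -{1}(powRr0 (1 + norm1 w)) ler_powR// addr_ge0.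
apply: (le_trans L); rewrite -mulrA ler_wpM2l// powRD ?gt_eqF ?implybT//.
by rewrite powRr1 ?(ltW w0)// ler_wpM2l ?powR_ge0// lerDr.
by rewrite ltr_wpDl.
Qed.

(** * Comparison along the interpolation path *)

Section interpolation_path.
Context (R : realType) (dT dT' : measure_display) (T : measurableType dT)
  (T' : measurableType dT') (P : probability T R) (Q : probability T' R)
  (n d : nat) (X : 'I_n -> 'I_d -> {RV P >-> R}) (Z : 'I_d -> {RV Q >-> R})
  (S : 'M[R]_d) (q : R).
Hypotheses (X_indep : mutually_independent P (fun i => random_vector (X i)))
  (X_mean0 : forall i j, \int[P]_x X i j x = 0) (q0 : 0 <= q)
  (X_mom : forall i j, P.-integrable setT (EFin \o (fun x => `|X i j x| `^ (q + 3))))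
  (Z_normal : std_normal_vector Z) (S_sym : S^T = S).
Local Notation mu := (P \x Q)%E.
Local Notation V := 'cV[R]_d.
Local Notation SZ := (gaussian_image Z S).
Local Notation rn := (@Num.sqrt R n%:R)^-1.

Local Notation NX := (sample_size X).
Local Notation N := (joint_size X Z).
Hypothesis SS : forall j k, (S *m S) j k =
  \int[P]_x (normalized_sum X j x * normalized_sum X k x).
Local Notation W := (normalized_sum X).
Local Notation mix := (mixture X Z S).
Context (f : V -> R) (D1 : 'I_d -> V -> R) (D2 : 'I_d -> 'I_d -> V -> R)
  (D3 : 'I_d -> 'I_d -> 'I_d -> V -> R) (H A : R) (B r : 'I_d -> R).
Hypotheses (fD : third_order_partials f D1 D2 D3) (H0 : 0 <= H) (A0 : 0 <= A)
  (B0 : forall t, 0 <= B t) (r0 : forall t, 0 <= r t) (rq : forall t, r t <= q)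
  (D3_bound : forall i j k w, `|D3 i j k w| <= H * growth A B r w)
  (D1_growth : forall i, pgrowth q (D1 i)) (D2_growth : forall i j, pgrowth q (D2 i j)).
Local Notation U := (interpolation X Z S).
Local Notation E3 := (third_moment_bracket X Z S A B r).

Let NX1 := sample_size_ge1 X.
Let N1 := joint_size_ge1 X Z.
Let q0' : 0 <= q := q0.

Let shift i s (z : T * T') : V := \col_j (s * (rn * X i j z.1)).

Let interpolationE i s c z : U s c z = mix i s c z + shift i s z.
Proof.
apply/matrixP => j k; rewrite !mxE (normalized_sumE X i); ring.
Qed.

Let D3_growth i j k : pgrowth q (D3 i j k).
Proof.
exact: (pgrowth_le H0 (D3_bound i j k) (pgrowth_growth A0 B0 q0 r0 rq)).
Qed.

Let D1_cont i : continuous (D1 i).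
Proof. by case: fD => _ h2 _; apply: (pgrowth_continuous q0 (h2 i)). Qed.

Let D2_cont i j : continuous (D2 i j).
Proof. by case: fD => _ _ h3; apply: (pgrowth_continuous q0 (h3 i j)). Qed.

(** The growth function is a sum over coordinates, so box_moment_bound applies to
    each of them. *)
Lemma growth_box_bound i s c : 0 <= s -> 0 <= c -> s ^+ 2 + c ^+ 2 = 1 ->
  exists D : T * T' -> R, [/\ dominated N q D, forall z, 0 <= D z,
    forall z v, box (mix i s c z) (shift i s z) v -> growth A B r v <= D z &
    forall phi k, 0 <= k -> k <= 3 -> depends_on X i phi -> dominated NX k phi ->
      (forall x, 0 <= phi x) -> \int[mu]_z (phi z.1 * D z) <= E3 i phi].
Proof.
move=> s0 c0 sc.
have /choice[D hD] := fun t => box_moment_bound X_indep X_mean0 q0 X_mom Z_normal S_sym SS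
  i t s0 c0 sc (r0 t) (rq t).
exists (fun z => A + \sum_t B t * D t z); split.
- apply: dominatedD => //.
    by apply: (dominated_le N1 q0); exact: dominated_cst.
  apply: dominated_sum => // t; apply: dominatedZ => //.
  by have [h _ _ _] := hD t; exact: (dominated_le N1 (rq t) h).
- move=> z; rewrite addr_ge0// sumr_ge0// => t _; rewrite mulr_ge0//.
  by have [_ h _ _] := hD t.
- move=> z v hv; rewrite /growth lerD2l; apply: ler_sum => t _.
  rewrite ler_wpM2l//; have [_ _ h _] := hD t; apply: h.
  by have := hv t; rewrite [shift _ _ _ _ _]mxE.
- move=> phi k k0 k3 hphi dphi phi0.
  have kq : k + q <= q + 3 by lra.
  have kq' : k <= q + 3 by have := q0; lra.
  have iphi := sample_integrable q0 X_mom kq' dphi.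
  have jphi := integrable_fst Q iphi.
  have it t : mu.-integrable setT (EFin \o (fun z => B t * (phi z.1 * D t z))).
    have [h _ _ _] := hD t.
    apply: integrable_scale.
    apply: (joint_integrable q0 X_mom Z_normal kq).
    by apply: dominatedM => //; [exact: (dominated_fst Z k0 dphi)|exact: (dominated_le N1 (rq t) h)].
  have -> : \int[mu]_z (phi z.1 * (A + \sum_t B t * D t z)) =
      \int[mu]_z (A * phi z.1 + \sum_t B t * (phi z.1 * D t z)).
    apply: eq_Rintegral => z _; rewrite mulrDr mulrC; congr (_ + _).
    by rewrite mulr_sumr; apply: eq_bigr => t _; rewrite mulrCA.
  rewrite RintegralD//; [|exact: integrable_scale|exact: integrable_fsum].
  rewrite (RintegralZl _ _ jphi)// (Rintegral_fst Q iphi) Rintegral_fsum// /E3.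
  rewrite lerD2l; apply: ler_sum => t _.
  have [h _ _ bnd] := hD t.
  rewrite RintegralZl//; last first.
    apply: (joint_integrable q0 X_mom Z_normal kq).
    by apply: dominatedM => //; [exact: (dominated_fst Z k0 dphi)|exact: (dominated_le N1 (rq t) h)].
  by rewrite [2 `^ r t * B t]mulrC -[leRHS]mulrA ler_wpM2l//; exact: bnd hphi dphi phi0.
Qed.

Let dom_interp s c (g : V -> R) : continuous g -> pgrowth q g ->
  dominated N q (fun z => g (U s c z)).
Proof. exact: dominated_interpolation. Qed.

Let dom_mix i s c (g : V -> R) : continuous g -> pgrowth q g ->
  dominated N q (fun z => g (mix i s c z)).
Proof. exact: dominated_mixture. Qed.

Let dom_X i j : dominated N 1 (fun z => X i j z.1).
Proof. exact: (dominated_fst Z ler01 (dominated_sample X i j)). Qed.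

Let dom_XX i j k : dominated NX 2 (fun x => X i j x * X i k x).
Proof.
have -> : 2 = 1 + 1 :> R by lra.
by apply: dominatedM => //; exact: dominated_sample.
Qed.

Let dom_XXX i j k l : dominated NX 3 (fun x => `|X i j x * X i k x * X i l x|).
Proof.
apply: dominated_abs; have -> : 3 = 2 + 1 :> R by lra.
by apply: dominatedM => //; exact: dominated_sample.
Qed.

(** Taylor expansion of the partial derivative at the mixture, which is independent
    of the i-th vector. The constant term vanishes because X_ij has mean 0, the
    linear term factorizes, and the remainder is bounded by third derivatives on
    the box. *)
Lemma first_partial_estimate i j s c : 0 <= s -> 0 <= c -> s ^+ 2 + c ^+ 2 = 1 ->
  `|\int[mu]_z (X i j z.1 * D1 j (U s c z)) -
    s * rn * \sum_k \int[P]_x (X i j x * X i k x) * \int[mu]_z D2 j k (mix i s c z)| <=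
  (s * rn) ^+ 2 * H / 2 * \sum_k \sum_l E3 i (fun x => `|X i j x * X i k x * X i l x|).
Proof.
move=> s0 c0 sc; have [_ h2 h3] := fD.
have [D [dD D0 boxD momD]] := growth_box_bound i s0 c0 sc.
pose a := s * rn.
have q3 : 3 + q <= q + 3 by lra.
have dXD k l : dominated N (3 + q) (fun z => `|X i j z.1 * X i k z.1 * X i l z.1| * D z).
  by apply: dominatedM => //; exact: (dominated_fst Z (ler0n R 3) (dom_XXX i j k l)).
have iXD k l := joint_integrable q0 X_mom Z_normal q3 (dXD k l).
have iXXXD : mu.-integrable setT (EFin \o (fun z => a ^+ 2 * H / 2 *
    \sum_k \sum_l `|X i j z.1 * X i k z.1 * X i l z.1| * D z)).
  by apply: integrable_scale; apply: integrable_fsum => k; apply: integrable_fsum => l.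
have q1 : 1 + q <= q + 3 by lra.
have q2 : 2 + q <= q + 3 by lra.
have i1 : mu.-integrable setT (EFin \o (fun z => X i j z.1 * D1 j (U s c z))).
  by apply: (joint_integrable q0 X_mom Z_normal q1); apply: dominatedM => //; exact: dom_interp.
have i2 : mu.-integrable setT (EFin \o (fun z => X i j z.1 * D1 j (mix i s c z))).
  by apply: (joint_integrable q0 X_mom Z_normal q1); apply: dominatedM => //; exact: dom_mix.
have i3 k : mu.-integrable setT (EFin \o (fun z => X i j z.1 * X i k z.1 * D2 j k (mix i s c z))).
  apply: (joint_integrable q0 X_mom Z_normal q2); apply: dominatedM => //; last exact: dom_mix.
  exact: (dominated_fst Z (ler0n R 2) (dom_XX i j k)).
have e2 : \int[mu]_z (X i j z.1 * D1 j (mix i s c z)) = 0.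
  rewrite (mixture_independent S X_indep q0 X_mom Z_normal s c ler01 q0 q1
    (depends_on_sample X i j) (dominated_sample X i j) (@D1_cont j) (D1_growth j)).
  by rewrite X_mean0 mul0r.
have e3 k : \int[mu]_z (X i j z.1 * X i k z.1 * D2 j k (mix i s c z)) =
    \int[P]_x (X i j x * X i k x) * \int[mu]_z D2 j k (mix i s c z).
  exact: (mixture_independent S X_indep q0 X_mom Z_normal s c (ler0n R 2) q0 q2
    (depends_onM (depends_on_sample X i j) (depends_on_sample X i k)) (dom_XX i j k)
    (@D2_cont j k) (D2_growth j k)).
have i3s : mu.-integrable setT (EFin \o (fun z => a * \sum_k X i j z.1 * X i k z.1 * D2 j k (mix i s c z))).
  by apply: integrable_scale; apply: integrable_fsum.
have -> : \int[mu]_z (X i j z.1 * D1 j (U s c z)) -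
    s * rn * \sum_k \int[P]_x (X i j x * X i k x) * \int[mu]_z D2 j k (mix i s c z) =
    \int[mu]_z (X i j z.1 * D1 j (U s c z) - X i j z.1 * D1 j (mix i s c z) -
      a * \sum_k X i j z.1 * X i k z.1 * D2 j k (mix i s c z)).
  rewrite RintegralB//; last exact: integrable_sub.
  rewrite RintegralB// e2 subr0 RintegralZl//; last exact: integrable_fsum.
  by rewrite Rintegral_fsum//; under [X in _ = _ - _ * X]eq_bigr do rewrite e3.
apply: (@le_trans _ _ (\int[mu]_z (a ^+ 2 * H / 2 *
    \sum_k \sum_l `|X i j z.1 * X i k z.1 * X i l z.1| * D z))); last first.
  rewrite RintegralZl//; last by apply: integrable_fsum => k; apply: integrable_fsum => l.
  rewrite ler_wpM2l ?mulr_ge0 ?sqr_ge0//.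
  rewrite Rintegral_fsum; last by move=> k; apply: integrable_fsum.
  apply: ler_sum => k _; rewrite Rintegral_fsum//; apply: ler_sum => l _.
  apply: (momD _ 3) => //.
  by apply: depends_on_abs; apply: depends_onM; [apply: depends_onM|]; exact: depends_on_sample.
apply: (le_trans (le_normr_Rintegral _ _)) => //; first by apply: integrable_sub => //; exact: integrable_sub.
apply: le_Rintegral => //.
  have := integrable_sub (integrable_sub i1 i2) i3s; move/integrable_abse.
  exact: eq_integrable.
move=> z _.
have T1 : `|D1 j (U s c z) - D1 j (mix i s c z) - \sum_k shift i s z k 0 * D2 j k (mix i s c z)|
    <= H * D z / 2 * norm1 (shift i s z) ^+ 2.
  rewrite (interpolationE i); apply: (@box_Taylor _ _ (D1 j) (D2 j) (D3 j)) => //.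
    by rewrite mulr_ge0.
  by move=> v k l hv; rewrite (le_trans (D3_bound _ _ _ _))// ler_wpM2l//; exact: boxD.
have -> : X i j z.1 * D1 j (U s c z) - X i j z.1 * D1 j (mix i s c z) -
    a * (\sum_k X i j z.1 * X i k z.1 * D2 j k (mix i s c z)) =
    X i j z.1 * (D1 j (U s c z) - D1 j (mix i s c z) - \sum_k shift i s z k 0 * D2 j k (mix i s c z)).
  rewrite !mulrBr; congr (_ - _); rewrite !mulr_sumr; apply: eq_bigr => k _.
  by rewrite mxE /a; ring.
rewrite normrM (le_trans (ler_wpM2l _ T1))//.
have a0 : 0 <= a by rewrite mulr_ge0// invr_ge0 sqrtr_ge0.
have ns : norm1 (shift i s z) = a * \sum_k `|X i k z.1|.
  rewrite /norm1 mulr_sumr; apply: eq_bigr => k _.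
  by rewrite mxE mulrA normrM (ger0_norm a0).
have e : `|X i j z.1| * (\sum_k `|X i k z.1|) ^+ 2 =
    \sum_k \sum_l `|X i j z.1 * X i k z.1 * X i l z.1|.
  rewrite expr2 mulrA mulr_sumr; apply: eq_bigr => k _.
  by rewrite mulr_sumr mulr_suml; apply: eq_bigr => l _; rewrite !normrM mulrAC.
rewrite ns le_eqVlt; apply/orP; left; apply/eqP.
have -> : \sum_k \sum_l `|X i j z.1 * X i k z.1 * X i l z.1| * D z =
    (`|X i j z.1| * (\sum_k `|X i k z.1|) ^+ 2) * D z.
  by rewrite e mulr_suml; apply: eq_bigr => k _; rewrite mulr_suml.
by field.
Qed.

(** This restores the interpolation in place of the mixture in the second-order
    term of first_partial_estimate, at the cost of a third derivative. *)
Lemma second_partial_estimate i j k s c : 0 <= s -> 0 <= c -> s ^+ 2 + c ^+ 2 = 1 ->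
  `|\int[mu]_z D2 j k (U s c z) - \int[mu]_z D2 j k (mix i s c z)| <=
  s * rn * H * \sum_l E3 i (fun x => `|X i l x|).
Proof.
move=> s0 c0 sc; have [_ h2 h3] := fD.
have [D [dD D0 boxD momD]] := growth_box_bound i s0 c0 sc.
pose a := s * rn.
have a0 : 0 <= a by rewrite mulr_ge0// invr_ge0 sqrtr_ge0.
have q1 : 1 + q <= q + 3 by lra.
have qq : q <= q + 3 by lra.
have dabs l : dominated NX 1 (fun x => `|X i l x|).
  by apply: dominated_abs; exact: dominated_sample.
have iXD l : mu.-integrable setT (EFin \o (fun z => `|X i l z.1| * D z)).
  apply: (joint_integrable q0 X_mom Z_normal q1).
  by apply: dominatedM => //; exact: (dominated_fst Z ler01 (dabs l)).
have i1 := joint_integrable q0 X_mom Z_normal qq (dom_interp s c (@D2_cont j k) (D2_growth j k)).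
have i2 := joint_integrable q0 X_mom Z_normal qq (dom_mix i s c (@D2_cont j k) (D2_growth j k)).
rewrite -RintegralB//.
apply: (@le_trans _ _ (\int[mu]_z (a * H * \sum_l `|X i l z.1| * D z))); last first.
  rewrite RintegralZl//; last exact: integrable_fsum.
  rewrite ler_wpM2l ?mulr_ge0// Rintegral_fsum//; apply: ler_sum => l _.
  apply: (momD _ 1) => //; first by rewrite ler1n.
  by apply: depends_on_abs; exact: depends_on_sample.
apply: (le_trans (le_normr_Rintegral _ _)) => //; first exact: integrable_sub.
apply: le_Rintegral => //.
- by have := integrable_sub i1 i2; move/integrable_abse; exact: eq_integrable.
- by apply: integrable_scale; exact: integrable_fsum.
move=> z _; rewrite (interpolationE i).
have ns : norm1 (shift i s z) = a * \sum_k `|X i k z.1|.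
  rewrite /norm1 mulr_sumr; apply: eq_bigr => l _.
  by rewrite mxE mulrA normrM (ger0_norm a0).
have := @box_Lipschitz _ _ (D2 j k) (D3 j k) (mix i s c z) (shift i s z) (H * D z) (h3 j k).
rewrite ns => h; apply: (le_trans (h _)).
  by move=> v l hv; rewrite (le_trans (D3_bound _ _ _ _))// ler_wpM2l//; exact: boxD.
by rewrite -mulr_suml le_eqVlt; apply/orP; left; apply/eqP; ring.
Qed.

(** The cross terms vanish: W_k is the partial sum plus X_ik / sqrt n, and the partial
    sum is independent of the centred variable X_ij. *)
Lemma covariance_sum j k :
  (S *m S) j k = rn ^+ 2 * \sum_i \int[P]_x (X i j x * X i k x).
Proof.
have q2 : 1 + 1 <= q + 3 by have := q0; lra.
have dX i l := dominated_sample X i l.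
have iXW i : P.-integrable setT (EFin \o (fun x => X i j x * W k x)).
  by apply: (sample_integrable q0 X_mom q2); apply: dominatedM => //; exact: dominated_normalized_sum.
have iXX i : P.-integrable setT (EFin \o (fun x => X i j x * X i k x)).
  by apply: (sample_integrable q0 X_mom q2); exact: dominatedM.
have iXp i : P.-integrable setT (EFin \o (fun x => X i j x * partial_sum X i k x)).
  by apply: (sample_integrable q0 X_mom q2); apply: dominatedM => //; exact: dominated_partial_sum.
rewrite SS.
have -> : \int[P]_x (W j x * W k x) = \int[P]_x (rn * \sum_i X i j x * W k x).
  by apply: eq_Rintegral => x _; rewrite {1}/normalized_sum -mulrA mulr_suml.
rewrite RintegralZl//; last exact: integrable_fsum.
rewrite expr2 -mulrA; congr (_ * _); rewrite Rintegral_fsum// mulr_sumr.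
apply: eq_bigr => i _.
have -> : \int[P]_x (X i j x * W k x) =
    \int[P]_x (X i j x * partial_sum X i k x + rn * (X i j x * X i k x)).
  by apply: eq_Rintegral => x _; rewrite (normalized_sumE X i); ring.
rewrite RintegralD//; last exact: integrable_scale.
rewrite RintegralZl//.
rewrite (sample_independent X_indep q0 X_mom ler01 ler01 q2 (depends_on_sample X i j)
  (depends_off_partial_sum X i k) (dX i j) (dominated_partial_sum X i k)).
by rewrite X_mean0 mul0r add0r.
Qed.

(** The sum over i of the two estimates above. Up to s^2 times a constant, the
    non-Gaussian vector W satisfies the same integration by parts along the
    interpolation as a Gaussian one. *)
Lemma lindeberg_estimate s c : 0 <= s -> 0 <= c -> s ^+ 2 + c ^+ 2 = 1 ->
  `|\sum_j \int[mu]_z (W j z.1 * D1 j (U s c z)) -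
    s * \sum_j \sum_k (S *m S) j k * \int[mu]_z D2 j k (U s c z)| <=
  s ^+ 2 * (rn ^+ 3 * H * \sum_i \sum_j \sum_k \sum_l
    (E3 i (fun x => `|X i j x * X i k x * X i l x|) / 2 +
     `|\int[P]_x (X i j x * X i k x)| * E3 i (fun x => `|X i l x|))).
Proof.
move=> s0 c0 sc.
have rn0 : 0 <= rn by rewrite invr_ge0 sqrtr_ge0.
have q1 : 1 + q <= q + 3 by lra.
have iX i j : mu.-integrable setT (EFin \o (fun z => X i j z.1 * D1 j (U s c z))).
  apply: (joint_integrable q0 X_mom Z_normal q1); apply: dominatedM => //.
  by apply: dom_interp => //; exact: D1_cont.
have eW j : \int[mu]_z (W j z.1 * D1 j (U s c z)) =
    rn * \sum_i \int[mu]_z (X i j z.1 * D1 j (U s c z)).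
  rewrite -Rintegral_fsum// -RintegralZl//; last exact: integrable_fsum.
  by apply: eq_Rintegral => z _; rewrite /normalized_sum -mulrA mulr_suml.
pose m i j k := \int[P]_x (X i j x * X i k x).
pose b j k := \int[mu]_z D2 j k (U s c z).
pose G i j := \int[mu]_z (X i j z.1 * D1 j (U s c z)) - s * rn * \sum_k m i j k * b j k.
have -> : \sum_j \int[mu]_z (W j z.1 * D1 j (U s c z)) -
    s * \sum_j \sum_k (S *m S) j k * \int[mu]_z D2 j k (U s c z) =
    rn * \sum_i \sum_j G i j.
  rewrite mulr_sumr -sumrB exchange_big mulr_sumr; apply: eq_bigr => j _.
  rewrite eW /G sumrB mulrBr; congr (_ - _).
  rewrite -mulr_sumr exchange_big /= !mulr_sumr; apply: eq_bigr => k _.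
  by rewrite covariance_sum -/(b j k) -mulr_suml; rewrite /m; ring.
have Gle i j : `|G i j| <= (s * rn) ^+ 2 * H * \sum_k \sum_l
    (E3 i (fun x => `|X i j x * X i k x * X i l x|) / 2 + `|m i j k| * E3 i (fun x => `|X i l x|)).
  pose bm k := \int[mu]_z D2 j k (mix i s c z).
  have -> : G i j = (\int[mu]_z (X i j z.1 * D1 j (U s c z)) - s * rn * \sum_k m i j k * bm k)
      - s * rn * \sum_k m i j k * (b j k - bm k).
    rewrite /G -addrA -opprD -mulrDr -big_split/=; congr (_ - _ * _); apply: eq_bigr => k _; ring.
  apply: (le_trans (ler_normB _ _)).
  have h1 := first_partial_estimate i j s0 c0 sc.
  apply: (le_trans (lerD h1 (lexx _))).
  have h2 k := second_partial_estimate i j k s0 c0 sc.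
  have h3 : `|s * rn * \sum_k m i j k * (b j k - bm k)| <=
      s * rn * \sum_k `|m i j k| * (s * rn * H * \sum_l E3 i (fun x => `|X i l x|)).
    rewrite normrM (ger0_norm (mulr_ge0 s0 rn0)) ler_wpM2l ?mulr_ge0//.
    apply: (le_trans (ler_norm_sum _ _ _)); apply: ler_sum => k _.
    rewrite normrM ler_wpM2l //; exact: h2.
  apply: (le_trans (lerD (lexx _) h3)).
  rewrite le_eqVlt; apply/orP; left; apply/eqP.
  have -> : \sum_k \sum_l (E3 i (fun x => `|X i j x * X i k x * X i l x|) / 2 +
      `|m i j k| * E3 i (fun x => `|X i l x|)) =
      (\sum_k \sum_l E3 i (fun x => `|X i j x * X i k x * X i l x|)) / 2 +
      (\sum_k `|m i j k|) * (\sum_l E3 i (fun x => `|X i l x|)).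
    rewrite !mulr_suml -big_split/=; apply: eq_bigr => k _.
    by rewrite big_split/= mulr_suml mulr_sumr.
  rewrite -mulr_suml; set u := _^-1. by field.
rewrite normrM (ger0_norm rn0).
apply: (@le_trans _ _ (rn * \sum_i \sum_j (s * rn) ^+ 2 * H * \sum_k \sum_l
    (E3 i (fun x => `|X i j x * X i k x * X i l x|) / 2 + `|m i j k| * E3 i (fun x => `|X i l x|)))).
  rewrite ler_wpM2l//; apply: (le_trans (ler_norm_sum _ _ _)); apply: ler_sum => i _.
  by apply: (le_trans (ler_norm_sum _ _ _)); exact: ler_sum.
rewrite le_eqVlt; apply/orP; left; apply/eqP.
under eq_bigr do rewrite -mulr_sumr; rewrite -mulr_sumr.
by ring.
Qed.

Local Notation Sg := (S *m S).

Let f_growth : pgrowth (q + 1) f.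
Proof. by case: fD => h1 _ _; exact: (pgrowth_primitive q0 h1 D1_growth). Qed.

Let f_cont : continuous f.
Proof. by case: fD => h1 _ _; exact: (pgrowth_continuous q0 h1 D1_growth). Qed.

Let iD1W j s c : mu.-integrable setT (EFin \o (fun z => W j z.1 * D1 j (U s c z))).
Proof.
have q1 : 1 + q <= q + 3 by lra.
apply: (joint_integrable q0 X_mom Z_normal q1); apply: dominatedM => //.
  exact: (dominated_fst Z ler01 (dominated_normalized_sum X j)).
by apply: dominated_interpolation => //; exact: D1_cont.
Qed.

Let iD1V j s c : mu.-integrable setT (EFin \o (fun z => SZ z.2 j 0 * D1 j (U s c z))).
Proof.
have q1 : 1 + q <= q + 3 by lra.
apply: (joint_integrable q0 X_mom Z_normal q1); apply: dominatedM => //.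
  exact: dominated_joint_image.
by apply: dominated_interpolation => //; exact: D1_cont.
Qed.

Lemma interpolation_slice s c x y :
  U s c (x, y) = s *: (\col_j W j x) + c *: SZ y.
Proof. by apply/matrixP => j k; rewrite (ord1 k) !mxE. Qed.

(** For a fixed sample point the interpolation is an affine image of the Gaussian
    vector with linear part c S. *)
Lemma gaussian_part j s c :
  \int[mu]_z (SZ z.2 j 0 * D1 j (U s c z)) =
  c * \sum_k Sg j k * \int[mu]_z D2 j k (U s c z).
Proof.
have [_ h2 h3] := fD.
have qq : q <= q + 3 by lra.
have q1 : 1 + q <= q + 3 by lra.
have q10 : 0 <= 1 + q by rewrite addr_ge0.
have dD2 k : dominated N q (fun z => D2 j k (U s c z)).
  by apply: dominated_interpolation => //; exact: D2_cont.
have iD2 k : mu.-integrable setT (EFin \o (fun z => D2 j k (U s c z))).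
  exact: (joint_integrable q0 X_mom Z_normal qq).
have iD2x k x : Q.-integrable setT (EFin \o (fun y => D2 j k (U s c (x, y)))).
  by apply: (gaussian_image_integrable Z_normal q0); exact: (dominated_slice_snd x q0 (dD2 k)).
have iVx x : Q.-integrable setT (EFin \o (fun y => SZ y j 0 * D1 j (U s c (x, y)))).
  apply: (gaussian_image_integrable Z_normal q10).
  apply: (@dominated_slice_snd _ _ _ _ _ _ _ _ _ X Z _ (fun z => SZ z.2 j 0 * D1 j (U s c z))) => //.
  apply: dominatedM => //; first exact: dominated_joint_image.
  by apply: dominated_interpolation => //; exact: D1_cont.
rewrite Rintegral_iterated//.
have ibp x : \int[Q]_y (SZ y j 0 * D1 j (U s c (x, y))) =
    c * \sum_k Sg j k * \int[Q]_y D2 j k (U s c (x, y)).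
  under eq_Rintegral do rewrite interpolation_slice.
  have dD1 w v : is_derive w v (D1 j) (\sum_k v k 0 * D2 j k w).
    by refine (is_derive_direction w v q0 (h2 j) (h3 j) (D3_growth j)).
  rewrite (gaussian_image_ibp Z_normal S_sym j (s *: (\col_j W j x)) c q0
    dD1 (@D1_cont j) (@D2_cont j) (D1_growth j) (D2_growth j)).
  congr (_ * _); apply: eq_bigr => k _; congr (_ * _).
  by apply: eq_Rintegral => y _; rewrite interpolation_slice.
under eq_Rintegral do rewrite /= ibp.
have iI k : P.-integrable setT (EFin \o (fun x => Sg j k * \int[Q]_y D2 j k (U s c (x, y)))).
  by apply: integrable_scale; exact: (integrable_iterated (iD2 k) (iD2x k)).
rewrite RintegralZl//; last exact: integrable_fsum.
rewrite Rintegral_fsum//; congr (_ * _); apply: eq_bigr => k _.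
by rewrite RintegralZl ?(Rintegral_iterated (iD2 k))//; exact: (integrable_iterated (iD2 k) (iD2x k)).
Qed.

(** One constant serves the whole quarter circle: the error constant in
    arc_partition must not depend on the point of the circle. *)
Lemma interpolation_size : exists2 a : R, 0 <= a & forall s c z,
  0 <= s -> s <= 1 -> 0 <= c -> c <= 1 -> norm1 (U s c z) <= a * N z /\
  forall s' c', norm1 (U s' c' z - U s c z) <= (`|s' - s| + `|c' - c|) * (a * N z).
Proof.
pose G z := \sum_j (`|W j z.1| + `|SZ z.2 j 0|).
have [_ [a a0 ha]] : dominated N 1 G.
  apply: dominated_sum => // j; apply: dominatedD => //.
    by apply: dominated_abs; exact: (dominated_fst Z ler01 (dominated_normalized_sum X j)).
  by apply: dominated_abs; exact: dominated_joint_image.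
have Ga z : G z <= a * N z.
  by have := ha z; rewrite powRr1 ?(le_trans ler01)//; apply: le_trans; exact: ler_norm.
exists a => // s c z s0 s1 c0 c1; split => [|s' c'].
  apply: le_trans (Ga z); apply: ler_sum => j _; rewrite mxE.
  apply: (le_trans (ler_normD _ _)); rewrite !normrM (ger0_norm s0) (ger0_norm c0).
  by apply: lerD; exact: ler_piMl.
apply: (@le_trans _ _ ((`|s' - s| + `|c' - c|) * G z)); last first.
  by rewrite ler_wpM2l// addr_ge0.
rewrite /G mulr_sumr; apply: ler_sum => j _.
have -> : (U s' c' z - U s c z) j 0 = (s' - s) * W j z.1 + (c' - c) * SZ z.2 j 0.
  by rewrite !mxE; ring.
apply: (le_trans (ler_normD _ _)); rewrite !normrM mulrDl !mulrDr.
by apply: lerD; [rewrite lerDl|rewrite lerDr]; rewrite mulr_ge0.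
Qed.

(** Two factors N come from the squared displacement and q from the growth of the
    second derivatives on the box; the exponent q + 3 is the one known to be
    integrable. *)
Lemma interpolation_Taylor : exists2 b : R, 0 <= b & forall s c s' c' z,
  0 <= s -> s <= 1 -> 0 <= c -> c <= 1 -> 0 <= s' -> s' <= 1 -> 0 <= c' -> c' <= 1 ->
  (forall j k, `|D2 j k (U s c z)| <= b * N z `^ (q + 3)) /\
  `|f (U s' c' z) - f (U s c z) - \sum_j (U s' c' z - U s c z) j 0 * D1 j (U s c z)|
    <= ((s' - s) ^+ 2 + (c' - c) ^+ 2) * (b * N z `^ (q + 3)).
Proof.
have [h1 h2 h3] := fD.
have [a a0 ha] := interpolation_size.
have [C C0 hC] := pgrowth_unif (F := fun p : 'I_d * 'I_d => D2 p.1 p.2)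
  (fun p => D2_growth p.1 p.2).
pose b := C * (1 + 3 * a) `^ q * (1 + a ^+ 2).
have b0 : 0 <= b by rewrite !mulr_ge0 ?powR_ge0// addr_ge0// sqr_ge0.
exists b => // s c s' c' z s0 s1 c0 c1 s'0 s'1 c'0 c'1.
have N0 : 0 <= N z by apply: le_trans (N1 z).
have NE : N z `^ q * N z ^+ 2 <= N z `^ (q + 3).
  have -> : N z `^ q * N z ^+ 2 = N z `^ (q + 2).
    by rewrite powRD ?powR_mulrn//; apply/implyP => _; rewrite gt_eqF ?(lt_le_trans ltr01).
  by rewrite ler_powR ?N1// lerD2l ler_nat.
have N21 : 1 <= N z ^+ 2 by rewrite expr_ge1.
have [hU hy] := ha s c z s0 s1 c0 c1.
pose e := `|s' - s| + `|c' - c|.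
have e0 : 0 <= e by rewrite addr_ge0.
have e2 : e <= 2.
  have A1 : `|s' - s| <= 1 by rewrite ler_norml; apply/andP; split; lra.
  have A2 : `|c' - c| <= 1 by rewrite ler_norml; apply/andP; split; lra.
  by rewrite /e; lra.
have ee : e ^+ 2 <= 2 * ((s' - s) ^+ 2 + (c' - c) ^+ 2).
  rewrite -(real_normK (num_real (s' - s))) -(real_normK (num_real (c' - c))) /e.
  by have := sqr_ge0 (`|s' - s| - `|c' - c|); nra.
pose y := U s' c' z - U s c z.
have hyz : norm1 y <= e * (a * N z) by exact: hy.
pose M := C * (1 + 3 * a) `^ q * N z `^ q.
have M0 : 0 <= M by rewrite !mulr_ge0 ?powR_ge0.
have hM v j k : box (U s c z) y v -> `|D2 j k v| <= M.
  move=> hv; apply: (le_trans (growth_box q0 C0 (hC (j, k)) hv)).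
  have a30 : 0 <= 1 + 3 * a by rewrite addr_ge0// mulr_ge0.
  have aN0 : 0 <= (1 + 3 * a) * N z by exact: mulr_ge0.
  rewrite /M -mulrA ler_wpM2l// -powRM//.
  rewrite ge0_ler_powR ?nnegrE ?addr_ge0 ?norm1_ge0//.
  have ey : e * (a * N z) <= 2 * (a * N z) by rewrite ler_wpM2r// mulr_ge0.
  have -> : (1 + 3 * a) * N z = N z + a * N z + 2 * (a * N z) by ring.
  by apply: lerD; [exact: lerD|exact: le_trans ey].
have Mb : M <= b * N z `^ (q + 3).
  apply: le_trans (ler_wpM2l b0 NE).
  rewrite /M /b -[leRHS]mulrA ler_wpM2l ?mulr_ge0 ?powR_ge0//.
  by rewrite mulrCA ler_peMr ?powR_ge0// mulr_ege1// lerDl sqr_ge0.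
split.
  by move=> j k; apply: le_trans Mb; apply: hM => t; rewrite subrr normr0.
have Ty := box_Taylor M0 h1 h2 hM.
have -> : U s' c' z = U s c z + y by rewrite /y addrC subrK.
rewrite [_ + y - _]addrAC subrr add0r.
apply: (le_trans Ty).
have : norm1 y ^+ 2 <= (e * (a * N z)) ^+ 2.
  by rewrite ler_sqr ?nnegrE ?norm1_ge0// mulr_ge0// mulr_ge0.
move=> h; apply: (@le_trans _ _ (M / 2 * (2 * ((s' - s) ^+ 2 + (c' - c) ^+ 2) * (a * N z) ^+ 2))).
  rewrite ler_wpM2l ?divr_ge0//; apply: (le_trans h); rewrite exprMn.
  by rewrite ler_wpM2r// sqr_ge0.
have -> : M / 2 * (2 * ((s' - s) ^+ 2 + (c' - c) ^+ 2) * (a * N z) ^+ 2) =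
  ((s' - s) ^+ 2 + (c' - c) ^+ 2) * (C * (1 + 3 * a) `^ q * a ^+ 2 * (N z `^ q * N z ^+ 2)).
  by rewrite /M; field.
apply: ler_wpM2l; first by rewrite addr_ge0// sqr_ge0.
apply: le_trans (ler_wpM2l b0 NE).
apply: ler_wpM2r; first by rewrite mulr_ge0 ?powR_ge0// sqr_ge0.
rewrite /b; apply: ler_wpM2l; first by rewrite mulr_ge0 ?powR_ge0.
by rewrite lerDr.
Qed.

Local Notation K := (rn ^+ 3 * H * \sum_i \sum_j \sum_k \sum_l
    (E3 i (fun x => `|X i j x * X i k x * X i l x|) / 2 +
     `|\int[P]_x (X i j x * X i k x)| * E3 i (fun x => `|X i l x|))).

Let i_f s c : mu.-integrable setT (EFin \o (fun z => f (U s c z))).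
Proof.
have q1 : q + 1 <= q + 3 by lra.
apply: (joint_integrable q0 X_mom Z_normal q1).
by apply: dominated_interpolation => //; rewrite addr_ge0.
Qed.

(** The first-order term of the increment is
    (s' - s) E<W, Df> + (c' - c) E<V, Df>. Gaussian integration by parts turns the second
    expectation into c beta, and lindeberg_estimate turns the first into s beta up to
    s^2 K. On the circle (s' - s) s + (c' - c) c is minus half the squared chord, so
    the beta terms cancel up to a quadratic error, and (s' - s) s^2 is at most a third
    of the increment of the cube. *)
Lemma interpolation_step : exists2 C : R, 0 <= C & forall s c s' c',
  0 <= s -> 0 <= c -> 0 <= s' -> 0 <= c' ->
  s ^+ 2 + c ^+ 2 = 1 -> s' ^+ 2 + c' ^+ 2 = 1 -> s <= s' ->
  `|\int[mu]_z f (U s' c' z) - \int[mu]_z f (U s c z)| <=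
    K * ((s' ^+ 3 - s ^+ 3) / 3) + C * ((s' - s) ^+ 2 + (c' - c) ^+ 2).
Proof.
have [b b0 hb] := interpolation_Taylor.
have iN : mu.-integrable setT (EFin \o (fun z => b * N z `^ (q + 3))).
  by apply: integrable_scale; exact: (joint_size_integrable q0 X_mom Z_normal).
pose I := \int[mu]_z (b * N z `^ (q + 3)).
have I0 : 0 <= I by apply: Rintegral_ge0 => z _; rewrite mulr_ge0 ?powR_ge0.
pose G := \sum_j \sum_k `|Sg j k|.
have G0 : 0 <= G by apply: sumr_ge0 => j _; exact: sumr_ge0.
exists (I * (1 + G / 2)); first by rewrite mulr_ge0// addr_ge0// divr_ge0.
move=> s c s' c' s0 c0 s'0 c'0 sc sc' ss'.
have le1 (x y : R) : 0 <= x -> x ^+ 2 + y ^+ 2 = 1 -> x <= 1.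
  move=> x0 xy; rewrite -(expr_le1 (n := 2))//; have := sqr_ge0 y; lra.
have s1 := le1 _ _ s0 sc; have s'1 := le1 _ _ s'0 sc'.
have c1 : c <= 1 by apply: (le1 _ s) => //; rewrite addrC.
have c'1 : c' <= 1 by apply: (le1 _ s') => //; rewrite addrC.
have hz z := hb s c s' c' z s0 s1 c0 c1 s'0 s'1 c'0 c'1.
pose L z := (s' - s) * (\sum_j W j z.1 * D1 j (U s c z)) +
   (c' - c) * \sum_j SZ z.2 j 0 * D1 j (U s c z).
have iL1 : mu.-integrable setT (EFin \o (fun z => (s' - s) * (\sum_j W j z.1 * D1 j (U s c z)))).
  by apply: integrable_scale; apply: integrable_fsum => j; exact: iD1W.
have iL2 : mu.-integrable setT (EFin \o (fun z => (c' - c) * (\sum_j SZ z.2 j 0 * D1 j (U s c z)))).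
  by apply: integrable_scale; apply: integrable_fsum => j; exact: iD1V.
have iL : mu.-integrable setT (EFin \o L) by exact: integrable_add.
pose a := \sum_j \int[mu]_z (W j z.1 * D1 j (U s c z)).
pose beta := \sum_j \sum_k Sg j k * \int[mu]_z D2 j k (U s c z).
have eL : \int[mu]_z L z = (s' - s) * a + (c' - c) * (c * beta).
  rewrite RintegralD// !RintegralZl//; try by apply: integrable_fsum.
  rewrite !Rintegral_fsum//; congr (_ + _ * _); rewrite /beta mulr_sumr.
  by apply: eq_bigr => j _; rewrite gaussian_part.
have iD : mu.-integrable setT (EFin \o (fun z => f (U s' c' z) - f (U s c z) - L z)).
  by apply: integrable_sub => //; exact: integrable_sub.
pose dd := (s' - s) ^+ 2 + (c' - c) ^+ 2.
have dd0 : 0 <= dd by rewrite addr_ge0 ?sqr_ge0.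
have rem : `|\int[mu]_z (f (U s' c' z) - f (U s c z) - L z)| <= dd * I.
  apply: (le_trans (le_normr_Rintegral _ _)) => //.
  rewrite /I -RintegralZl//; apply: le_Rintegral => //.
  - by have := iD; move/integrable_abse; exact: eq_integrable.
  - exact: integrable_scale.
  move=> z _; apply: le_trans (hz z).2; rewrite le_eqVlt; apply/orP; left; apply/eqP.
  congr (`| _ - _ |); rewrite /L !mulr_sumr -big_split/=; apply: eq_bigr => j _.
  by rewrite !mxE; ring.
have betaI : `|beta| <= G * I.
  rewrite /beta /G mulr_suml; apply: (le_trans (ler_norm_sum _ _ _)).
  apply: ler_sum => j _; rewrite mulr_suml; apply: (le_trans (ler_norm_sum _ _ _)).
  apply: ler_sum => k _; rewrite normrM ler_wpM2l//.
  have qq : q <= q + 3 by lra.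
  have iD2 : mu.-integrable setT (EFin \o (fun z => D2 j k (U s c z))).
    apply: (joint_integrable q0 X_mom Z_normal qq).
    by apply: dominated_interpolation => //; exact: D2_cont.
  apply: (le_trans (le_normr_Rintegral _ _)) => //.
  apply: le_Rintegral => //.
    by have := iD2; move/integrable_abse; exact: eq_integrable.
  by move=> z _; exact: (hz z).1.
have lind : `|a - s * beta| <= s ^+ 2 * K.
  exact: (lindeberg_estimate s0 c0 sc).
have K0 : 0 <= K.
  have h1 : 1 ^+ 2 + 0 ^+ 2 = 1 :> R by rewrite expr1n expr0n addr0.
  have := lindeberg_estimate ler01 (lexx 0) h1.
  by move/(le_trans (normr_ge0 _)); rewrite expr1n mul1r.
have -> : \int[mu]_z f (U s' c' z) - \int[mu]_z f (U s c z) =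
    \int[mu]_z (f (U s' c' z) - f (U s c z) - L z) +
    ((s' - s) * (a - s * beta) - dd / 2 * beta).
  rewrite RintegralB//; last exact: integrable_sub.
  rewrite RintegralB// eL.
  (* both points lie on the unit circle *)
  have E : (s' - s) * s + (c' - c) * c = - (dd / 2).
    by rewrite /dd; move: sc sc'; nra.
  have -> : (s' - s) * a + (c' - c) * (c * beta) =
    (s' - s) * (a - s * beta) + ((s' - s) * s + (c' - c) * c) * beta by ring.
  by rewrite E; ring.
apply: (le_trans (ler_normD _ _)).
apply: (@le_trans _ _ (dd * I + ((s' - s) * (s ^+ 2 * K) + dd / 2 * (G * I)))).
  apply: lerD => //; apply: (le_trans (ler_normB _ _)); apply: lerD.
    by rewrite normrM ger0_norm ?subr_ge0// ler_wpM2l// subr_ge0.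
  by rewrite normrM ger0_norm ?divr_ge0// ler_wpM2l// divr_ge0.
have cube : (s' - s) * s ^+ 2 <= (s' ^+ 3 - s ^+ 3) / 3.
  have -> : (s' ^+ 3 - s ^+ 3) / 3 = (s' - s) * ((s' ^+ 2 + s' * s + s ^+ 2) / 3) by field.
  by rewrite ler_wpM2l ?subr_ge0//; nra.
have := ler_wpM2r K0 cube.
rewrite -/dd; move: cube => _; lra.
Qed.

Lemma sum_test_integrable : P.-integrable setT (EFin \o (fun x => f (\col_j W j x))).
Proof.
have q1 : q + 1 <= q + 3 by lra.
apply: (sample_integrable q0 X_mom q1); apply: dominated_col => //; first by rewrite addr_ge0.
by move=> j; exact: dominated_normalized_sum.
Qed.

Lemma gaussian_test_integrable : Q.-integrable setT (EFin \o (fun y => f (SZ y))).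
Proof.
have q1 : 0 <= q + 1 by rewrite addr_ge0.
apply: (gaussian_image_integrable Z_normal q1).
have := dominated_gaussian_image_affine Z S 0 1 q1 f_cont f_growth.
by under eq_fun do rewrite add0r scale1r.
Qed.

Theorem gaussian_comparison :
  `|\int[P]_x f (\col_j W j x) - \int[Q]_y f (SZ y)| <= K / 3.
Proof.
have [C C0 hC] := interpolation_step.
have := @arc_partition R (fun s c => \int[mu]_z f (U s c z)) K C C0 hC.
rewrite -(Rintegral_fst Q sum_test_integrable) -(Rintegral_snd P gaussian_test_integrable).
congr (`| _ - _ | <= _); apply: eq_Rintegral => z _; congr f; apply/matrixP => j k; rewrite (ord1 k) mxE.
  by rewrite mxE mul1r mul0r addr0.
by rewrite mul0r mul1r add0r.
Qed.

End interpolation_path.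

(** * Expectations and suprema of derivatives *)

Section expectations.
Context (R : realType) (d0 : measure_display) (T : measurableType d0) (P : probability T R).

Lemma expectation_Rintegral (f : T -> R) : P.-integrable setT (EFin \o f) ->
  'E_P[f]%E = (\int[P]_x f x)%:E.
Proof. by move=> fi; rewrite unlock /Rintegral fineK//; exact: integrable_fin_num fi. Qed.

Lemma Rintegral_eq0_ae (f : T -> R) : P.-integrable setT (EFin \o f) ->
  (forall x, 0 <= f x) -> \int[P]_x f x = 0 -> \forall x \ae P, f x = 0.
Proof.
move=> fi f0 /(congr1 (@EFin R)); rewrite /Rintegral fineK ?integrable_fin_num// => h.
have : (\int[P]_x `|(EFin \o f) x| = 0)%E.
  by rewrite -[RHS]h; apply: eq_integral => x _; rewrite gee0_abs// lee_fin.
move/(ae_eq_integral_abs P measurableT (measurable_int _ fi)).1.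
by apply: filterS => x /= /(_ Logic.I)[].
Qed.

Lemma expectation_ae_cst (f : T -> R) (a : R) : measurable_fun setT f ->
  (\forall x \ae P, f x = a) -> 'E_P[f]%E = a%:E.
Proof.
move=> mf fa; rewrite unlock (ae_eq_integral (cst a%:E))//.
- by rewrite integral_cst//= probability_setT mule1.
- exact/measurable_EFinP.
- by apply: filterS fa => x fxa _; rewrite /= fxa.
Qed.

End expectations.

Section derivative_norms.
Context (R : realType).
Implicit Types h f : R -> R.

Lemma sup_norm_ge0 f : (0 <= sup_norm f)%E.
Proof.
apply: (@le_trans _ _ `|f 0|%:E); first by rewrite lee_fin.
by apply: ereal_sup_ubound; exists 0.
Qed.

Lemma sup_norm_fin f : (sup_norm f < +oo)%E ->
  exists2 b : R, sup_norm f = b%:E & forall x, `|f x| <= b.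
Proof.
move=> fo; have e : sup_norm f = (fine (sup_norm f))%:E.
  by rewrite fineK// ge0_fin_numE ?sup_norm_ge0.
exists (fine (sup_norm f)) => // x; rewrite -lee_fin -e.
by apply: ereal_sup_ubound; exists x.
Qed.

Lemma sup_norm_lty f (M : R) : (forall x, `|f x| <= M) -> (sup_norm f < +oo)%E.
Proof.
move=> fM; apply: (@le_lt_trans _ _ M%:E); last exact: ltry.
by apply: ge_ereal_sup => _ [x _ <-]; rewrite lee_fin.
Qed.

Lemma stirling_norm3E h : stirling_norm 3 h =
  (sup_norm (h^`(1))%classic + 3%:E * sup_norm (h^`(2))%classic + sup_norm (h^`(3))%classic)%E.
Proof. by rewrite /stirling_norm big_nat_recr//= big_nat_recr//= big_nat1 /= !mul1e. Qed.

Lemma Cb_is_derive k h j x : Cb k h -> (j < k)%N ->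
  is_derive x (1 : R) (h^`(j))%classic ((h^`(j.+1))%classic x).
Proof.
by move=> [dh _] jk; rewrite derive1nS derive1E; apply: derivableP; exact: dh.
Qed.

(** The third derivative is bounded by assumption while the first two may be
    unbounded, so the constant of the theorem may be infinite. *)
Lemma stirling_norm3_cases h : Cb 3 h ->
  [\/ stirling_norm 3 h = +oo%E | exists b1 b2 b3 : R,
    [/\ stirling_norm 3 h = (b1 + 3 * b2 + b3)%:E, forall x, `|(h^`(1))%classic x| <= b1,
        forall x, `|(h^`(2))%classic x| <= b2 & forall x, `|(h^`(3))%classic x| <= b3]].
Proof.
move=> [_ [M hM]]; rewrite stirling_norm3E.
have [b3 e3 h3] := sup_norm_fin (sup_norm_lty hM).
rewrite [X in (_ + X)%E = _]e3 [X in exists _ _ _, [/\ (_ + X)%E = _, _, _ & _]]e3.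
have p1 := sup_norm_ge0 (h^`(1))%classic; have p2 := sup_norm_ge0 (h^`(2))%classic.
have [/sup_norm_fin[b1 -> h1]|] := ltP (sup_norm (h^`(1))%classic) +oo%E; last first.
  rewrite leye_eq => /eqP ->; left; rewrite !addye// gt_eqF//.
  by rewrite (lt_le_trans (ltNyr 0))// mule_ge0.
have [/sup_norm_fin[b2 -> h2]|] := ltP (sup_norm (h^`(2))%classic) +oo%E; last first.
  by rewrite leye_eq => /eqP ->; left; rewrite gt0_muley ?lte_fin// addey ?addye.
by right; exists b1, b2, b3; split=> //; rewrite !EFinD EFinM.
Qed.

End derivative_norms.

(** * Expectations and vanishing of the brackets *)

Section brackets.
Context (R : realType) (dT dT' : measure_display) (T : measurableType dT)
  (T' : measurableType dT') (P : probability T R) (Q : probability T' R)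
  (n d : nat) (X : 'I_n -> 'I_d -> {RV P >-> R}) (Z : 'I_d -> {RV Q >-> R})
  (S : 'M[R]_d) (q : R).
Hypotheses (q0 : 0 <= q)
  (X_mom : forall i j, P.-integrable setT (EFin \o (fun x => `|X i j x| `^ (q + 3))))
  (Z_normal : std_normal_vector Z) (S_sym : S^T = S).
Local Notation V := 'cV[R]_d.
Local Notation SZ := (gaussian_image Z S).
Local Notation rn := (@Num.sqrt R n%:R)^-1.

Local Notation NX := (sample_size X).
Hypothesis SS : forall j k, (S *m S) j k =
  \int[P]_x (normalized_sum X j x * normalized_sum X k x).
Local Notation W := (normalized_sum X).
Context (A : R) (B r : 'I_d -> R).
Hypotheses (A0 : 0 <= A) (B0 : forall t, 0 <= B t) (r0 : forall t, 0 <= r t)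
  (rq : forall t, r t <= q).
Local Notation E3 := (third_moment_bracket X Z S A B r).

Let NX1 := sample_size_ge1 X.
Let q0' : 0 <= q := q0.

Lemma normalized_sum_powR_integrable t :
  P.-integrable setT (EFin \o (fun x => `|W t x| `^ r t)).
Proof.
have h : 1 * r t <= q + 3 by rewrite mul1r; apply: (le_trans (rq t)); lra.
apply: (sample_integrable q0 X_mom h).
by apply: dominated_powR => //; exact: dominated_normalized_sum.
Qed.

Lemma sample_moment_integrable i t phi k : 0 <= k -> k <= 3 -> dominated NX k phi ->
  P.-integrable setT (EFin \o (fun x => phi x * `|X i t x| `^ r t)).
Proof.
move=> k0 k3 dphi; have h : k + 1 * r t <= q + 3.
  by have := rq t; rewrite mul1r; move: k3; lra.
apply: (sample_integrable q0 X_mom h); apply: dominatedM => //.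
by apply: dominated_powR => //; exact: dominated_sample.
Qed.

Lemma expectation_third_moment_bracket i phi k : 0 <= k -> k <= 3 -> dominated NX k phi ->
  (A%:E * 'E_P[phi]
   + \sum_(t < d) (2 `^ r t * B t)%R%:E *
       ((2 `^ r t)%:E * 'E_P[phi] * 'E_P[fun x => (`|W t x| `^ r t)%R]
        + (2 `^ r t / n%:R `^ (r t / 2))%R%:E * 'E_P[fun x => (phi x * `|X i t x| `^ r t)%R]
        + 'E_Q[fun y => (`|SZ y t 0| `^ r t)%R] * 'E_P[phi]))%E = (E3 i phi)%:E.
Proof.
move=> k0 k3 dphi; have h : k <= q + 3 by have := q0; move: k3; lra.
rewrite (expectation_Rintegral (sample_integrable q0 X_mom h dphi)).
rewrite /third_moment_bracket EFinD EFinM -sumEFin; congr (_ + _)%E.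
apply: eq_bigr => t _.
rewrite (expectation_Rintegral (normalized_sum_powR_integrable t)).
rewrite (expectation_Rintegral (sample_moment_integrable i t k0 k3 dphi)).
rewrite (expectation_Rintegral (gaussian_image_powR_integrable S Z_normal t (r0 t))).
have -> : 2 `^ r t / n%:R `^ (r t / 2) = 2 `^ r t * rn `^ r t :> R.
  by rewrite -powR12_sqrt// -(powRN _ 2^-1) -powRrM -powRN mulNr [2^-1 * _]mulrC.
by rewrite !EFinM !EFinD !EFinM.
Qed.

Lemma third_moment_bracket_ge0 i phi : (forall x, 0 <= phi x) -> 0 <= E3 i phi.
Proof.
move=> phi0; have I0 : 0 <= \int[P]_x phi x by apply: Rintegral_ge0.
rewrite /third_moment_bracket addr_ge0 ?mulr_ge0// sumr_ge0// => t _.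
rewrite mulr_ge0 ?mulr_ge0 ?powR_ge0// !addr_ge0// ?mulr_ge0 ?powR_ge0//.
- by apply: Rintegral_ge0 => x _; exact: powR_ge0.
- by apply: Rintegral_ge0 => x _; rewrite mulr_ge0 ?powR_ge0.
- by apply: Rintegral_ge0 => x _; exact: powR_ge0.
Qed.

Lemma third_moment_bracket_eq0 i phi : (forall x, 0 <= phi x) ->
  0 < \int[P]_x phi x -> E3 i phi = 0 ->
  A = 0 /\ forall t, B t = 0 \/ \int[P]_x (`|W t x| `^ r t) = 0 /\
    \int[Q]_y (`|SZ y t 0| `^ r t) = 0.
Proof.
move=> phi0 I0.
pose MW t := \int[P]_x (`|W t x| `^ r t).
pose MV t := \int[Q]_y (`|SZ y t 0| `^ r t).
pose MX t := \int[P]_x (phi x * `|X i t x| `^ r t).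
have MW0 t : 0 <= MW t by apply: Rintegral_ge0 => x _; exact: powR_ge0.
have MV0 t : 0 <= MV t by apply: Rintegral_ge0 => x _; exact: powR_ge0.
have MX0 t : 0 <= MX t by apply: Rintegral_ge0 => x _; rewrite mulr_ge0 ?powR_ge0.
rewrite /third_moment_bracket -/MW; set I := \int[P]_x phi x in I0 *.
have pw t : 0 < 2 `^ r t by apply: powR_gt0.
have I0' := ltW I0; have pw' t := ltW (pw t).
have T1 t : 0 <= 2 `^ r t * I * MW t by apply: mulr_ge0 => //; exact: mulr_ge0.
have T2 t : 0 <= 2 `^ r t * rn `^ r t * MX t.
  by apply: mulr_ge0 => //; apply: mulr_ge0 => //; exact: powR_ge0.
have T3 t : 0 <= MV t * I by exact: mulr_ge0.
have S0 t : 0 <= (2 `^ r t * B t) * (2 `^ r t * I * MW t + 2 `^ r t * rn `^ r t * MX t + MV t * I).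
  by apply: mulr_ge0; [exact: mulr_ge0|rewrite !addr_ge0].
move/eqP; rewrite paddr_eq0; [|exact: mulr_ge0|exact: sumr_ge0].
rewrite mulf_eq0 (gt_eqF I0) orbF => /andP[/eqP -> ]; rewrite psumr_eq0// => /allP h.
split => // t; have := h t; rewrite mem_index_enum => /(_ isT); rewrite /= -/(MW t) -/(MV t) -/(MX t).
rewrite mulf_eq0 mulf_eq0 (gt_eqF (pw t)) /= => /orP[/eqP|]; first by left.
rewrite paddr_eq0 ?addr_ge0// paddr_eq0// => /andP[/andP[+ _]].
rewrite !mulf_eq0 (gt_eqF (pw t)) (gt_eqF I0) /= orbF => /eqP e1 /eqP e2.
by right.
Qed.

(** Where the growth function vanishes on the whole box between 0 and w, so do the
    first partial derivatives, and g is constant there. *)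
Lemma stationary_without_growth (g : V -> R) (D : 'I_d -> V -> R) (w : V) :
  (forall i v, is_derive v (e_ R i) g (D i v)) ->
  (forall i v, growth A B r v = 0 -> D i v = 0) -> A = 0 ->
  (forall t, B t = 0 \/ r t != 0 /\ w t 0 = 0) -> g w = g 0.
Proof.
move=> hD D0 A00 hw.
suff : `|g (0 + w) - g 0| <= 0 * norm1 w.
  by rewrite mul0r add0r normr_le0 subr_eq0 => /eqP.
apply: box_Lipschitz hD _ => v i hv; rewrite D0 ?normr0// /growth A00 add0r.
rewrite big1// => t _; have [->|[rt wt]] := hw t; first by rewrite mul0r.
have := hv t; rewrite wt mxE subr0 normr0 normr_le0 => /eqP ->.
by rewrite normr0 powR0// mulr0.
Qed.

(** If the brackets with weights |X_ij|^3 all vanish, then either all X_ij vanish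
    almost surely, and so do W and V, or some X_ij does not; then A = 0 and, for every
    t with B_t > 0, both W_t and V_t vanish almost surely and r_t > 0, since 0 ^ 0 = 1.
    In either case g is evaluated at points where it takes the value g 0. *)
Lemma degenerate_values (g : V -> R) (D : 'I_d -> V -> R) :
  (forall i v, is_derive v (e_ R i) g (D i v)) ->
  (forall i v, growth A B r v = 0 -> D i v = 0) ->
  (forall i j, E3 i (fun x => `|X i j x * X i j x * X i j x|) = 0) ->
  (\forall x \ae P, g (\col_j W j x) = g 0) /\ (\forall y \ae Q, g (SZ y) = g 0).
Proof.
move=> hD D0 E0.
pose phi i j x := `|X i j x * X i j x * X i j x|.
have phi0 i j x : 0 <= phi i j x by exact: normr_ge0.
have dphi i j : dominated NX (1 + 1 + 1) (phi i j).
  by apply: dominated_abs; apply: dominatedM => //; [apply: dominatedM => //|]; exact: dominated_sample.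
have h3 : 1 + 1 + 1 <= q + 3 by have := q0; lra.
have iphi i j := sample_integrable q0 X_mom h3 (dphi i j).
have [[i [j Iij]]|all0] := pselect (exists i j, \int[P]_x phi i j x != 0).
  have I0 : 0 < \int[P]_x phi i j x by rewrite lt_def Iij; exact: Rintegral_ge0.
  have [A00 hB] := third_moment_bracket_eq0 (phi0 i j) I0 (E0 i j).
  split.
    have : \forall x \ae P, forall t, B t = 0 \/ r t != 0 /\ W t x = 0.
      apply: filter_forall => t; have [Bt|[MW _]] := hB t; first by apply: aeW => x; left.
      apply: filterS (Rintegral_eq0_ae (normalized_sum_powR_integrable t) _ MW) => [x /eqP|x].
        by rewrite powR_eq0 normr_eq0 => /andP[/eqP ? ?]; right.
      exact: powR_ge0.
    apply: filterS => x hx; apply: (stationary_without_growth hD D0 A00) => t.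
    by rewrite mxE.
  have : \forall y \ae Q, forall t, B t = 0 \/ r t != 0 /\ SZ y t 0 = 0.
    apply: filter_forall => t; have [Bt|[_ MV]] := hB t; first by apply: aeW => y; left.
    have iV := gaussian_image_powR_integrable S Z_normal t (r0 t).
    have := Rintegral_eq0_ae iV (fun y => powR_ge0 _ _) MV; apply: filterS => y /eqP.
    by rewrite powR_eq0 normr_eq0 => /andP[/eqP ? ?]; right.
  by apply: filterS => y hy; exact: (stationary_without_growth hD D0 A00).
have W0 : \forall x \ae P, forall j, W j x = 0.
  have : \forall x \ae P, forall i j, X i j x = 0.
    apply: filter_forall => i; apply: filter_forall => j.
    have e0 : \int[P]_x phi i j x = 0.
      by apply/eqP; apply: contrapT => /negP h; apply: all0; exists i, j.
    apply: filterS (Rintegral_eq0_ae (iphi i j) (phi0 i j) e0) => x /eqP.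
    by rewrite /phi normr_eq0 !mulf_eq0 !orbb => /eqP.
  by apply: filterS => x hx j; rewrite /normalized_sum big1 ?mulr0.
split.
  by apply: filterS W0 => x hx; congr g; apply/matrixP => j k; rewrite !mxE hx.
have V0 t : \forall y \ae Q, SZ y t 0 = 0.
  have v0 : \int[Q]_y (SZ y t 0) ^+ 2 = 0.
    rewrite gaussian_image_variance// SS.
    rewrite (_ : \int[P]_x _ = fine 'E_P[fun x => W t x * W t x]); last by rewrite unlock.
    rewrite (expectation_ae_cst (a := 0))//.
    + have [mW _] := dominated_normalized_sum X t; exact: measurable_funM.
    + by apply: filterS W0 => x hx; rewrite hx mul0r.
  have i2 : Q.-integrable setT (EFin \o (fun y => (SZ y t 0) ^+ 2)).
    have h : 0 <= 1 + 1 :> R by lra.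
    apply: (gaussian_image_integrable Z_normal h).
    under eq_fun do rewrite expr2.
    by apply: dominatedM; [exact: gaussian_size_ge1| |]; exact: dominated_gaussian_image.
  apply: filterS (Rintegral_eq0_ae i2 _ v0) => [y /eqP|y]; last exact: sqr_ge0.
  by rewrite sqrf_eq0 => /eqP.
have : \forall y \ae Q, forall t, SZ y t 0 = 0 by apply: filter_forall.
by apply: filterS => y hy; congr g; apply/matrixP => j k; rewrite (ord1 k) hy mxE.
Qed.

End brackets.

(** The cube root of a growth function is again of the same polynomial growth, and
    so is its square. *)
Lemma growth_cube_root (R : realType) (p G : R) : 0 <= p -> p ^+ 3 = G ->
  p <= 1 + G /\ p ^+ 2 <= 1 + G.
Proof.
move=> p0 <-; rewrite expr2 exprS expr2.
have p3 : 0 <= p * (p * p) by rewrite !mulr_ge0.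
have [p1|p1] := leP p 1; split.
- by lra.
- by nra.
- have : p <= p * (p * p); last by lra.
  by rewrite ler_peMr// mulr_ege1// ltW.
- have : p * p <= p * (p * p); last by lra.
  by rewrite ler_wpM2l// ler_peMr// ltW.
Qed.

Theorem theorem2p2 (R : realType)
  (dT : measure_display) (T : measurableType dT) (P : probability T R)
  (dT' : measure_display) (T' : measurableType dT') (Q : probability T' R)
  (n d : nat) (n_gt0 : (0 < n)%N) (d_gt0 : (0 < d)%N)
  (X : 'I_n -> 'I_d -> {RV P >-> R}) (Z : 'I_d -> {RV Q >-> R})
  (S : 'M[R]_d) (A : R) (B r : 'I_d -> R)
  (g : 'cV[R]_d -> R) (h : R -> R)
  (X_indep : mutually_independent P (fun i => random_vector (X i)))
  (X_mean0 : forall i j, ('E_P[X i j] = 0)%E)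
  (Z_normal : std_normal_vector Z)
  (A_ge0 : 0 <= A) (B_ge0 : forall i, 0 <= B i) (r_ge0 : forall i, 0 <= r i)
  (X_moments : forall i j k,
     ('E_P[fun x => (`|X i j x| `^ (r k + 3))%R] < +oo)%E) :
  let W := normalized_sum X in
  let Sigma := covariance_mx P W in
  let SZ := fun y => S *m \col_(j < d) Z j y in
  forall (Sigma_nonneg : nonneg_definite Sigma) (SE : is_nonneg_sqrt Sigma S)
    (g_CP : CP (growth A B r) 3 g) (h_Cb : Cb 3 h),
  (`| 'E_P[fun x => h (g (\col_(j < d) W j x))] - 'E_Q[fun y => h (g (SZ y))] |
   <= stirling_norm 3 h * ((6 * n%:R `^ (3 / 2))^-1)%R%:E *
      \sum_(i < n) \sum_(j < d) \sum_(k < d) \sum_(l < d)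
        (A%:E * 'E_P[fun x => `|X i j x * X i k x * X i l x|%R]
         + \sum_(t < d) (2 `^ r t * B t)%R%:E *
             ((2 `^ r t)%:E * 'E_P[fun x => `|X i j x * X i k x * X i l x|%R]
                * 'E_P[fun x => (`|W t x| `^ r t)%R]
              + (2 `^ r t / n%:R `^ (r t / 2))%R%:E
                * 'E_P[fun x => (`|X i j x * X i k x * X i l x|
                                 * `|X i t x| `^ r t)%R]
              + 'E_Q[fun y => (`|SZ y t 0| `^ r t)%R]
                * 'E_P[fun x => `|X i j x * X i k x * X i l x|%R])
         + 2%:E * `| 'E_P[fun x => (X i j x * X i k x)%R] | *
             (A%:E * 'E_P[fun x => `|X i l x|%R]
              + \sum_(t < d) (2 `^ r t * B t)%R%:E *
                  ((2 `^ r t)%:E * 'E_P[fun x => `|X i l x|%R]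
                     * 'E_P[fun x => (`|W t x| `^ r t)%R]
                   + (2 `^ r t / n%:R `^ (r t / 2))%R%:E
                     * 'E_P[fun x => (`|X i l x| * `|X i t x| `^ r t)%R]
                   + 'E_Q[fun y => (`|SZ y t 0| `^ r t)%R]
                     * 'E_P[fun x => `|X i l x|%R]))))%E.
Proof.
move=> W Sigma SZ Sigma_nonneg SE g_CP h_Cb.
(* a single order of growth for all coordinates; its moments are assumed *)
pose k0 := [arg max_(k > Ordinal d_gt0) r k]%O; pose q := r k0.
have rq t : r t <= q by rewrite /q /k0; case: arg_maxP => // m _; exact.
have q0 : 0 <= q by exact: r_ge0.
have X_mom i j : P.-integrable setT (EFin \o (fun x => `|X i j x| `^ (q + 3))).
  apply/integrableP; split.
    apply/measurable_EFinP; apply: (measurableT_comp (measurable_powR _)).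
    by apply: (measurableT_comp (normr_measurable (D := setT))); exact: measurable_funPT.
  have := X_moments i j k0; rewrite unlock; apply: le_lt_trans.
  rewrite le_eqVlt; apply/orP; left; apply/eqP.
  by apply: eq_integral => x _; rewrite gee0_abs// lee_fin powR_ge0.
have NX1 := sample_size_ge1 X.
have dX i j := dominated_sample X i j.
have dXX i j k : dominated (sample_size X) (1 + 1) (fun x => X i j x * X i k x).
  exact: dominatedM.
have dXXX i j k l : dominated (sample_size X) (1 + 1 + 1) (fun x => `|X i j x * X i k x * X i l x|).
  by apply: dominated_abs; exact: dominatedM.
have dabs i l : dominated (sample_size X) 1 (fun x => `|X i l x|) by exact: dominated_abs.
have q1 : 1 <= q + 3 by lra.
have q2 : 1 + 1 <= q + 3 by lra.
have m0 i j : \int[P]_x X i j x = 0.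
  by have := X_mean0 i j; rewrite (expectation_Rintegral (sample_integrable q0 X_mom q1 (dX i j))) => -[].
have dW j := dominated_normalized_sum X j.
have EW j : 'E_P[W j]%E = 0%E.
  rewrite (expectation_Rintegral (sample_integrable q0 X_mom q1 (dW j))).
  have iX i := sample_integrable q0 X_mom q1 (dX i j).
  rewrite /W /normalized_sum RintegralZl//; last exact: integrable_fsum.
  by rewrite Rintegral_fsum// big1 ?mulr0.
have [[S_sym _] SSE] := SE.
have SS j k : (S *m S) j k = \int[P]_x (normalized_sum X j x * normalized_sum X k x).
  have W0 l : W l \- cst 0 = W l by apply/funext => x; rewrite /= subr0.
  by rewrite SSE mxE unlock !EW /= !W0 /Rintegral unlock.
have growth0 w : 0 <= growth A B r w by exact: growth_ge0.
have [D1 [D2 [D3 [gD gB]]]] := CP_third_order_partials growth0 g_CP.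
pose p w := growth A B r w `^ 3^-1.
have p0 w : 0 <= p w by exact: powR_ge0.
have p3 w : p w ^+ 3 = growth A B r w.
  by rewrite -powR_mulrn// -powRrM mulVf// powRr1.
have pq : pgrowth q (growth (1 + A) B r) by apply: pgrowth_growth => //; rewrite addr_ge0.
have p1A w : 1 + growth A B r w = growth (1 + A) B r w by rewrite /growth addrA.
have p_le w : p w <= growth (1 + A) B r w.
  by rewrite -p1A; have [] := growth_cube_root (p0 w) (p3 w).
have p2_le w : p w ^+ 2 <= growth (1 + A) B r w.
  by rewrite -p1A; have [] := growth_cube_root (p0 w) (p3 w).
pose E3 := third_moment_bracket X Z S A B r.
pose m i j k := \int[P]_x (X i j x * X i k x).
pose F i j k l := E3 i (fun x => `|X i j x * X i k x * X i l x|) +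
  2 * `|m i j k| * E3 i (fun x => `|X i l x|).
pose Sum := \sum_i \sum_j \sum_k \sum_l F i j k l.
have E3_ge0 i phi : (forall x, 0 <= phi x) -> 0 <= E3 i phi.
  exact: third_moment_bracket_ge0.
have F0 i j k l : 0 <= F i j k l by rewrite addr_ge0 ?E3_ge0// !mulr_ge0 ?E3_ge0.
have -> : (\sum_(i < n) \sum_(j < d) \sum_(k < d) \sum_(l < d)
        (A%:E * 'E_P[fun x => `|X i j x * X i k x * X i l x|%R]
         + \sum_(t < d) (2 `^ r t * B t)%R%:E *
             ((2 `^ r t)%:E * 'E_P[fun x => `|X i j x * X i k x * X i l x|%R]
                * 'E_P[fun x => (`|W t x| `^ r t)%R]
              + (2 `^ r t / n%:R `^ (r t / 2))%R%:E
                * 'E_P[fun x => (`|X i j x * X i k x * X i l x|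
                                 * `|X i t x| `^ r t)%R]
              + 'E_Q[fun y => (`|SZ y t 0| `^ r t)%R]
                * 'E_P[fun x => `|X i j x * X i k x * X i l x|%R])
         + 2%:E * `| 'E_P[fun x => (X i j x * X i k x)%R] | *
             (A%:E * 'E_P[fun x => `|X i l x|%R]
              + \sum_(t < d) (2 `^ r t * B t)%R%:E *
                  ((2 `^ r t)%:E * 'E_P[fun x => `|X i l x|%R]
                     * 'E_P[fun x => (`|W t x| `^ r t)%R]
                   + (2 `^ r t / n%:R `^ (r t / 2))%R%:E
                     * 'E_P[fun x => (`|X i l x| * `|X i t x| `^ r t)%R]
                   + 'E_Q[fun y => (`|SZ y t 0| `^ r t)%R]
                     * 'E_P[fun x => `|X i l x|%R]))) = Sum%:E)%E.
  rewrite /Sum -sumEFin; apply: eq_bigr => i _; rewrite -sumEFin; apply: eq_bigr => j _.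
  rewrite -sumEFin; apply: eq_bigr => k _; rewrite -sumEFin; apply: eq_bigr => l _.
  have k3 : 0 <= 1 + 1 + 1 :> R by lra.
  have k33 : 1 + 1 + 1 <= 3 :> R by lra.
  have k13 : 1 <= 3 :> R by lra.
  have e1 := expectation_third_moment_bracket S q0 X_mom Z_normal A B r_ge0 rq i k3 k33 (dXXX i j k l).
  have e2 := expectation_third_moment_bracket S q0 X_mom Z_normal A B r_ge0 rq i ler01 k13 (dabs i l).
  have e3 := expectation_Rintegral (sample_integrable q0 X_mom q2 (dXX i j k)).
  transitivity ((E3 i (fun x => `|X i j x * X i k x * X i l x|))%:E +
    2%:E * `|(m i j k)%:E| * (E3 i (fun x => `|X i l x|))%:E)%E; last by [].
  congr (_ + _ * `|_| * _)%E; [exact: e1|exact: e3|exact: e2].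
have [n0 c0] : 0 < n%:R `^ (3 / 2) :> R /\ 0 < (6 * n%:R `^ (3 / 2))^-1 :> R.
  have n0 : 0 < n%:R `^ (3 / 2) :> R by rewrite powR_gt0// ltr0n.
  by split=> //; rewrite invr_gt0 mulr_gt0.
have Sum0 : 0 <= Sum.
  by do 4 (apply: sumr_ge0 => ? _).
have gc : continuous g.
  case: gD => h1 _ _; apply: (pgrowth_continuous q0 h1) => i.
  apply: (pgrowth_le ler01 _ pq) => w; rewrite mul1r; apply: le_trans (p_le w).
  by have [] := gB i i i w.
have dh j x : (j < 3)%N -> is_derive x (1 : R) (h^`(j))%classic ((h^`(j.+1))%classic x).
  by move=> j3; exact: (Cb_is_derive x h_Cb j3).
(* an infinite constant h_3 only leaves the case in which the sum of brackets is 0,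
   where the right-hand side is 0 and both expectations equal h (g 0) *)
have [hoo|[b1 [b2 [b3 [hE hb1 hb2 hb3]]]]] := stirling_norm3_cases h_Cb.
  have [S0|Spos] := eqVneq Sum 0; last first.
    rewrite hoo -muleA gt0_mulye ?leey// -EFinM lte_fin mulr_gt0//.
    by rewrite lt_def Spos.
  have E0 i j : E3 i (fun x => `|X i j x * X i j x * X i j x|) = 0.
    apply/eqP; rewrite eq_le E3_ge0// andbT -S0 /Sum.
    have S1 i' j' k : 0 <= \sum_l F i' j' k l by apply: sumr_ge0.
    have S2 i' j' : 0 <= \sum_k \sum_l F i' j' k l by apply: sumr_ge0.
    have S3 i' : 0 <= \sum_j \sum_k \sum_l F i' j k l by apply: sumr_ge0.
    apply: (@le_trans _ _ (F i j j j)); first by rewrite lerDl !mulr_ge0 ?E3_ge0.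
    have le1 (I : finType) (G : I -> R) k : (forall k, 0 <= G k) -> G k <= \sum_k G k.
      by move=> G0; rewrite (bigD1 k)//= lerDl sumr_ge0.
    apply: le_trans (le1 _ _ j (F0 i j j)) _; apply: le_trans (le1 _ _ j (S1 i j)) _.
    by apply: le_trans (le1 _ _ j (S2 i)) _; exact: (le1 _ _ i S3).
  have D10 i v : growth A B r v = 0 -> D1 i v = 0.
    move=> v0; have [+ _ _] := gB i i i v.
    by rewrite v0 powR0 ?invr_neq0// normr_le0 => /eqP.
  have [h1 _ _] := gD.
  have [hW hV] := degenerate_values q0 X_mom Z_normal S_sym SS A_ge0 B_ge0 r_ge0 rq h1 D10 E0.
  have hc : continuous h.
    move=> x; apply: differentiable_continuous; apply/derivable1_diffP.
    exact: (@ex_derive _ _ _ _ _ _ _ (dh 0%N x isT)).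
  have hgc : continuous (h \o g).
    by move=> w; apply: continuous_comp; [exact: gc|exact: hc].
  have -> : 'E_P[fun x => h (g (\col_(j < d) W j x))]%E = (h (g 0))%:E.
    apply: expectation_ae_cst; last by apply: filterS hW => x ->.
    by apply: (measurable_continuous_col _ hgc) => j; have [] := dW j.
  have -> : 'E_Q[fun y => h (g (SZ y))]%E = (h (g 0))%:E.
    apply: expectation_ae_cst; last by apply: filterS hV => y ->.
    have SZc y : SZ y = \col_j SZ y j 0.
      by apply/matrixP => j k; rewrite mxE (ord1 k).
    under eq_fun do rewrite SZc.
    apply: (measurable_continuous_col _ hgc) => j.
    by have [] := dominated_gaussian_image Z S j.
  by rewrite S0 mule0 subee// abse0.
have b0 (f : R -> R) b : (forall x, `|f x| <= b) -> 0 <= b by move=> /(_ 0); exact: le_trans.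
have b10 := b0 _ _ hb1; have b20 := b0 _ _ hb2; have b30 := b0 _ _ hb3.
pose H := b1 + 3 * b2 + b3.
have H0 : 0 <= H by rewrite !addr_ge0// mulr_ge0.
have gB' i j k w : [/\ `|D1 i w| <= p w, `|D2 i j w| <= p w ^+ 2 & `|D3 i j k w| <= p w ^+ 3].
  by rewrite p3.
have [E1 [E2 [E3' [fD fB]]]] := third_order_partials_comp b10 b20 b30 p0
  (fun x => dh 0%N x isT) (fun x => dh 1%N x isT) (fun x => dh 2%N x isT) hb1 hb2 hb3 gD gB'.
have E1g i : pgrowth q (E1 i).
  apply: (pgrowth_le b10 _ pq) => w; have [fb _ _] := fB i i i w.
  by apply: (le_trans fb); rewrite ler_wpM2l.
have E2g i j : pgrowth q (E2 i j).
  apply: (pgrowth_le (addr_ge0 b20 b10) _ pq) => w; have [_ fb _] := fB i j i w.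
  by apply: (le_trans fb); rewrite ler_wpM2l// addr_ge0.
have E3b i j k w : `|E3' i j k w| <= H * growth A B r w.
  by have [_ _] := fB i j k w; rewrite p3.
have main := gaussian_comparison X_indep m0 q0 X_mom Z_normal S_sym SS fD H0 A_ge0 B_ge0
  r_ge0 rq E3b E1g E2g.
have eW := expectation_Rintegral (sum_test_integrable q0 X_mom fD E1g).
have eV := expectation_Rintegral (gaussian_test_integrable S q0 Z_normal fD E1g).
have -> : 'E_P[fun x => h (g (\col_(j < d) W j x))]%E = (\int[P]_x (h \o g) (\col_j W j x))%:E.
  exact: eW.
have -> : 'E_Q[fun y => h (g (SZ y))]%E = (\int[Q]_y (h \o g) (SZ y))%:E by exact: eV.
rewrite hE -EFinB abse_EFin -!EFinM lee_fin; apply: (le_trans main).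
rewrite le_eqVlt; apply/orP; left; apply/eqP.
have -> : \sum_i \sum_j \sum_k \sum_l
    (E3 i (fun x => `|X i j x * X i k x * X i l x|) / 2 + `|m i j k| * E3 i (fun x => `|X i l x|))
    = Sum / 2.
  rewrite /Sum !mulr_suml; apply: eq_bigr => i _; rewrite mulr_suml; apply: eq_bigr => j _.
  rewrite mulr_suml; apply: eq_bigr => k _; rewrite mulr_suml; apply: eq_bigr => l _.
  by rewrite /F; field.
have -> : n%:R `^ (3 / 2) = Num.sqrt n%:R ^+ 3 :> R.
  by rewrite mulrC powRrM powR12_sqrt// powR_mulrn// sqrtr_ge0.
have sn0 : Num.sqrt n%:R != 0 :> R by rewrite gt_eqF// sqrtr_gt0 ltr0n.
by rewrite -/H; field.
Qed.
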